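(* Let $\delta>0$ and $\beta>0$. For $\lambda\in\mathbb R$ let $\alpha_\lambda(u)$, $u\in(-\infty,\infty)$, be the strong solution of $$d\alpha_\lambda = \lambda\tfrac{\beta}{4}e^{\frac{\beta}{4}u}\, du + \Re[(e^{-i\alpha_\lambda(u)}-1)(dZ-i\delta\, du)],\qquad \lim_{u\to-\infty}\alpha_\lambda(u)=0,$$ where $Z$ is a two-sided complex Brownian motion. Then the one-point function (density) of the $\mathrm{HP}_{\beta,\delta}$ process is given by $$\rho^{(1)}_{\beta,\delta}(\lambda)=\frac{1}{2\pi}+\frac{1}{\pi}\sum_{k=1}^\infty \frac{(-\delta)^{\uparrow k}}{(1+\delta)^{\uparrow k}}\, E[\cos(k \alpha_\lambda(0))].$$
   Context: For $x\in\mathbb{R}$ and an integer $k\ge 0$, $(x)^{\uparrow k}=\prod_{j=0}^{k-1}(x+j)$, with the empty product equal to 1. $Z$ is a two-sided complex Brownian motion with independent standard real and imaginary parts, and the same $Z$ drives the equation for all $\lambda\in\mathbb R$; the equation with the given condition at $-\infty$ has a unique strong solution, and almost surely $\lambda\mapsto\alpha_\lambda(0)$ is analytic and strictly increasing. Let $\Theta\in[0,2\pi)$ be a random variable independent of $Z$ with probability density $\frac{1}{2\pi}\frac{\Gamma(1+\delta)^2}{\Gamma(1+2\delta)}(1-e^{-i\theta})^{\delta}(1-e^{i\theta})^{\delta}$. The $\mathrm{HP}_{\beta,\delta}$ process is the point process $\{\lambda\in\mathbb R:\alpha_\lambda(0)=\Theta \bmod 2\pi\}$. Its one-point function $\rho^{(1)}_{\beta,\delta}$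 is the Radon–Nikodym derivative of $A\mapsto E[\mathrm{HP}_{\beta,\delta}(A)]$ (expected number of points in $A$) with respect to Lebesgue measure; it is determined up to null sets and the formula gives a version. *)

(* Defs.v *)
From HB Require Import structures.
From mathcomp Require Import all_boot all_order all_algebra.
From mathcomp Require Import all_classical all_reals all_analysis.
From mathcomp.real_closed Require Import complex.
Set Implicit Arguments.
Unset Strict Implicit.
Unset Printing Implicit Defensive.
Import Order.TTheory GRing.Theory Num.Theory numFieldNormedType.Exports.
Import complex.
#[local] Arguments Re {R} _.
#[local] Arguments Im {R} _.
Local Open Scope classical_set_scope.
Local Open Scope complex_scope.
Local Open Scope ring_scope.

Section special_functions.
Context {R : realType}.

Definition rising (x : R) (k : nat) : R := \prod_(j < k) (x + j%:R).

Definition Gamma (x : R) : R :=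
  \int[lebesgue_measure]_(t in `]0, +oo[) (t `^ (x - 1) * expR (- t)).

(* e^{ia} *)
Definition expi (a : R) : R[i] := cos a +i* sin a.

Definition cnorm (z : R[i]) : R := Num.sqrt (Re z ^+ 2 + Im z ^+ 2).

(* principal argument, in ]-pi, pi]; cpow does not depend on its value at 0 *)
Definition carg (z : R[i]) : R :=
  if 0 <= Im z then acos (Re z / cnorm z) else - acos (Re z / cnorm z).

(* principal branch of z^r, with 0^r = 0 for r <> 0 *)
Definition cpow (z : R[i]) (r : R) : R[i] :=
  (cnorm z `^ r)%:C * expi (r * carg z).

(* The complex number below is real, so Re is only a cast. *)
Definition Theta_pdf (delta theta : R) : R :=
  Re (((2 * pi)^-1)%:C
      * (Gamma (1 + delta) ^+ 2 / Gamma (1 + 2 * delta))%:C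
      * cpow (1 - expi (- theta)) delta * cpow (1 - expi theta) delta).

Definition real_analytic (f : R -> R) : Prop :=
  forall x, exists c : nat -> R, exists2 r : R, 0 < r &
    forall h, `|h| < r -> series (fun n => c n * h ^+ n) @ \oo --> f (x + h).

End special_functions.

Section sigma_algebras.
Context {R : realType} {d : measure_display} {T : measurableType d}.
Variable P : probability T R.
Implicit Types (F G : set (set T)) (Z : R -> T -> R[i]).

(* sigma-algebra generated by a family of real functions *)
Definition sigma_of (X : set (T -> R)) : set (set T) :=
  <<s [set A | exists2 f, X f & preimage_set_system setT f measurable A] >>.

Definition measurable_wrt F (f : T -> R) : Prop :=
  forall A : set R, measurable A -> F (f @^-1` A).

Definition cmeasurable_wrt F (f : T -> R[i]) : Prop :=
  measurable_wrt F (Re \o f) /\ measurable_wrt F (Im \o f).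

Definition independent F G : Prop :=
  forall A B, F A -> G B -> P (A `&` B) = (P A * P B)%E.

(* augmentation by null sets, inside the ambient sigma-algebra of T *)
Definition completed F : set (set T) :=
  [set A | measurable A /\
    exists2 B, F B & P.-negligible ((A `\` B) `|` (B `\` A))].

Definition sigma_all Z : set (set T) :=
  sigma_of [set f | exists u, f = Re \o Z u \/ f = Im \o Z u].

(* The past of a two-sided Brownian motion up to u: it is generated by the
   increments of Z before u and not by the values Z v, v <= u, because the
   normalization Z 0 = 0 makes the latter anticipate when u < 0. *)
Definition past Z (u : R) : set (set T) :=
  completed (sigma_of [set f | exists v w, [/\ v <= u, w <= u &
    f = Re \o (Z v \- Z w) \/ f = Im \o (Z v \- Z w)]]).

End sigma_algebras.

Section brownian_motion.
Context {R : realType} {d : measure_display} {T : measurableType d}.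
Variable P : probability T R.

Record two_sided_BM (B : R -> T -> R) : Prop := {
  BM_measurable : forall u, measurable_fun setT (B u) ;
  BM_zero : {ae P, forall w, B 0 w = 0} ;
  (* the second parameter of normal_prob is the standard deviation *)
  BM_normal : forall (s t : R) (A : set R), s < t -> measurable A ->
    P ((B t \- B s) @^-1` A) = normal_prob 0 (Num.sqrt (t - s)) A ;
  BM_indep : forall (n : nat) (t : nat -> R) (A : nat -> set R),
    {homo t : i j / (i <= j)%N >-> i <= j} -> (forall k, measurable (A k)) ->
    P (\bigcap_(k < n) ((B (t k.+1) \- B (t k)) @^-1` A k)) =
    (\prod_(k < n) P ((B (t k.+1) \- B (t k))%R @^-1` A k))%E ;
  BM_continuous : {ae P, forall w, continuous (B ^~ w)} }.

Record two_sided_complex_BM (Z : R -> T -> R[i]) : Prop := {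
  CBM_Re : two_sided_BM (fun u => Re \o Z u) ;
  CBM_Im : two_sided_BM (fun u => Im \o Z u) ;
  CBM_indep : independent P (sigma_of [set f | exists u, f = Re \o Z u])
                            (sigma_of [set f | exists u, f = Im \o Z u]) }.

End brownian_motion.

Section ito.
Context {R : realType} {d : measure_display} {T : measurableType d}.
Variables (P : probability T R) (Z : R -> T -> R[i]).

(* bounded simple process on [s, t]: the value is simple_val k, known at time
   grid k, on the interval ]grid k, grid k.+1], for k < steps *)
Record simple_process (s t : R) := SimpleProcess {
  steps : nat ;
  grid : nat -> R ;
  simple_val : nat -> T -> R[i] ;
  grid_start : grid 0%N = s ;
  grid_end : grid steps = t ;
  grid_le : forall k, (k < steps)%N -> grid k <= grid k.+1 ;
  simple_bounded : exists M : R,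
    forall k w, (k < steps)%N -> cnorm (simple_val k w) <= M ;
  simple_adapted : forall k, (k < steps)%N ->
    cmeasurable_wrt (past P Z (grid k)) (simple_val k) }.

Definition simple_eval s t (S : simple_process s t) (u : R) (w : T) : R[i] :=
  \sum_(k < steps S)
    (\1_`]grid S k, grid S k.+1] u)%:C * simple_val S k w.

Definition simple_integral s t (S : simple_process s t) (w : T) : R[i] :=
  \sum_(k < steps S)
    simple_val S k w * (Z (grid S k.+1) w - Z (grid S k) w).

(* I is (a version of) the Ito integral of H dZ over [s, t]: the L^2 limit of
   the integrals of simple processes that approximate H in L^2(du x P); it is
   used only for bounded, adapted, almost surely continuous H. *)
Definition is_ito_integral (s t : R) (H : R -> T -> R[i]) (I : T -> R[i]) :
    Prop :=
  cmeasurable_wrt (past P Z t) I /\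
  exists S : nat -> simple_process s t,
    ((\int[P]_w \int[lebesgue_measure]_(u in `[s, t])
        (cnorm (simple_eval (S n) u w - H u w) ^+ 2)%:E)%E
       @[n --> \oo] --> 0%E) /\
    ((\int[P]_w (cnorm (simple_integral (S n) w - I w) ^+ 2)%:E)%E
       @[n --> \oo] --> 0%E).

(* Strong solution of
     da = lambda (beta/4) e^{(beta/4) u} du + Re[(e^{-ia} - 1)(dZ - i delta du)]
   on the real line with a(-oo) = 0. *)
Record strong_solution (beta delta lambda : R) (a : R -> T -> R) : Prop := {
  sol_adapted : forall u, measurable_wrt (past P Z u) (a u) ;
  sol_continuous : {ae P, forall w, continuous (a ^~ w)} ;
  sol_start : {ae P, forall w, a u w @[u --> -oo] --> 0} ;
  sol_sde : forall s t, s <= t -> exists2 I : T -> R[i],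
    is_ito_integral s t (fun u w => expi (- a u w) - 1) I &
    {ae P, forall w, a t w - a s w =
      \int[lebesgue_measure]_(u in `[s, t])
         (lambda * (beta / 4) * expR (beta / 4 * u)
          + Re ((expi (- a u w) - 1) * (- ('i%C * delta%:C))))
      + Re (I w)} }.

End ito.

Section point_process.
Context {R : realType} {d : measure_display} {T : measurableType d}.
Variable P : probability T R.

Definition Theta_law (delta : R) (Theta : T -> R) : Prop :=
  [/\ measurable_fun setT Theta,
      forall w, 0 <= Theta w < 2 * pi &
      forall A : set R, measurable A ->
        P (Theta @^-1` A) =
        (\int[lebesgue_measure]_(x in A `&` `[0%R, (2 * pi)%R[)
           (Theta_pdf delta x)%:E)%E].

Definition HP_process (alpha : R -> R -> T -> R) (Theta : T -> R) (w : T) :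
    set R :=
  [set lambda | exists n : int, alpha lambda 0 w = Theta w + 2 * pi * n%:~R].

(* rho is a version of the density of A |-> E[N(A)], where N(A) is the number of
   points of the random set N in A; that measure need not be finite, so the
   library's Radon-Nikodym derivative of a charge does not apply. *)
Definition one_point_function (N : T -> set R) (rho : R -> R) : Prop :=
  [/\ measurable_fun setT rho, forall x, 0 <= rho x &
      forall A : set R, measurable A ->
        (\int[P]_w counting (N w `&` A))%E =
        (\int[lebesgue_measure]_(x in A) (rho x)%:E)%E].

End point_process.

(* Main.v *)
(* Let S be the 2 pi-periodic density of Theta and T its integral from 0. The
   Fourier coefficients of S are proportional to (-delta)^{up k} / (1+delta)^{up k}.

   As lambda |-> alpha_lambda(0) is continuous and increasing and Theta is
   independent of it, the expected number of points in ]p, q] is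
   E[T(alpha_q(0))] - E[T(alpha_p(0))].

   By Ito's formula the moments E[exp(i k alpha_lambda(u))] satisfy an infinite
   linear system of differential equations in u, and a weighted energy estimate
   gives uniqueness and continuity in lambda. By uniqueness the moments depend only
   on lambda e^{beta u / 4}. In the derivative of E[T(alpha_lambda(u))] the recurrence
   of the coefficients makes everything but the drift in lambda telescope to zero:
   d/du E[T(alpha_lambda(u))] = lambda (beta/4) e^{beta u / 4} E[S(alpha_lambda(u))].
   In the variable x = lambda e^{beta u / 4} this says that E[T(alpha_lambda(0))] is the
   integral over x in [0, lambda] of E[S(alpha_x(0))], the claimed intensity. *)

(* The obstacle is that the system of moments is infinite and couples mode k to its neighbours with
   coefficients of order k^2, so no Lipschitz estimate applies. The energy is a sum of squares with
   weights of order k^(-1-2p), p being delta capped at 1/2: they decay fast enough for the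
   truncation term to vanish, and slowly enough for the quadratic form to be nonpositive.

   A moment is differentiable in u because its increment over [s, t] is known up to an error of
   order (t - s)^(3/2), obtained by freezing the coefficients of the equation at s.

   The linear part of T requires alpha_lambda(u) to be integrable, while the condition at -oo is
   only an almost sure limit. Integrability comes from decay: the unit increments have mean of order
   e^{beta u/16} and are summed backwards in time.

   For the count, points are labelled by the multiple of 2 pi added to Theta. The path increases in
   lambda, so each label has at most one point, and the expected count becomes a series of
   probabilities that need be computed on ]p, q] only. *)
Require Import Defs.
From HB Require Import structures.
From mathcomp Require Import all_boot all_order all_algebra.
From mathcomp Require Import all_classical all_reals all_analysis.
From mathcomp Require Import measurable_realfun.
From mathcomp.real_closed Require Import complex.
From mathcomp Require Import ring lra.
Set Implicit Arguments.
Unset Strict Implicit.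
Unset Printing Implicit Defensive.
Import Order.TTheory GRing.Theory Num.Theory numFieldNormedType.Exports.
Import complex.
#[local] Arguments Re {R} _.
#[local] Arguments Im {R} _.
Local Open Scope classical_set_scope.
Local Open Scope complex_scope.
Local Open Scope ring_scope.

(** * Independence and the past of Brownian motion *)

Section independence.
Context {R : realType} {d : measure_display} {T : measurableType d}.
Variable P : probability T R.

Definition indep_event (F : set (set T)) (E : set T) : Prop :=
  forall A, F A -> P (A `&` E) = (P A * P E)%E.

(** Dynkin's argument: the events independent of [E] form a lambda-system, and [G] is a pi-system
    inside it. *)
Lemma indep_event_generated (G : set (set T)) (E : set T) :
  G `<=` measurable -> setI_closed G -> measurable E ->
  indep_event G E -> indep_event <<s G >> E.
Proof.
move=> mG GI mE GE.
pose H := [set A | measurable A /\ P (A `&` E) = (P A * P E)%E].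
suff GH : <<s G >> `<=` H by move=> A /GH[].
have Pfin (A : set T) : measurable A -> P A \is a fin_num by exact: fin_num_measure.
have Plty (A : set T) : measurable A -> (P A < +oo)%E.
  by move=> mA; rewrite ltey_eq Pfin.
apply: lambda_system_subset => //.
- split => //.
  + by split => //; rewrite setTI probability_setT mul1e.
  + move=> A B BA [mA PA] [mB PB]; split; first exact: measurableD.
    have -> : (A `\` B) `&` E = (A `&` E) `\` (B `&` E).
      apply/seteqP; split => x /=; first by move=> [[Ax nBx] Ex]; split => // -[].
      by move=> [[Ax Ex] nBE]; split => //; split => // Bx; apply: nBE.
    rewrite measureD //; [|exact: measurableI|exact: measurableI|by apply: Plty; exact: measurableI].
    rewrite (setIidr (@setSI _ E _ _ BA)).
    rewrite [in RHS]measureD //; last exact: Plty.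
    rewrite (setIidr BA) -[LHS]/(P (A `&` E) - P (B `&` E))%E PA PB.
    rewrite muleBl //; first exact: fin_num_measure.
    by apply: fin_num_adde_defr; exact: fin_num_measure.
  + move=> F ndF FH.
    have mF n : measurable (F n) by have [] := FH n.
    have mU : measurable (\bigcup_n F n) by exact: bigcupT_measurable.
    split => //.
    have c1 : P (F n `&` E) @[n --> \oo] --> P (\bigcup_n F n `&` E).
      rewrite setI_bigcupl; apply: nondecreasing_cvg_mu.
      - by move=> n; exact: measurableI.
      - by rewrite -setI_bigcupl; exact: measurableI.
      - by move=> m n mn; apply/subsetPset; apply: setSI; apply/subsetPset; exact: ndF.
    have c2 : (P (F n) * P E)%E @[n --> \oo] --> (P (\bigcup_n F n) * P E)%E.
      apply: cvgeM.
      - by rewrite mule_def_fin // ?Pfin.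
      - exact: nondecreasing_cvg_mu.
      - exact: cvg_cst.
    have e : (fun n => P (F n `&` E)) = (fun n => (P (F n) * P E)%E).
      by apply/funext => n; have [] := FH n.
    rewrite e in c1.
    exact: (cvg_unique _ c1 c2).
- by move=> A GA; split; [exact: mG|exact: GE].
Qed.

Section pair.
Context {d1 d2 : measure_display} {T1 : measurableType d1} {T2 : measurableType d2}.
Variables (G : T -> T1) (X : T -> T2).
Hypotheses (mG : measurable_fun setT G) (mX : measurable_fun setT X).
Hypothesis indGX : forall (A : set T1) (B : set T2), measurable A -> measurable B ->
  P (G @^-1` A `&` X @^-1` B) = (P (G @^-1` A) * P (X @^-1` B))%E.

Let G' : {mfun T >-> T1} := HB.pack G (isMeasurableFun.Build _ _ _ _ _ mG).
Let X' : {mfun T >-> T2} := HB.pack X (isMeasurableFun.Build _ _ _ _ _ mX).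
Let mGX : measurable_fun setT (fun w => (G w, X w)).
Proof. exact: measurable_fun_pair. Qed.
Let GX' : {mfun T >-> (T1 * T2)%type} :=
  HB.pack (fun w => (G w, X w)) (isMeasurableFun.Build _ _ _ _ _ mGX).

Let jointE (A : set (T1 * T2)) : measurable A ->
  (distribution P G' \x distribution P X')%E A = distribution P GX' A.
Proof.
apply: product_measure_unique => B C mB mC.
by rewrite /distribution /pushforward /= -indGX.
Qed.

Let int_joint (h : T1 * T2 -> \bar R) :
  (\int[distribution P GX']_z h z =
   \int[distribution P G' \x distribution P X']_z h z)%E.
Proof. by apply: eq_measure_integral => A mA _; apply/esym; exact: jointE. Qed.

(** Independence makes the law of [(G, X)] the product of the two laws, and Tonelli's theorem gives
    the rest. The inner integral is again over [T], an independent copy of the sample space, so that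
    no distribution appears in the statement. *)
Lemma indep_ge0_integral (h : T1 * T2 -> \bar R) :
  measurable_fun setT h -> (forall z, 0 <= h z)%E ->
  (\int[P]_w h (G w, X w) = \int[P]_w \int[P]_v h (G w, X v))%E.
Proof.
move=> mh h0.
transitivity (\int[distribution P GX']_z h z)%E.
  by rewrite ge0_integral_distribution.
rewrite int_joint.
rewrite fubini_tonelli1 // ge0_integral_distribution //=; last 2 first.
- exact: measurable_fun_fubini_tonelli_F.
- by move=> y; exact: integral_ge0.
apply: eq_integral => w _; rewrite /fubini_F /= ge0_integral_distribution //.
exact: measurableT_comp.
Qed.

Lemma indep_integral (h : T1 * T2 -> \bar R) :
  measurable_fun setT h -> P.-integrable setT (fun w => h (G w, X w)) ->
  (forall w, P.-integrable setT (fun v => h (G w, X v))) ->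
  (\int[P]_w h (G w, X w) = \int[P]_w \int[P]_v h (G w, X v))%E.
Proof.
move=> mh ih ihx.
have ihp : (distribution P G' \x distribution P X')%E.-integrable setT h.
  apply/integrableP; split => //.
  rewrite -int_joint.
  rewrite ge0_integral_distribution //; last exact: measurableT_comp.
  by case/integrableP : ih.
rewrite -(integral_distribution (X := GX')) //.
rewrite int_joint.
rewrite -(integral12_prod_meas1 ihp).
have iE w : (\int[distribution P X']_y h (G w, y) = \int[P]_v h (G w, X v))%E.
  rewrite (integral_distribution (X := X')) //; last exact: ihx.
  exact: measurableT_comp.
rewrite (integral_distribution (X := G')) //=; last first.
- apply/integrableP; split.
    by apply: measurableT_comp => //; exact: measurable_fubini_F ihp.
  have /integrableP[_] := integrable_fubini_F ihp.
  rewrite ge0_integral_distribution //.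
  by apply: measurableT_comp => //; exact: measurable_fubini_F ihp.
- exact: measurable_fubini_F ihp.
by apply: eq_integral => w _; rewrite -iE.
Qed.

End pair.

End independence.

Section measurable_wrt.
Context {R : realType} {d : measure_display} {T : measurableType d}.
Implicit Types (F G : set (set T)) (f g : T -> R) (X : set (T -> R)).

(** Turns measurability with respect to a family of sets into measurability on a type that carries
    it as its sigma-algebra. The closure lemmas below follow by writing a sigma-algebra [F] as
    [<<s F>>]. *)
Lemma measurable_wrtP G f : measurable_wrt <<s G>> f <->
  measurable_fun (setT : set (g_sigma_algebraType G)) (f : g_sigma_algebraType G -> R).
Proof.
split=> [h _ A mA|h A mA]; first by rewrite setTI; exact: h.
by rewrite -[X in <<s G>> X]setTI; exact: h.
Qed.

Lemma measurable_wrt_comp F f (phi : R -> R) : sigma_algebra setT F ->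
  measurable_fun setT phi -> measurable_wrt F f -> measurable_wrt F (phi \o f).
Proof.
move=> sF; rewrite -(sigma_algebra_id sF) => mphi /measurable_wrtP mf.
by apply/measurable_wrtP; exact: measurableT_comp.
Qed.

Lemma measurable_wrt_cst F (c : R) : sigma_algebra setT F -> measurable_wrt F (cst c).
Proof.
move=> sF; rewrite -(sigma_algebra_id sF).
by apply/measurable_wrtP; exact: measurable_cst.
Qed.

Lemma measurable_wrtD F f g : sigma_algebra setT F ->
  measurable_wrt F f -> measurable_wrt F g -> measurable_wrt F (f \+ g).
Proof.
move=> sF; rewrite -(sigma_algebra_id sF) => /measurable_wrtP mf /measurable_wrtP mg.
by apply/measurable_wrtP; exact: measurable_funD.
Qed.

Lemma measurable_wrtB F f g : sigma_algebra setT F ->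
  measurable_wrt F f -> measurable_wrt F g -> measurable_wrt F (f \- g).
Proof.
move=> sF; rewrite -(sigma_algebra_id sF) => /measurable_wrtP mf /measurable_wrtP mg.
by apply/measurable_wrtP; exact: measurable_funB.
Qed.

Lemma measurable_wrtM F f g : sigma_algebra setT F ->
  measurable_wrt F f -> measurable_wrt F g -> measurable_wrt F (f \* g).
Proof.
move=> sF; rewrite -(sigma_algebra_id sF) => /measurable_wrtP mf /measurable_wrtP mg.
by apply/measurable_wrtP; exact: measurable_funM.
Qed.

Lemma measurable_wrtS F G f : F `<=` G -> measurable_wrt F f -> measurable_wrt G f.
Proof. by move=> FG mf A mA; apply: FG; exact: mf. Qed.

Lemma measurable_wrt_measurable F f : F `<=` measurable -> measurable_wrt F f ->
  measurable_fun setT f.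
Proof. by move=> Fm mf _ A mA; rewrite setTI; apply: Fm; exact: mf. Qed.

Lemma sigma_of_sub X F : sigma_algebra setT F ->
  (forall f, X f -> measurable_wrt F f) -> sigma_of X `<=` F.
Proof.
move=> sF h; apply: smallest_sub => // A [f Xf [B mB <-]].
by rewrite setTI; exact: h.
Qed.

Lemma sigma_of_mem X f : X f -> measurable_wrt (sigma_of X) f.
Proof.
move=> Xf A mA; apply: sub_sigma_algebra; exists f => //; exists A => //.
by rewrite setTI.
Qed.

Lemma sigma_of_sigma_algebra X : sigma_algebra setT (sigma_of X).
Proof. exact: smallest_sigma_algebra. Qed.

Lemma sigma_of_le X Y : X `<=` Y -> sigma_of X `<=` sigma_of Y.
Proof.
move=> XY; apply: sigma_of_sub; first exact: sigma_of_sigma_algebra.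
by move=> f Xf; apply: sigma_of_mem; exact: XY.
Qed.

Lemma sigma_of_measurable X : (forall f, X f -> measurable_fun setT f) ->
  sigma_of X `<=` measurable.
Proof.
move=> mX; apply: sigma_of_sub; first exact: sigma_algebra_measurable.
by move=> f Xf A mA; rewrite -[X in measurable X]setTI; exact: mX.
Qed.

End measurable_wrt.

Section completion.
Context {R : realType} {d : measure_display} {T : measurableType d}.
Variable P : probability T R.
Implicit Types F : set (set T).

Lemma completed_measurable F : completed P F `<=` measurable.
Proof. by move=> A []. Qed.

Lemma sub_completed F : F `<=` measurable -> F `<=` completed P F.
Proof.
move=> Fm A FA; split; first exact: Fm.
by exists A => //; rewrite setDv setU0; exact: negligible_set0.
Qed.

Lemma completed_le F G : F `<=` G -> completed P F `<=` completed P G.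
Proof. by move=> FG A [mA [B FB AB]]; split => //; exists B => //; exact: FG. Qed.

Lemma completed_sigma_algebra F : sigma_algebra setT F ->
  sigma_algebra setT (completed P F).
Proof.
move=> [F0 FC FU]; split.
- split; first exact: measurable0.
  by exists set0 => //; rewrite setDv setU0; exact: negligible_set0.
- move=> A [mA [B FB AB]]; split; first by rewrite setTD; exact: measurableC.
  exists (setT `\` B); first exact: FC.
  rewrite !setTD; apply: negligibleS AB => x /= [[nA nnB]|[nB nnA]].
  + by right; split => //; apply: contrapT.
  + by left; split => //; apply: contrapT.
- move=> A hA; split.
    by apply: bigcupT_measurable => n; have [] := hA n.
  have /choice[B hB] : forall n, exists B, F B /\
      P.-negligible ((A n `\` B) `|` (B `\` A n)).
    by move=> n; have [_ [B FB AB]] := hA n; exists B.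
  exists (\bigcup_n B n); first by apply: FU => n; have [] := hB n.
  apply: (@negligibleS _ _ _ _ (\bigcup_n ((A n `\` B n) `|` (B n `\` A n)))).
    move=> x /= [[[n _ Ax] nB]|[[n _ Bx] nA]]; exists n => //.
      by left; split => // Bx; apply: nB; exists n.
    by right; split => // Ax; apply: nA; exists n.
  by apply: negligible_bigcup => n; have [] := hB n.
Qed.

Lemma completed_null F A : sigma_algebra setT F -> measurable A ->
  P A = 0%E -> completed P F A.
Proof.
move=> [F0 _ _] mA PA; split => //; exists set0 => //.
by rewrite setD0 set0D setU0; exists A; split.
Qed.

Lemma measure_symdiff A B E : measurable A -> measurable B -> measurable E ->
  P.-negligible ((A `\` B) `|` (B `\` A)) -> P (A `&` E) = P (B `&` E).
Proof.
move=> mA mB mE.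
have h (C D : set T) : measurable C -> measurable D ->
    P.-negligible ((C `\` D) `|` (D `\` C)) -> (P (C `&` E) <= P (D `&` E))%E.
  move=> mC mD nCD.
  have n0 : P (C `\` D) = 0%E.
    apply/measure_negligible; first exact: measurableD.
    by apply: negligibleS nCD => x; left.
  apply: (@le_trans _ _ (P ((D `&` E) `|` (C `\` D)))).
    apply: le_measure; rewrite ?inE.
    - exact: measurableI.
    - by apply: measurableU; [exact: measurableI|exact: measurableD].
    - by move=> x [Cx Ex]; have [Dx|nDx] := pselect (D x); [left|right].
  rewrite measureU0 //; [exact: measurableI|exact: measurableD].
move=> nAB; apply/eqP; rewrite eq_le; apply/andP; split; first exact: h.
by apply: h => //; rewrite setUC.
Qed.

Lemma indep_event_completed F E : F `<=` measurable -> measurable E ->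
  indep_event P F E -> indep_event P (completed P F) E.
Proof.
move=> Fm mE hF A [mA [B FB AB]].
have mB := Fm _ FB.
rewrite (measure_symdiff mA mB mE AB) hF //; congr (_ * _)%E.
by have := measure_symdiff mA mB measurableT AB; rewrite !setIT.
Qed.

Lemma completed_mem (X : set (T -> R)) f : X f ->
  (forall g, X g -> measurable_fun setT g) ->
  measurable_wrt (completed P (sigma_of X)) f.
Proof.
move=> Xf mX; apply: (measurable_wrtS (F := sigma_of X)); last exact: sigma_of_mem.
by apply: sub_completed; exact: sigma_of_measurable.
Qed.

End completion.

(** * Independence of Brownian increments from the past *)

Section brownian_past.
Context {R : realType} {d : measure_display} {T : measurableType d}.
Variable P : probability T R.

Section real_BM.
Variable B : R -> T -> R.
Hypothesis BM : two_sided_BM P B.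

Let mB u : measurable_fun setT (B u). Proof. exact: (BM_measurable BM). Qed.

Let minc u v : measurable_fun setT (B u \- B v).
Proof. exact: measurable_funB. Qed.

Let minc_event u v (C : set R) : measurable C -> measurable ((B u \- B v) @^-1` C).
Proof. by move=> mC; rewrite -[X in measurable X]setTI; exact: minc. Qed.

(** [BM_indep] concerns consecutive increments along one nondecreasing grid; for a fixed grid the
    events it speaks of are stable under intersection. *)
Let rect (t : nat -> R) (n : nat) : set (set T) :=
  [set S | exists2 A : nat -> set R, (forall k, measurable (A k)) &
    S = \bigcap_(k < n) ((B (t k.+1) \- B (t k)) @^-1` A k)].

Let rect_setI t n : setI_closed (rect t n).
Proof.
move=> _ _ [A mA ->] [C mC ->]; exists (fun k => A k `&` C k).
  by move=> k; exact: measurableI.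
by rewrite -bigcapI; apply: eq_bigcapr => k _; rewrite preimage_setI.
Qed.

Let rect_measurable t n : rect t n `<=` measurable.
Proof.
by move=> _ [A mA ->]; apply: bigcap_measurableType => k _; exact: minc_event.
Qed.

Let rect_indep (t : nat -> R) n (s s' : R) (C : set R) :
  {homo t : i j / (i <= j)%N >-> i <= j} -> t n = s -> s <= s' -> measurable C ->
  indep_event P (rect t n) ((B s' \- B s) @^-1` C).
Proof.
move=> ht tn ss' mC _ [A mA ->].
(* The grid is prolonged by the point [s'], and the constraint [C] bears on the added increment from
   [t n = s] to [s']. *)
pose t' k := if (k <= n)%N then t k else s'.
pose A' k := if (k < n)%N then A k else C.
have ht' : {homo t' : i j / (i <= j)%N >-> i <= j}.
  move=> i j ij; rewrite /t'; case: (leqP j n) => jn.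
    by rewrite (leq_trans ij jn); exact: ht.
  by case: (leqP i n) => // iin; rewrite (le_trans _ ss') // -tn; exact: ht.
have mA' k : measurable (A' k) by rewrite /A'; case: ifP.
have := BM_indep BM n.+1 ht' mA'.
have e0 k : (k < n)%N -> (B (t' k.+1) \- B (t' k)) @^-1` A' k =
    (B (t k.+1) \- B (t k)) @^-1` A k.
  by move=> kn; rewrite /t' /A' kn (ltnW kn).
have e1 : (B (t' n.+1) \- B (t' n)) @^-1` A' n = (B s' \- B s) @^-1` C.
  by rewrite /t' /A' ltnn leqnn tn.
rewrite bigcap_mkord big_ord_recr /= e1.
rewrite (eq_bigr (fun k : 'I_n => (B (t k.+1) \- B (t k)) @^-1` A k)); last first.
  by move=> k _; exact: e0.
rewrite [in RHS]big_ord_recr /= e1 bigcap_mkord => ->.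
congr (_ * _)%E; rewrite -(bigcap_mkord n (fun k => (B (t k.+1) \- B (t k)) @^-1` A k)) (BM_indep BM n ht mA).
by apply: eq_bigr => k _; rewrite e0.
Qed.

(** Events of the past without a common grid: each constrains finitely many differences to [B s], in
    any order and with repetitions, so that intersection is concatenation of lists. The differences
    to [B s] generate all increments before [s]. *)
Let cyl (s : R) (l : seq (R * set R)) : set T :=
  foldr (fun p S => ((B p.1 \- B s) @^-1` p.2) `&` S) setT l.

Let good_cyl (s : R) (l : seq (R * set R)) :=
  forall p, List.In p l -> (p.1 <= s) /\ measurable (p.2 : set R).

Let In_map_fst (l : seq (R * set R)) p : List.In p l -> p.1 \in [seq q.1 | q <- l].
Proof.
by elim: l => //= q l ih [->|/ih]; rewrite inE ?eqxx // => ->; rewrite orbT.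
Qed.

Let map_fst_In (l : seq (R * set R)) x : x \in [seq q.1 | q <- l] ->
  exists2 p, List.In p l & p.1 = x.
Proof.
elim: l => //= q l ih; rewrite inE => /orP[/eqP ->|/ih[p pl <-]].
  by exists q => //; left.
by exists p => //; right.
Qed.

Let cyl_mem F s l : sigma_algebra setT F -> good_cyl s l ->
  (forall p, List.In p l -> measurable_wrt F (B p.1 \- B s)) -> F (cyl s l).
Proof.
move=> sF; elim: l => [|p l ih] gl inc3 /=.
  by case: sF => F0 FC _; rewrite -(setD0 setT); exact: FC.
suff : F.-sigma.-measurable ((B p.1 \- B s) @^-1` p.2 `&` cyl s l).
  by rewrite /measurable /= (sigma_algebra_id sF).
apply: measurableI; rewrite /measurable /= (sigma_algebra_id sF).
  by apply: inc3; [left|have [] := gl p (or_introl erefl)].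
by apply: ih => q ql; [apply: gl|apply: inc3]; right.
Qed.

Let past_pi s : set (set T) := [set S | exists2 l, good_cyl s l & S = cyl s l].

Let past_pi_setI s : setI_closed (past_pi s).
Proof.
move=> _ _ [l gl ->] [m gm ->]; exists (l ++ m).
  by move=> p /List.in_app_iff[/gl|/gm].
by elim: l {gl} => [|p l ih] /=; rewrite ?setTI // -setIA ih.
Qed.

(** Two applications of Dynkin's argument. For one cylinder, the sorted times give a grid ending at
    [s], and the cylinder belongs to the sigma-algebra generated by the increments of that grid. The
    cylinders in turn generate the past. *)
Lemma BM_past_indep (s s' : R) (C : set R) : s <= s' -> measurable C ->
  indep_event P (sigma_of [set f | exists v w, [/\ v <= s, w <= s & f = B v \- B w]])
    ((B s' \- B s) @^-1` C).
Proof.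
move=> ss' mC.
have mE := minc_event s' s mC.
have piE : indep_event P (past_pi s) ((B s' \- B s) @^-1` C).
  move=> _ [l gl ->].
  pose ts := sort <=%R [seq p.1 | p <- l].
  (* The default value [s] of [nth] supplies the end of the grid: [t (size ts) = s], and [t] stays
     nondecreasing beyond the list. *)
  pose t k := nth s ts k.
  have tss x : x \in ts -> x <= s.
    by rewrite mem_sort => /map_fst_In[p /gl[ps _] <-].
  have ht : {homo t : i j / (i <= j)%N >-> i <= j}.
    move=> i j ij; rewrite /t; have [jn|jn] := ltnP j (size ts); last first.
      rewrite (nth_default _ jn); have [iin|iin] := ltnP i (size ts).
        by apply: tss; exact: mem_nth.
      by rewrite nth_default.
    by apply: sorted_leq_nth => //; [exact: le_trans|exact: sort_le_sorted|
      rewrite inE (leq_ltn_trans ij)].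
  have tn : t (size ts) = s by rewrite /t nth_default.
  have h := indep_event_generated (@rect_measurable t (size ts))
    (@rect_setI t (size ts)) mE (rect_indep ht tn ss' mC).
  apply: h.
  set F := <<s rect t (size ts) >>.
  have sF : sigma_algebra setT F by exact: smallest_sigma_algebra.
  have inc1 k : (k < size ts)%N -> measurable_wrt F (B (t k.+1) \- B (t k)).
    move=> kn A mA; apply: sub_sigma_algebra.
    exists (fun j => if j == k then A else setT).
      by move=> j; case: ifP.
    apply/seteqP; split=> w /=.
      by move=> Aw j /= jn; case: eqP => // ->.
    by move=> /(_ k kn) /=; rewrite eqxx.
  (* Downwards from the last grid point, where the difference is 0, taking in one increment at a
     time. *)
  have inc2 k : (k <= size ts)%N -> measurable_wrt F (B (t k) \- B s).
    move=> kn; rewrite -(subKn kn); elim: (size ts - k)%N => [|j ih].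
      rewrite subn0 tn; have -> : B s \- B s = cst 0.
        by apply/funext => w /=; rewrite subrr.
      exact: measurable_wrt_cst.
    case: (ltnP j (size ts)) => jn; last first.
      have -> : (size ts - j.+1 = size ts - j)%N by rewrite subnS; case: (size ts - j)%N (subn_eq0 (size ts) j) => //; rewrite jn.
      exact: ih.
    have -> : B (t (size ts - j.+1)%N) \- B s = (B (t (size ts - j)%N) \- B s) \-
        (B (t (size ts - j.+1).+1) \- B (t (size ts - j.+1)%N)).
      by apply/funext => w /=; rewrite subnSK //; ring.
    apply: measurable_wrtB => //; apply: inc1.
    by rewrite ltn_subrL (leq_ltn_trans _ jn).
  have inc3 p : List.In p l -> measurable_wrt F (B p.1 \- B s).
    move=> pl; have : p.1 \in ts by rewrite mem_sort; exact: In_map_fst.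
    move=> /(nthP s)[k kn <-]; apply: inc2; exact: ltnW.
  exact: cyl_mem.
have mpi : past_pi s `<=` measurable.
  move=> _ [l gl ->]; elim: l gl => [|p l ih] gl /=; first exact: measurableT.
  apply: measurableI; last by apply: ih => q ql; apply: gl; right.
  by apply: minc_event; have [] := gl p (or_introl erefl).
have h := indep_event_generated mpi (@past_pi_setI s) mE piE.
move=> A FA; apply: h; move: A FA.
have sF : sigma_algebra setT <<s past_pi s >> by exact: smallest_sigma_algebra.
apply: sigma_of_sub => // _ [v [w [vs ws ->]]].
have inc u : u <= s -> measurable_wrt <<s past_pi s >> (B u \- B s).
  move=> us A mA; apply: sub_sigma_algebra; exists [:: (u, A)].
    by move=> p [<-|[]].
  by rewrite /cyl /= setIT.
have -> : B v \- B w = (B v \- B s) \- (B w \- B s).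
  by apply/funext => x /=; ring.
by apply: measurable_wrtB => //; exact: inc.
Qed.

End real_BM.

Section two_BM.
Variables B1 B2 : R -> T -> R.
Hypothesis mB1 : forall u, measurable_fun setT (B1 u).
Hypothesis BM2 : two_sided_BM P B2.
Hypothesis B12 : independent P (sigma_of [set f | exists u, f = B1 u])
                               (sigma_of [set f | exists u, f = B2 u]).

(** The pi-system consists of events [A] of [B1] at all times intersected with events [A'] of the
    past of [B2]. For these, independence of the two motions is used twice, for [A] against [A']
    with the increment and for [A] against [A'] alone, together with [BM_past_indep]. *)
Lemma BM_cross_indep (s s' : R) (C : set R) : s <= s' -> measurable C ->
  indep_event P (sigma_of [set f | (exists v w, f = B1 v \- B1 w) \/
      exists v w, [/\ v <= s, w <= s & f = B2 v \- B2 w]])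
    ((B2 s' \- B2 s) @^-1` C).
Proof.
move=> ss' mC.
pose F1 := sigma_of [set f | exists u, f = B1 u].
pose F2 := sigma_of [set f | exists u, f = B2 u].
have m2 u : measurable_fun setT (B2 u) by exact: (BM_measurable BM2).
pose Fs := sigma_of [set f | exists v w, [/\ v <= s, w <= s & f = B2 v \- B2 w]].
pose E := (B2 s' \- B2 s) @^-1` C.
have sF1 : sigma_algebra setT F1 by exact: sigma_of_sigma_algebra.
have sF2 : sigma_algebra setT F2 by exact: sigma_of_sigma_algebra.
have sFs : sigma_algebra setT Fs by exact: sigma_of_sigma_algebra.
have mF1 : F1 `<=` measurable by apply: sigma_of_measurable => _ [u ->].
have mF2 : F2 `<=` measurable by apply: sigma_of_measurable => _ [u ->].
have inc2 u v : measurable_wrt F2 (B2 u \- B2 v).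
  by apply: measurable_wrtB => //; apply: sigma_of_mem; [exists u|exists v].
have FsF2 : Fs `<=` F2.
  by apply: sigma_of_sub => // _ [v [w [_ _ ->]]]; exact: inc2.
have F2E : F2 E by exact: inc2.
have F2I A A' : F2 A -> F2 A' -> F2 (A `&` A').
  rewrite -(sigma_algebra_id sF2).
  exact: (@measurableI _ (g_sigma_algebraType F2)).
have F1I A A' : F1 A -> F1 A' -> F1 (A `&` A').
  rewrite -(sigma_algebra_id sF1).
  exact: (@measurableI _ (g_sigma_algebraType F1)).
have FsI A A' : Fs A -> Fs A' -> Fs (A `&` A').
  rewrite -(sigma_algebra_id sFs).
  exact: (@measurableI _ (g_sigma_algebraType Fs)).
have F1T : F1 setT by case: sF1 => F0 FC _; rewrite -(setD0 setT); exact: FC.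
have FsT : Fs setT by case: sFs => F0 FC _; rewrite -(setD0 setT); exact: FC.
pose G := [set S | exists A A', [/\ F1 A, Fs A' & S = A `&` A']].
have Gm : G `<=` measurable.
  by move=> _ [A [A' [/mF1 mA /FsF2/mF2 mA' ->]]]; exact: measurableI.
have GI : setI_closed G.
  move=> _ _ [A [A' [FA FA' ->]]] [D [D' [FD FD' ->]]].
  by exists (A `&` D), (A' `&` D'); split; [exact: F1I|exact: FsI|rewrite setIACA].
have GE : indep_event P G E.
  move=> _ [A [A' [FA FA' ->]]].
  rewrite -setIA B12 //; last by apply: F2I => //; exact: FsF2.
  rewrite (B12 FA); last exact: FsF2.
  by rewrite (BM_past_indep BM2 ss' mC FA') muleA.
have h := indep_event_generated Gm GI (mF2 _ F2E) GE.
move=> A FA; apply: h; move: A FA.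
have sG : sigma_algebra setT <<s G >> by exact: smallest_sigma_algebra.
have F1G : F1 `<=` <<s G >>.
  by move=> A FA; apply: sub_sigma_algebra; exists A, setT; rewrite setIT.
have FsG : Fs `<=` <<s G >>.
  by move=> A FA; apply: sub_sigma_algebra; exists setT, A; rewrite setTI.
apply: sigma_of_sub => // f [[v [w ->]]|fs].
  apply: measurable_wrtB => //; apply: (measurable_wrtS F1G); apply: sigma_of_mem.
    by exists v.
  by exists w.
by apply: (measurable_wrtS FsG); exact: sigma_of_mem.
Qed.

End two_BM.

Section complex_BM.
Variable Z : R -> T -> R[i].
Hypothesis CBM : two_sided_complex_BM P Z.
Local Notation X u := (Re \o Z u).
Local Notation Y u := (Im \o Z u).

Lemma ReB_comp (f g : T -> R[i]) : Re \o (f \- g) = (Re \o f) \- (Re \o g).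
Proof. by apply/funext => w /=; case: (f w) (g w) => ? ? [? ?]. Qed.

Lemma ImB_comp (f g : T -> R[i]) : Im \o (f \- g) = (Im \o f) \- (Im \o g).
Proof. by apply/funext => w /=; case: (f w) (g w) => ? ? [? ?]. Qed.

Lemma measurable_Re_BM u : measurable_fun setT (X u).
Proof. exact: (BM_measurable (CBM_Re CBM)). Qed.

Lemma measurable_Im_BM u : measurable_fun setT (Y u).
Proof. exact: (BM_measurable (CBM_Im CBM)). Qed.

(** The past up to [s] enlarged by the whole real part. A product of past coefficients with an
    increment of the real part after [s] is measurable for it, while the simultaneous increment of
    the imaginary part is independent of it; so the mixed term of a squared increment has mean
    zero. *)
Definition past_Re_all (s : R) : set (set T) := completed P
  (sigma_of [set f | (exists v w, f = X v \- X w) \/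
     exists v w, [/\ v <= s, w <= s & f = Y v \- Y w]]).

Let past_Im_all (s : R) : set (set T) := completed P
  (sigma_of [set f | (exists v w, f = Y v \- Y w) \/
     exists v w, [/\ v <= s, w <= s & f = X v \- X w]]).

Lemma past_sigma_algebra s : sigma_algebra setT (past P Z s).
Proof. exact/completed_sigma_algebra/sigma_of_sigma_algebra. Qed.

Lemma past_Re_all_sigma_algebra s : sigma_algebra setT (past_Re_all s).
Proof. exact/completed_sigma_algebra/sigma_of_sigma_algebra. Qed.

Lemma past_measurable s : past P Z s `<=` measurable.
Proof. exact: completed_measurable. Qed.

Lemma past_Re_all_measurable s : past_Re_all s `<=` measurable.
Proof. exact: completed_measurable. Qed.

Lemma past_le s s' : s <= s' -> past P Z s `<=` past P Z s'.
Proof.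
move=> ss'; apply: completed_le; apply: sigma_of_le => f [v [w [vs ws hf]]].
by exists v, w; split => //; rewrite (le_trans _ ss').
Qed.

Lemma past_sub_Re_all s : past P Z s `<=` past_Re_all s.
Proof.
apply: completed_le; apply: sigma_of_le => f [v [w [vs ws [->|->]]]].
  by left; exists v, w; rewrite ReB_comp.
by right; exists v, w; rewrite ImB_comp.
Qed.

Lemma Re_incr_past v w s : v <= s -> w <= s ->
  measurable_wrt (past P Z s) (X v \- X w).
Proof.
move=> vs ws; apply: completed_mem.
  by exists v, w; split=> //; left; rewrite ReB_comp.
move=> f [? [? [_ _ [->|->]]]].
  by rewrite ReB_comp; apply: measurable_funB; exact: measurable_Re_BM.
by rewrite ImB_comp; apply: measurable_funB; exact: measurable_Im_BM.
Qed.

Lemma Im_incr_past v w s : v <= s -> w <= s ->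
  measurable_wrt (past P Z s) (Y v \- Y w).
Proof.
move=> vs ws; apply: completed_mem.
  by exists v, w; split=> //; right; rewrite ImB_comp.
move=> f [? [? [_ _ [->|->]]]].
  by rewrite ReB_comp; apply: measurable_funB; exact: measurable_Re_BM.
by rewrite ImB_comp; apply: measurable_funB; exact: measurable_Im_BM.
Qed.

Lemma Re_incr_past_Re_all v w s : measurable_wrt (past_Re_all s) (X v \- X w).
Proof.
apply: completed_mem; first by left; exists v, w.
move=> f [[? [? ->]]|[? [? [_ _ ->]]]].
  by apply: measurable_funB; exact: measurable_Re_BM.
by apply: measurable_funB; exact: measurable_Im_BM.
Qed.

Lemma past_Re_all_indep_Im (s s' : R) (C : set R) : s <= s' -> measurable C ->
  indep_event P (past_Re_all s) ((Y s' \- Y s) @^-1` C).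
Proof.
move=> ss' mC; apply: indep_event_completed.
- apply: sigma_of_measurable => f [[? [? ->]]|[? [? [_ _ ->]]]].
    by apply: measurable_funB; exact: measurable_Re_BM.
  by apply: measurable_funB; exact: measurable_Im_BM.
- rewrite -[U in measurable U]setTI; apply: measurable_funB => //; exact: measurable_Im_BM.
- apply: (@BM_cross_indep (fun u => X u) (fun u => Y u)) => //.
  + exact: measurable_Re_BM.
  + exact: (CBM_Im CBM).
  + exact: (CBM_indep CBM).
Qed.

Lemma past_indep_Im (s s' : R) (C : set R) : s <= s' -> measurable C ->
  indep_event P (past P Z s) ((Y s' \- Y s) @^-1` C).
Proof.
by move=> ss' mC A /past_sub_Re_all; exact: past_Re_all_indep_Im.
Qed.

Lemma past_indep_Re (s s' : R) (C : set R) : s <= s' -> measurable C ->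
  indep_event P (past P Z s) ((X s' \- X s) @^-1` C).
Proof.
move=> ss' mC A pA.
have : past_Im_all s A.
  move: A pA; apply: completed_le; apply: sigma_of_le => f [v [w [vs ws [->|->]]]].
    by right; exists v, w; rewrite ReB_comp.
  by left; exists v, w; rewrite ImB_comp.
apply: indep_event_completed.
- apply: sigma_of_measurable => f [[? [? ->]]|[? [? [_ _ ->]]]].
    by apply: measurable_funB; exact: measurable_Im_BM.
  by apply: measurable_funB; exact: measurable_Re_BM.
- rewrite -[U in measurable U]setTI; apply: measurable_funB => //; exact: measurable_Re_BM.
- apply: (@BM_cross_indep (fun u => Y u) (fun u => X u)) => //.
  + exact: measurable_Im_BM.
  + exact: (CBM_Re CBM).
  + by move=> D D' hD hD'; rewrite setIC (CBM_indep CBM) // muleC.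
Qed.

End complex_BM.
End brownian_past.

(** * Moments and the Ito integral *)

Section normal_moments.
Context {R : realType}.
Local Notation mu := (@lebesgue_measure R).
Variable sg : R.
Hypothesis sg_gt0 : 0 < sg.
Local Notation N := (normal_prob 0 sg).
Local Notation p := (normal_pdf 0 sg).

(** The Radon-Nikodym derivative of the normal law agrees almost everywhere with the density, both
    having the same integral over every measurable set. *)
Lemma ge0_integral_normal_prob (h : R -> \bar R) : measurable_fun setT h ->
  (forall x, 0 <= h x)%E ->
  (\int[N]_x h x = \int[mu]_x (h x * (p x)%:E))%E.
Proof.
move=> mh h0.
have numu := @normal_prob_dominates R 0 sg.
rewrite -(Radon_Nikodym_SigmaFinite.change_of_variables numu) //.
have mRN := Radon_Nikodym_SigmaFinite.f_integrable numu.
apply: ae_eq_integral => //.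
- by apply: emeasurable_funM => //; exact: (measurable_int mu).
- apply: emeasurable_funM => //; apply/measurableT_comp => //.
  exact: measurable_normal_pdf.
apply: ae_eqe_mul2l => /=.
apply: integral_ae_eq => //.
- by apply/measurableT_comp => //; exact: measurable_normal_pdf.
- by move=> E _ mE; rewrite -Radon_Nikodym_SigmaFinite.f_integral.
Qed.

Let pE x : p x = normal_peak sg * expR (- x ^+ 2 / (sg ^+ 2 *+ 2)).
Proof. by rewrite normal_pdfE ?gt_eqF //= /normal_fun subr0. Qed.

Let pN x : p (- x) = p x.
Proof. by rewrite !pE sqrrN. Qed.

Let p_ge0 x : 0 <= p x. Proof. exact: normal_pdf_ge0. Qed.

Let p_derive (x : R) : is_derive x 1 (fun y => p y) (- (x / sg ^+ 2) * p x).
Proof.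
rewrite (_ : (fun y => p y) = (fun y => normal_peak sg *
   expR (- y ^+ 2 / (sg ^+ 2 *+ 2)))); last by apply/funext => y; rewrite pE.
apply: is_derive_eq.
rewrite pE /GRing.scale /=; field.
by rewrite ?mulrn_eq0 /= ?gt_eqF.
Qed.

Let mp : measurable_fun setT p. Proof. exact: measurable_normal_pdf. Qed.

Let cp : continuous p.
Proof. by apply: continuous_normal_pdf; rewrite gt_eqF. Qed.

Lemma cvg_expR_sqr_poly (c : R) : 0 < c ->
  x ^+ 2 * expR (- x ^+ 2 / c) @[x --> +oo] --> (0 : R).
Proof.
move=> c0.
have h (x : R) : 1 <= x -> 0 <= x ^+ 2 * expR (- x ^+ 2 / c) <= (2 * c ^+ 2) * x^-1.
  move=> x1; have x0 : 0 < x by exact: lt_le_trans x1.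
  apply/andP; split; first by rewrite mulr_ge0 ?expR_ge0 // sqr_ge0.
  pose y := x ^+ 2 / c.
  have y0 : 0 < y by rewrite divr_gt0 // exprn_gt0.
  rewrite mulNr -/y expRN.
  (* This gives x^2 exp(- y) <= 2 c^2 / x^2 for y = x^2 / c. *)
  have ey : y ^+ 2 / 2 <= expR y.
    have h : 1 + y ^+ 2 / 2 <= expR y := expR_ge1Dxn 1 (ltW y0).
    by apply: le_trans h; rewrite lerDr.
  apply: (@le_trans _ _ (x ^+ 2 * (y ^+ 2 / 2)^-1)).
    rewrite ler_pM2l ?exprn_gt0 // lef_pV2 // ?posrE ?expR_gt0 //.
    by rewrite divr_gt0 // exprn_gt0.
  have -> : x ^+ 2 * (y ^+ 2 / 2)^-1 = (2 * c ^+ 2) * (x ^+ 2)^-1.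
    by rewrite /y; field; rewrite ?gt_eqF.
  rewrite ler_pM2l; last by rewrite mulr_gt0 // exprn_gt0.
  by rewrite lef_pV2 ?posrE ?exprn_gt0 // expr2 ler_peMl // ltW.
apply: (@squeeze_cvgr _ _ _ _ (cst 0) (fun x => (2 * c ^+ 2) * x^-1)).
- by near=> x; apply: h; near: x; exact: nbhs_pinfty_ge.
- exact: cvg_cst.
- rewrite -[X in _ --> X](mulr0 (2 * c ^+ 2)); apply: cvgMr.
  by apply/gtr0_cvgV0; [near=> x; near: x; exact: nbhs_pinfty_gt|exact: cvg_id].
Unshelve. all: by end_near. Qed.

Let cvg_sqr_p : x ^+ 2 * p x @[x --> +oo] --> (0 : R).
Proof.
rewrite (_ : (fun x => x ^+ 2 * p x) = (fun x => normal_peak sg *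
   (x ^+ 2 * expR (- x ^+ 2 / (sg ^+ 2 *+ 2))))); last first.
  by apply/funext => y; rewrite pE; ring.
rewrite -[X in _ --> X](mulr0 (normal_peak sg)).
apply: cvgMr; apply: cvg_expR_sqr_poly.
by rewrite pmulrn_lgt0 // exprn_gt0.
Qed.


Let cvg_p : p x @[x --> +oo] --> (0 : R).
Proof.
apply: (@squeeze_cvgr _ _ _ _ (cst 0) (fun x => x ^+ 2 * p x)) => //.
- near=> x; have x1 : 1 <= x by near: x; exact: nbhs_pinfty_ge.
  by rewrite p_ge0 /= ler_peMl // exprn_ege1.
- exact: cvg_cst.
Unshelve. all: by end_near. Qed.

Let cvg_xp : x * p x @[x --> +oo] --> (0 : R).
Proof.
apply: (@squeeze_cvgr _ _ _ _ (cst 0) (fun x => x ^+ 2 * p x)) => //.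
- near=> x; have x1 : 1 <= x by near: x; exact: nbhs_pinfty_ge.
  have x0 : 0 <= x by exact: le_trans x1.
  by rewrite mulr_ge0 //= ler_wpM2r // expr2 ler_peMl.
- exact: cvg_cst.
Unshelve. all: by end_near. Qed.

Let int_p_half : (\int[mu]_(x in `[0%R, +oo[) (p x)%:E = (2^-1)%:E)%E.
Proof.
have := integral_normal_pdf 0 sg.
rewrite ge0_symfun_integralT //; last by move=> x /=; rewrite pN.
rewrite (_ : [set x | _] = `[0, +oo[%classic); last first.
  by apply/seteqP; split => x/=; rewrite in_itv/= andbT.
set I := integral _ _ _ => h.
have I0 : (0 <= I)%E by apply: integral_ge0 => x _; rewrite lee_fin.
case: I I0 h => [r| |] //=; last by rewrite mulry gtr0_sg // mul1e.
by move=> _ [h]; congr (_%:E); lra.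
Qed.

Let FTC (f F : R -> R) (l : R) : (forall x, 0 <= x -> 0 <= f x) -> continuous f ->
  F x @[x --> +oo] --> l -> (forall x : R, is_derive x 1 F (f x)) ->
  (\int[mu]_(x in `[0%R, +oo[) (f x)%:E = l%:E - (F 0)%:E)%E.
Proof.
move=> f0 cf Fl dF.
apply: ge0_continuous_FTC2y => //.
- exact: continuous_subspaceT.
- apply: cvg_at_right_filter.
  by apply: differentiable_continuous; apply/derivable1_diffP; have [] := dF 0.
- by move=> x _; rewrite derive1E; have [] := dF x.
Qed.

Let int_x3p : (\int[mu]_(x in `[0%R, +oo[) (x ^+ 3 * p x)%:E = (2 * sg ^+ 4 * p 0)%:E)%E.
Proof.
have -> : (2 * sg ^+ 4 * p 0)%:E = ((- (sg ^+ 2) * (0 + 2 * sg ^+ 2 * 0))%:E -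
    (- (sg ^+ 2) * (0 ^+ 2 * p 0 + 2 * sg ^+ 2 * p 0))%:E)%E.
  by rewrite -EFinB; congr (_%:E); ring.
(* The antiderivative of x^3 p found by two integrations by parts, from p' = - x p / sg^2. *)
apply: (FTC (F := fun x => - (sg ^+ 2) * (x ^+ 2 * p x + 2 * sg ^+ 2 * p x))).
- by move=> x x0; rewrite mulr_ge0 // exprn_ge0.
- by move=> x; apply: cvgM; [exact: exprn_continuous|exact: cp].
- by apply: cvgMr; apply: cvgD => //; apply: cvgMr; exact: cvg_p.
- move=> x; have dp := p_derive x; apply: is_derive_eq; rewrite /GRing.scale /=; field.
  by rewrite gt_eqF.
Qed.

Let G x := \int[mu]_(t in `]-oo, x]) p t.

Let integrable_p D : measurable D -> mu.-integrable D (EFin \o p).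
Proof.
by move=> mD; apply: (integrableS measurableT) => //; exact: integrable_normal_pdf.
Qed.

Let GE x : (G x)%:E = N `]-oo, x].
Proof.
rewrite /G /Rintegral fineK //.
exact: (integrable_fin_num _ (integrable_p _)).
Qed.

Let G_derive (x : R) : is_derive x 1 G (p x).
Proof.
have [dG dGE] := @continuous_FTC1 R p -oo%O x (x + 1) ltac:(by rewrite ltrDl)
  (integrable_p (measurable_itv _)) ltac:(by rewrite ltNyr) (@cp x).
by split; [exact: dG|rewrite -derive1E; exact: dGE].
Qed.

Let G0 : G 0 = 2^-1.
Proof.
have := integral_normal_pdf 0 sg.
rewrite -(setUv `]-oo, 0%R]) setCitvl ge0_integral_setU //=; first last.
- by apply/disj_setPS => x /= []; rewrite !in_itv /= andbT leNgt => /negbTE ->.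
- by move=> x _; rewrite lee_fin.
- by apply/measurable_EFinP/measurable_funTS.
rewrite integral_itv_obnd_cbnd; last by apply/measurable_EFinP/measurable_funTS.
rewrite int_p_half -/(normal_prob 0 sg `]-oo, 0%R]) -GE -EFinD => -[h].
lra.
Qed.

Let cvg_G : G x @[x --> +oo] --> (1 : R).
Proof.
have mid : measurable_fun setT (idfun : measurableTypeR R -> R).
  by move=> _ A mA; rewrite setTI.
(* The identity as a random variable under the normal law, whose [cdf] is [G]. *)
pose X : {mfun (measurableTypeR R) >-> R} :=
  HB.pack (idfun : measurableTypeR R -> R) (isMeasurableFun.Build _ _ _ _ _ mid).
have := @cvg_cdfy1 _ _ _ (normal_prob 0 sg) X.
rewrite (_ : cdf _ = fun x => (G x)%:E); last first.
  by apply/funext => x; rewrite GE /cdf /distribution /pushforward preimage_id.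
by move/fine_cvg.
Qed.

Let int_x2p : (\int[mu]_(x in `[0%R, +oo[) (x ^+ 2 * p x)%:E = (sg ^+ 2 / 2)%:E)%E.
Proof.
have -> : (sg ^+ 2 / 2)%:E = ((- (sg ^+ 2) * 0 + sg ^+ 2 * 1)%:E -
    (- (sg ^+ 2) * (0 * p 0) + sg ^+ 2 * G 0)%:E)%E.
  by rewrite -EFinB G0; congr (_%:E); field.
apply: (FTC (F := fun x => - (sg ^+ 2) * (x * p x) + sg ^+ 2 * G x)).
- by move=> x x0; rewrite mulr_ge0 // exprn_ge0.
- by move=> x; apply: cvgM; [exact: exprn_continuous|exact: cp].
- by apply: cvgD; apply: cvgMr; [exact: cvg_xp|exact: cvg_G].
- move=> x; have dp := p_derive x; have dG := G_derive x.
  apply: is_derive_eq; rewrite /GRing.scale /=; field.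
  by rewrite gt_eqF.
Qed.

Let even_moment (h : R -> R) : measurable_fun setT h -> continuous h ->
  (forall x, 0 <= h x) -> (forall x, h (- x) = h x) ->
  (\int[N]_x (h x)%:E = 2%:E * \int[mu]_(x in `[0%R, +oo[) (h x * p x)%:E)%E.
Proof.
move=> mh ch h0 hN.
rewrite ge0_integral_normal_prob; last 2 first.
- exact/measurable_EFinP.
- by move=> x; rewrite lee_fin.
under eq_integral do rewrite -EFinM.
rewrite ge0_symfun_integralT.
- congr (_ * integral _ _ _)%E.
  by apply/seteqP; split => x/=; rewrite in_itv/= andbT.
- by move=> x; rewrite mulr_ge0.
- by move=> x; apply: cvgM; [exact: ch|exact: cp].
- by move=> x /=; rewrite hN pN.
Qed.

Lemma normal_prob_moment2 : (\int[N]_x (x ^+ 2)%:E = (sg ^+ 2)%:E)%E.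
Proof.
rewrite (even_moment (h := fun x => x ^+ 2)).
- by rewrite int_x2p -EFinM; congr (_%:E); field.
- exact: measurable_funX.
- exact: exprn_continuous.
- by move=> x; exact: sqr_ge0.
- by move=> x; rewrite sqrrN.
Qed.

(** The exact value is 4 sg^3 / sqrt (2 pi); only the order sg^3 matters below. *)
Lemma normal_prob_abs_moment3 : (\int[N]_x (`|x| ^+ 3)%:E <= (4 * sg ^+ 3)%:E)%E.
Proof.
rewrite (even_moment (h := fun x => `|x| ^+ 3)); first last.
- by move=> x; rewrite normrN.
- by move=> x; rewrite exprn_ge0.
- move=> x; apply: (@continuous_comp _ _ _ (fun y : R => `|y|) (fun y => y ^+ 3)).
    exact: norm_continuous.
  exact: exprn_continuous.
- apply: measurable_funX; exact: normr_measurable.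
have -> : (\int[mu]_(x in `[0%R, +oo[) (`|x| ^+ 3 * p x)%:E =
    \int[mu]_(x in `[0%R, +oo[) (x ^+ 3 * p x)%:E)%E.
  by apply: eq_integral => x; rewrite inE /= in_itv /= andbT => x0; rewrite ger0_norm.
rewrite int_x3p -EFinM lee_fin.
have sp : sg * p 0 <= 1.
  rewrite pE expr0n /= oppr0 mul0r expR0 mulr1 /normal_peak.
  rewrite -mulrnAr.
  rewrite sqrtrM ?sqr_ge0 // sqrtr_sqr gtr0_norm // invfM mulrA mulfV ?gt_eqF // mul1r.
  rewrite invf_le1; last by rewrite sqrtr_gt0 pmulrn_lgt0 // pi_gt0.
  rewrite -sqrtr1 ler_sqrt; last by rewrite mulrn_wge0 // pi_ge0.
  by have := @pi_ge2 R; rewrite mulr2n; lra.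
have -> : 2 * (2 * sg ^+ 4 * p 0) = 4 * sg ^+ 3 * (sg * p 0) by ring.
by rewrite ler_piMr // mulr_ge0 // exprn_ge0 // ltW.
Qed.

(** Vanishing of the mean in a form that involves nonnegative functions only, so that
    [ge0_integral_BM_incr] carries it over to Brownian increments. *)
Lemma normal_prob_mean_pos_neg :
  (\int[N]_x (Num.max x 0)%:E = \int[N]_x (Num.max (- x) 0)%:E)%E.
Proof.
have mm1 : measurable_fun setT (fun x : R => Num.max x 0).
  by apply: measurable_maxr.
have mm2 : measurable_fun setT (fun x : R => Num.max (- x) 0).
  by apply: measurable_maxr => //; exact: measurableT_comp.
rewrite !ge0_integral_normal_prob; first last.
- by move=> x; rewrite lee_fin le_max lexx orbT.
- exact/measurable_EFinP.
- by move=> x; rewrite lee_fin le_max lexx orbT.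
- exact/measurable_EFinP.
pose f (x : R) := (Num.max x 0 * p x)%:E.
have f0 x : (0 <= f x)%E by rewrite lee_fin mulr_ge0 // le_max lexx orbT.
have mf : measurable_fun setT f by apply/measurable_EFinP; exact: measurable_funM.
have mfN : measurable_fun setT (fun x : R => f (- x)) by exact: measurableT_comp.
have e1 : (\int[mu]_x f x = \int[mu]_(x in `[0%R, +oo[) f x)%E.
  rewrite -(setUv `[0%R, +oo[) setCitvr ge0_integral_setU //=; first last.
  - by apply/disj_setPS => x /= []; rewrite !in_itv /= andbT leNgt => /negP.
  - exact: measurable_funTS.
  rewrite [X in (_ + X)%E]integral0_eq ?adde0 // => x /=.
  by rewrite in_itv /= => x0; rewrite /f max_r ?mul0r // ltW.
have e2 : (\int[mu]_x f (- x)%R = \int[mu]_(x in `]-oo, 0%R]) f (- x)%R)%E.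
  rewrite -(setUv `]-oo, 0%R]) setCitvl ge0_integral_setU //=; first last.
  - by apply/disj_setPS => x /= []; rewrite !in_itv /= andbT leNgt => /negbTE ->.
  - exact: measurable_funTS.
  rewrite [X in (_ + X)%E]integral0_eq ?adde0 // => x /=.
  by rewrite in_itv /= andbT => x0; rewrite /f max_r ?mul0r // oppr_le0 ltW.
transitivity (\int[mu]_x f x)%E; first by apply: eq_integral => x _; rewrite -EFinM.
transitivity (\int[mu]_x f (- x)%R)%E.
  by rewrite e1 e2; exact: ge0_integration_by_substitution0.
by apply: eq_integral => x _; rewrite /f pN EFinM.
Qed.

End normal_moments.

Section expectation.
Context {R : realType} {d : measure_display} {T : measurableType d}.
Variable P : probability T R.
Implicit Types f g h : T -> R.

Definition L1 f : Prop := P.-integrable setT (EFin \o f).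
Definition L2 f : Prop := measurable_fun setT f /\ L1 (fun w => f w ^+ 2).
(** A real number, equal to 0 when the extended integral is infinite; hence the [L1] hypotheses that
    accompany most identities. *)
Definition Ex f : R := \int[P]_w f w.

Lemma L1_measurable f : L1 f -> measurable_fun setT f.
Proof. by move=> /measurable_int /measurable_EFinP. Qed.

Lemma ExE f : L1 f -> (Ex f)%:E = (\int[P]_w (f w)%:E)%E.
Proof. by move=> lf; rewrite /Ex /Rintegral fineK //; exact: integrable_fin_num. Qed.

Lemma eq_Ex f g : f =1 g -> Ex f = Ex g.
Proof. by move=> fg; congr Ex; apply/funext. Qed.

Lemma L1_le f g : measurable_fun setT f -> L1 g -> (forall w, `|f w| <= g w) -> L1 f.
Proof.
move=> mf lg fg; apply: (le_integrable _ _ _ lg) => //; first exact/measurable_EFinP.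
by move=> w _; rewrite /= lee_fin (le_trans (fg w)) // ler_norm.
Qed.

Lemma L1_cst c : L1 (fun=> c).
Proof. exact: (finite_measure_integrable_cst P c). Qed.

Lemma L1_bounded f M : measurable_fun setT f -> (forall w, `|f w| <= M) -> L1 f.
Proof. by move=> mf fM; apply: (L1_le mf (L1_cst M)). Qed.

Lemma L1D f g : L1 f -> L1 g -> L1 (fun w => f w + g w).
Proof. by move=> lf lg; exact: (integrableD measurableT lf lg). Qed.

Lemma L1B f g : L1 f -> L1 g -> L1 (fun w => f w - g w).
Proof. by move=> lf lg; exact: (integrableB measurableT lf lg). Qed.

Lemma L1Z c f : L1 f -> L1 (fun w => c * f w).
Proof. by move=> lf; exact: (integrableZl measurableT c lf). Qed.

Lemma L1N f : L1 f -> L1 (fun w => - f w).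
Proof. by move=> lf; exact: (integrableN lf). Qed.

Lemma L1_norm f : L1 f -> L1 (fun w => `|f w|).
Proof. by move=> lf; exact: (integrable_norm lf). Qed.

Lemma L1_sum (I : Type) (r : seq I) (f : I -> T -> R) :
  (forall i, L1 (f i)) -> L1 (fun w => \sum_(i <- r) f i w).
Proof.
move=> lf; elim: r => [|i r ih].
  by rewrite (_ : (fun _ => _) = fun=> 0); [exact: L1_cst|apply/funext => w; rewrite big_nil].
rewrite (_ : (fun _ => _) = fun w => f i w + \sum_(j <- r) f j w); first exact: L1D.
by apply/funext => w; rewrite big_cons.
Qed.

Lemma Ex_cst c : Ex (fun=> c) = c.
Proof. by rewrite /Ex Rintegral_cst //= probability_setT mulr1. Qed.

Lemma ExD f g : L1 f -> L1 g -> Ex (fun w => f w + g w) = Ex f + Ex g.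
Proof. by move=> lf lg; exact: RintegralD. Qed.

Lemma ExB f g : L1 f -> L1 g -> Ex (fun w => f w - g w) = Ex f - Ex g.
Proof. by move=> lf lg; exact: RintegralB. Qed.

Lemma ExZ c f : L1 f -> Ex (fun w => c * f w) = c * Ex f.
Proof. by move=> lf; exact: RintegralZl. Qed.

Lemma ExN f : L1 f -> Ex (fun w => - f w) = - Ex f.
Proof.
move=> lf; rewrite -mulN1r -ExZ //; apply: eq_Ex => w; by rewrite mulN1r.
Qed.

Lemma Ex_sum (I : Type) (r : seq I) (f : I -> T -> R) :
  (forall i, L1 (f i)) -> Ex (fun w => \sum_(i <- r) f i w) = \sum_(i <- r) Ex (f i).
Proof.
move=> lf; elim: r => [|i r ih].
  by rewrite big_nil -[RHS](Ex_cst 0); apply: eq_Ex => w; rewrite big_nil.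
rewrite big_cons -ih -ExD //; last exact: L1_sum.
by apply: eq_Ex => w; rewrite big_cons.
Qed.

Lemma Ex_le f g : L1 f -> L1 g -> (forall w, f w <= g w) -> Ex f <= Ex g.
Proof. by move=> lf lg fg; apply: le_Rintegral => // w _; exact: fg. Qed.

Lemma Ex_ge0 f : (forall w, 0 <= f w) -> 0 <= Ex f.
Proof. by move=> f0; apply: Rintegral_ge0. Qed.

Lemma Ex_norm_le f : L1 f -> `|Ex f| <= Ex (fun w => `|f w|).
Proof. by move=> lf; exact: le_normr_Rintegral. Qed.

Lemma Ex_ae_eq f g : measurable_fun setT f -> measurable_fun setT g ->
  {ae P, forall w, f w = g w} -> Ex f = Ex g.
Proof.
move=> mf mg fg; congr fine; apply: ae_eq_integral => //; try exact/measurable_EFinP.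
by apply: filterS fg => w /= -> _.
Qed.

Lemma L1_ae_eq f g : L1 f -> measurable_fun setT g ->
  {ae P, forall w, f w = g w} -> L1 g.
Proof.
move=> lf mg fg; apply/integrableP; split; first exact/measurable_EFinP.
have <- : (\int[P]_x `|(EFin \o f) x| = \int[P]_x `|(EFin \o g) x|)%E.
  apply: ae_eq_integral => //.
  - by apply: measurableT_comp => //; exact: measurable_int lf.
  - by apply: measurableT_comp => //; exact/measurable_EFinP.
  - by apply: filterS fg => w /= -> _.
by case/integrableP: lf.
Qed.

Lemma Ex_ae_le f g : L1 f -> L1 g -> {ae P, forall w, f w <= g w} -> Ex f <= Ex g.
Proof.
move=> lf lg fg.
have lm : L1 (fun w => Num.max (f w) (g w)).
  apply: (@L1_le _ (fun w => `|f w| + `|g w|)).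
  - by apply: measurable_maxr; exact: L1_measurable.
  - by apply: L1D; exact: L1_norm.
  - move=> w; rewrite /Num.max; case: ifP => _; first by rewrite lerDr.
    by rewrite lerDl.
rewrite (@Ex_ae_eq g (fun w => Num.max (f w) (g w))).
- by apply: Ex_le => // w; rewrite le_max lexx.
- exact: L1_measurable.
- exact: L1_measurable.
- by apply: filterS fg => w /= h; rewrite max_r.
Qed.

Lemma ge0_L1 f : measurable_fun setT f -> (forall w, 0 <= f w) ->
  (\int[P]_w (f w)%:E < +oo)%E -> L1 f.
Proof.
move=> mf f0 h; apply/integrableP; split; first exact/measurable_EFinP.
by under eq_integral do rewrite /= ger0_norm //.
Qed.

Lemma Ex_le_int f c : measurable_fun setT f -> (forall w, 0 <= f w) ->
  (\int[P]_w (f w)%:E <= c%:E)%E -> L1 f /\ Ex f <= c.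
Proof.
move=> mf f0 h; have lf : L1 f by apply: ge0_L1 => //; exact: le_lt_trans h (ltry _).
by split => //; rewrite -lee_fin ExE.
Qed.

Lemma L2_measurable f : L2 f -> measurable_fun setT f. Proof. by case. Qed.

Lemma L2_sqr f : L2 f -> L1 (fun w => f w ^+ 2). Proof. by case. Qed.

Lemma L2M f g : L2 f -> L2 g -> L1 (fun w => f w * g w).
Proof.
move=> [mf lf] [mg lg]; apply: (L1_le _ (L1D lf lg)); first exact: measurable_funM.
move=> w; rewrite ler_norml; apply/andP; split; nra.
Qed.

Lemma L2_cst c : L2 (fun=> c).
Proof. by split; [exact: measurable_cst|exact: L1_cst]. Qed.

Lemma L2_L1 f : L2 f -> L1 f.
Proof.
move=> lf; have := L2M lf (L2_cst 1); congr L1.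
by apply/funext => w; rewrite mulr1.
Qed.

Lemma L2D f g : L2 f -> L2 g -> L2 (fun w => f w + g w).
Proof.
move=> lf lg; split; first by apply: measurable_funD; [case: lf|case: lg].
have := L1D (L1D (L2_sqr lf) (L2_sqr lg)) (L1Z 2 (L2M lf lg)).
by congr L1; apply/funext => w; ring.
Qed.

Lemma L2Z c f : L2 f -> L2 (fun w => c * f w).
Proof.
move=> lf; split; first by apply: measurable_funM => //; case: lf.
have := L1Z (c ^+ 2) (L2_sqr lf).
by congr L1; apply/funext => w; ring.
Qed.

Lemma L2B f g : L2 f -> L2 g -> L2 (fun w => f w - g w).
Proof.
move=> lf lg; have := L2D lf (L2Z (-1) lg).
by congr L2; apply/funext => w; rewrite mulN1r.
Qed.

Lemma L2_mul_bounded f g M : measurable_fun setT f -> (forall w, `|f w| <= M) ->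
  L2 g -> L2 (fun w => f w * g w).
Proof.
move=> mf fM lg; split; first by apply: measurable_funM => //; case: lg.
apply: (L1_le _ (L1Z (M ^+ 2) (L2_sqr lg))).
  by apply: measurable_funX; apply: measurable_funM => //; case: lg.
move=> w; rewrite ger0_norm ?sqr_ge0 // exprMn ler_wpM2r ?sqr_ge0 //.
by rewrite -real_normK ?num_real // lerXn2r // ?nnegrE // (le_trans _ (fM w)).
Qed.

Lemma L2_bounded f M : measurable_fun setT f -> (forall w, `|f w| <= M) -> L2 f.
Proof.
move=> mf fM; have := L2_mul_bounded mf fM (L2_cst 1).
by congr L2; apply/funext => w; rewrite mulr1.
Qed.

Lemma L1_mul_bounded f g M : measurable_fun setT f -> (forall w, `|f w| <= M) ->
  L1 g -> L1 (fun w => f w * g w).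
Proof.
move=> mf fM lg; apply: (L1_le _ (L1Z M (L1_norm lg))).
  by apply: measurable_funM => //; exact: L1_measurable.
by move=> w; rewrite normrM ler_wpM2r.
Qed.

(** Integrability of the product comes from Tonelli's theorem for the joint law. The factors are
    merely integrable, so that [V] may be the square of an increment. *)
Lemma ExM_indep F g V : F `<=` measurable -> measurable_wrt F g -> L1 g -> L1 V ->
  (forall C : set R, measurable C -> indep_event P F (V @^-1` C)) ->
  L1 (fun w => g w * V w) /\ Ex (fun w => g w * V w) = Ex g * Ex V.
Proof.
move=> Fm mg lg lV ind.
have mg' := L1_measurable lg; have mV := L1_measurable lV.
have indgV (A B : set R) : measurable A -> measurable B ->
    P (g @^-1` A `&` V @^-1` B) = (P (g @^-1` A) * P (V @^-1` B))%E.
  by move=> mA mB; apply: ind => //; exact: mg.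
have mM : measurable_fun setT (fun z : R * R => (z.1 * z.2)%:E).
  by apply/measurable_EFinP; apply: measurable_funM.
have lgV : L1 (fun w => g w * V w).
  apply/integrableP; split; first by apply/measurable_EFinP; exact: measurable_funM.
  have mA : measurable_fun setT (fun z : R * R => `|(z.1 * z.2)%:E|%E).
    exact: measurableT_comp.
  have := indep_ge0_integral mg' mV indgV mA (fun=> abse_ge0 _).
  rewrite /= => ->.
  have e w : (\int[P]_v (`|g w * V v|)%:E = (`|g w| * Ex (fun v => `|V v|))%:E)%E.
    rewrite -ExZ; last exact: L1_norm.
    rewrite ExE; last by apply: L1Z; exact: L1_norm.
    by apply: eq_integral => v _; rewrite normrM.
  under eq_integral do rewrite e.
  have l : L1 (fun w => `|g w| * Ex (fun v => `|V v|)).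
    have := L1Z (Ex (fun v => `|V v|)) (L1_norm lg).
    by congr L1; apply/funext => w; rewrite mulrC.
  by rewrite -ExE // ltry.
split => //.
have := indep_integral mg' mV indgV mM lgV (fun w => L1Z (g w) lV).
move=> h; apply: EFin_inj; rewrite ExE // h.
transitivity (\int[P]_w (Ex V * g w)%:E)%E.
  apply: eq_integral => w _ /=.
  by rewrite mulrC -ExZ // ExE //; exact: L1Z.
by rewrite -ExE ?ExZ //; [rewrite mulrC|exact: L1Z].
Qed.

(* [g] need not be measurable: its integral is then a lower integral. *)
Lemma le_Ex_integral f K (g : T -> \bar R) : L1 f -> L1 K ->
  (forall w, 0 <= g w)%E -> {ae P, forall w, ((f w)%:E <= g w + (K w)%:E)%E} ->
  ((Ex f)%:E <= \int[P]_w g w + (Ex K)%:E)%E.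
Proof.
move=> lf lK g0 [N0 [mN PN sN]].
(* A measurable function below [g]: the positive part of f - K, set to 0 on the exceptional set. *)
pose h w := Num.max (f w - K w) 0 * \1_(~` N0) w.
have mh : measurable_fun setT h.
  apply: measurable_funM; last by apply: measurable_indic; exact: measurableC.
  by apply: measurable_maxr => //; apply: measurable_funB; exact: L1_measurable.
have h0 w : 0 <= h w by rewrite mulr_ge0 // le_max lexx orbT.
have hg w : ((h w)%:E <= g w)%E.
  rewrite /h indicE; case: (boolP (w \in ~` N0)) => wN; last by rewrite mulr0.
  rewrite mulr1 /Num.max; case: ifP => [_|_] //.
  have : ((f w)%:E <= g w + (K w)%:E)%E.
    apply: contrapT => /sN; apply/set_mem: wN.
  by rewrite EFinB leeBlDr.
have ih : (\int[P]_w (h w)%:E <= \int[P]_w g w)%E.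
  rewrite !ge0_integralTE //.
  apply: le_ereal_sup => _ [q qh <-]; exists q => // w.
  exact: le_trans (qh w) (hg w).
have lh : L1 h.
  apply: (L1_le mh (L1D (L1_norm lf) (L1_norm lK))) => w.
  rewrite ger0_norm // /h indicE; case: (_ \in _); last by rewrite mulr0 addr_ge0.
  rewrite mulr1 ge_max addr_ge0 // andbT.
  by rewrite lerD // ?ler_norm // -normrN ler_norm.
apply: (@le_trans _ _ ((Ex h)%:E + (Ex K)%:E)%E); last by rewrite leeD2r // ExE.
rewrite -EFinD lee_fin -ExD //.
apply: Ex_ae_le => //; first exact: L1D.
exists N0; split => // w /= nw; apply: contrapT => nN; apply: nw.
rewrite /h indicE mem_set //= mulr1 -lerBlDr le_max lexx //.
Qed.

End expectation.

Section brownian_increments.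
Context {R : realType} {d : measure_display} {T : measurableType d}.
Variable P : probability T R.
Variable B : R -> T -> R.
Hypothesis BM : two_sided_BM P B.

Let mincr s t : measurable_fun setT (B t \- B s).
Proof. by apply: measurable_funB; exact: (BM_measurable BM). Qed.

Lemma ge0_integral_BM_incr (s t : R) (h : R -> \bar R) : s < t ->
  measurable_fun setT h -> (forall x, 0 <= h x)%E ->
  (\int[P]_w h (B t w - B s w)%R = \int[normal_prob 0 (Num.sqrt (t - s))]_x h x)%E.
Proof.
move=> st mh h0.
have mD : measurable_fun setT (B t \- B s : T -> measurableTypeR R) := mincr s t.
pose D : {mfun T >-> measurableTypeR R} := HB.pack (B t \- B s : T -> measurableTypeR R)
  (isMeasurableFun.Build _ _ _ _ _ mD).
transitivity (\int[distribution P D]_x h x)%E.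
  by rewrite ge0_integral_distribution.
apply: eq_measure_integral => A mA _.
exact: (BM_normal BM st mA).
Qed.

Lemma BM_incr_moments (s t : R) : s <= t ->
  [/\ L2 P (B t \- B s), Ex P (B t \- B s) = 0,
      Ex P (fun w => (B t \- B s) w ^+ 2) = t - s,
      L1 P (fun w => `|(B t \- B s) w| ^+ 3) &
      Ex P (fun w => `|(B t \- B s) w| ^+ 3) <= 4 * Num.sqrt (t - s) ^+ 3].
Proof.
(* [BM_normal] covers s < t only; for s = t the increment is the constant 0. *)
rewrite le_eqVlt => /orP[/eqP <-|st].
  have e : B s \- B s = fun=> 0 by apply/funext => w /=; rewrite subrr.
  have e2 : (fun w : T => (0 : R) ^+ 2) = fun=> 0.
    by apply/funext => w; rewrite expr0n.
  have e3 : (fun w : T => `|(0 : R)| ^+ 3) = fun=> 0.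
    by apply/funext => w; rewrite normr0 expr0n.
  rewrite e e2 e3 subrr sqrtr0 expr0n /= mulr0 Ex_cst; split => //.
    exact: L2_cst.
  exact: L1_cst.
have sg0 : 0 < Num.sqrt (t - s) by rewrite sqrtr_gt0 subr_gt0.
pose D := B t \- B s; have mD : measurable_fun setT D by exact: mincr.
have mD2 : measurable_fun setT (fun w => D w ^+ 2) by exact: measurable_funX.
have mD3 : measurable_fun setT (fun w => `|D w| ^+ 3).
  by apply: measurable_funX; exact: measurableT_comp.
have i2 : (\int[P]_w (D w ^+ 2)%:E = (t - s)%:E)%E.
  rewrite (ge0_integral_BM_incr (h := fun x => (x ^+ 2)%:E)) //; last 2 first.
  - by apply/measurable_EFinP; exact: measurable_funX.
  - by move=> x; rewrite lee_fin sqr_ge0.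
  by rewrite normal_prob_moment2 // sqr_sqrtr // subr_ge0 ltW.
have l2 : L2 P D.
  by split => //; apply: ge0_L1 => //; [move=> w; exact: sqr_ge0|rewrite i2 ltry].
have i3 : (\int[P]_w (`|D w| ^+ 3)%:E <= (4 * Num.sqrt (t - s) ^+ 3)%:E)%E.
  rewrite (ge0_integral_BM_incr (h := fun x => (`|x| ^+ 3)%:E)) //; first exact: normal_prob_abs_moment3.
  by apply/measurable_EFinP; apply: measurable_funX; exact: normr_measurable.
have [l3 e3] := Ex_le_int mD3 (fun w => exprn_ge0 _ (normr_ge0 _)) i3.
split => //; last by apply: EFin_inj; rewrite ExE //; case: l2.
have lD := L2_L1 l2.
have m1 : measurable_fun setT (fun x : R => Num.max x 0) by apply: measurable_maxr.
have m2 : measurable_fun setT (fun x : R => Num.max (- x) 0).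
  by apply: measurable_maxr => //; exact: measurableT_comp.
have lp : L1 P (fun w => Num.max (D w) 0).
  apply: (L1_le _ (L1_norm lD)); first exact: measurableT_comp m1 mD.
  by move=> w; rewrite ger0_norm ?le_max ?lexx ?orbT // ge_max normr_ge0 ler_norm.
have ln : L1 P (fun w => Num.max (- D w) 0).
  apply: (L1_le _ (L1_norm lD)); first exact: measurableT_comp m2 mD.
  move=> w; rewrite ger0_norm ?le_max ?lexx ?orbT // ge_max normr_ge0.
  by rewrite -normrN ler_norm.
have -> : Ex P D = Ex P (fun w => Num.max (D w) 0 - Num.max (- D w) 0).
  apply: eq_Ex => w; rewrite /Num.max.
  case: ifP => h1; case: ifP => h2; lra.
rewrite ExB //; apply/eqP; rewrite subr_eq0; apply/eqP; apply: EFin_inj.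
rewrite !ExE //.
rewrite (ge0_integral_BM_incr (h := fun x => (Num.max x 0)%:E)) //; last 2 first.
- exact/measurable_EFinP.
- by move=> x; rewrite lee_fin le_max lexx orbT.
rewrite (ge0_integral_BM_incr (h := fun x => (Num.max (- x) 0)%:E)) //; last 2 first.
- exact/measurable_EFinP.
- by move=> x; rewrite lee_fin le_max lexx orbT.
exact: normal_prob_mean_pos_neg.
Qed.

End brownian_increments.

(** * The isometry for simple processes and its consequences for the Ito integral *)

Section simple_integrals.
Context {R : realType} {d : measure_display} {T : measurableType d}.
Variables (P : probability T R) (Z : R -> T -> R[i]).
Hypothesis CBM : two_sided_complex_BM P Z.
Local Notation X u := (Re \o Z u).
Local Notation Y u := (Im \o Z u).
Local Notation F := (past P Z).

Let sF s : sigma_algebra setT (F s). Proof. exact: past_sigma_algebra. Qed.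
Let Fm s : F s `<=` measurable. Proof. exact: past_measurable. Qed.

Lemma past_bounded_L2 s g M : measurable_wrt (F s) g -> (forall w, `|g w| <= M) -> L2 P g.
Proof.
by move=> mg gM; apply: L2_bounded gM; exact: measurable_wrt_measurable mg.
Qed.

(** The real part of (p + i q)(Z t - Z s): one step of a stochastic integral with integrand frozen
    at p + i q. *)
Definition gauss_step (s t : R) (p q : T -> R) (w : T) : R :=
  p w * (X t \- X s) w - q w * (Y t \- Y s) w.

(** The increments of the real and imaginary parts are independent of the past, with mean 0 and
    variance t - s. This gives orthogonality to [J], and the isometry up to the mixed term in dX dY,
    for which the larger sigma-algebra [past_Re_all] is there. *)
Lemma gauss_step_facts (s t : R) (J p q : T -> R) M : s <= t ->
  L2 P J -> measurable_wrt (F s) J ->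
  measurable_wrt (F s) p -> measurable_wrt (F s) q ->
  (forall w, `|p w| <= M) -> (forall w, `|q w| <= M) ->
  [/\ L2 P (gauss_step s t p q), measurable_wrt (F t) (gauss_step s t p q),
      Ex P (fun w => J w * gauss_step s t p q w) = 0 &
      Ex P (fun w => gauss_step s t p q w ^+ 2) =
        Ex P (fun w => p w ^+ 2 + q w ^+ 2) * (t - s)].
Proof.
move=> st lJ mJ mp mq pM qM.
have [lX X0 X2 _ _] := BM_incr_moments (CBM_Re CBM) st.
have [lY Y0 Y2 _ _] := BM_incr_moments (CBM_Im CBM) st.
have mp' := measurable_wrt_measurable (@Fm s) mp.
have mq' := measurable_wrt_measurable (@Fm s) mq.
have lp := past_bounded_L2 mp pM; have lq := past_bounded_L2 mq qM.
pose dX := X t \- X s; pose dY := Y t \- Y s.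
have lpX : L2 P (fun w => p w * dX w) by apply: L2_mul_bounded pM lX.
have lqY : L2 P (fun w => q w * dY w) by apply: L2_mul_bounded qM lY.
have iX C : measurable C -> indep_event P (F s) (dX @^-1` C).
  by move=> mC; apply: past_indep_Re.
have iY C : measurable C -> indep_event P (F s) (dY @^-1` C).
  by move=> mC; apply: past_indep_Im.
have sqm : measurable_fun setT (fun x : R => x ^+ 2) by exact: measurable_funX.
have sq_ev (V : T -> R) C : measurable C -> exists2 C', measurable C' &
    (fun w => V w ^+ 2) @^-1` C = V @^-1` C' :> set T.
  move=> mC; exists ((fun x : R => x ^+ 2) @^-1` C) => //.
  by rewrite -[U in measurable U]setTI; exact: sqm.
split.
- exact: L2B.
- have Fst := past_le (P := P) (Z := Z) st.
  apply: measurable_wrtB => //; apply: measurable_wrtM => //.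
  + exact: measurable_wrtS mp.
  + exact: Re_incr_past.
  + exact: measurable_wrtS mq.
  + exact: Im_incr_past.
- have [l1 e1] := ExM_indep (@Fm s) (measurable_wrtM (sF s) mJ mp) (L2M lJ lp) (L2_L1 lX) iX.
  have [l2 e2] := ExM_indep (@Fm s) (measurable_wrtM (sF s) mJ mq) (L2M lJ lq) (L2_L1 lY) iY.
  rewrite (@eq_Ex _ _ _ _ _ (fun w => (J \* p) w * dX w - (J \* q) w * dY w)).
    by rewrite ExB // e1 e2 X0 Y0 !mulr0 subrr.
  by move=> w; rewrite /gauss_step -/dX -/dY /=; ring.
- have mp2 : measurable_wrt (F s) (fun w => p w ^+ 2) := measurable_wrt_comp (sF s) sqm mp.
  have mq2 : measurable_wrt (F s) (fun w => q w ^+ 2) := measurable_wrt_comp (sF s) sqm mq.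
  have [l1 e1] := ExM_indep (V := fun w => dX w ^+ 2) (@Fm s) mp2 (L2_sqr lp) (L2_sqr lX)
    ltac:(by move=> C /(sq_ev dX)[C' mC' ->]; exact: iX).
  have [l2 e2] := ExM_indep (V := fun w => dY w ^+ 2) (@Fm s) mq2 (L2_sqr lq) (L2_sqr lY)
    ltac:(by move=> C /(sq_ev dY)[C' mC' ->]; exact: iY).
  have sFR := past_Re_all_sigma_algebra P Z s.
  have mcr : measurable_wrt (past_Re_all P Z s) ((p \* q) \* dX).
    apply: measurable_wrtM => //; last exact: Re_incr_past_Re_all.
    apply: measurable_wrtM => //; apply: measurable_wrtS (past_sub_Re_all (s := s)) _ => //.
  have lcr : L1 P ((p \* q) \* dX).
    have := L2M lq lpX; congr L1; apply/funext => w /=; ring.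
  have [l3 e3] := ExM_indep (@past_Re_all_measurable _ _ _ P Z s) mcr lcr (L2_L1 lY)
    ltac:(by move=> C mC; apply: past_Re_all_indep_Im).
  rewrite (@eq_Ex _ _ _ _ _ (fun w => (p w ^+ 2 * dX w ^+ 2 + q w ^+ 2 * dY w ^+ 2) -
     2 * (((p \* q) \* dX) w * dY w))); last first.
    by move=> w; rewrite /gauss_step -/dX -/dY /=; ring.
  rewrite ExB; [|exact: L1D|exact: L1Z].
  rewrite ExZ // e3 Y0 mulr0 mulr0 subr0 ExD // e1 e2 X2 Y2 ExD; [|exact: L2_sqr lp|exact: L2_sqr lq].
  by rewrite mulrDl.
Qed.

Section grid.
Variables (N : nat) (g : nat -> R) (p q : nat -> T -> R) (M : R).
Hypothesis g_le : forall k, (k < N)%N -> g k <= g k.+1.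
Hypothesis mp : forall k, (k < N)%N -> measurable_wrt (F (g k)) (p k).
Hypothesis mq : forall k, (k < N)%N -> measurable_wrt (F (g k)) (q k).
Hypothesis pM : forall k w, (k < N)%N -> `|p k w| <= M.
Hypothesis qM : forall k w, (k < N)%N -> `|q k w| <= M.

Let J n w := \sum_(0 <= k < n) gauss_step (g k) (g k.+1) (p k) (q k) w.

Lemma grid_mono n k : (k <= n)%N -> (n <= N)%N -> g k <= g n.
Proof.
elim: n => [|n ih]; first by rewrite leqn0 => /eqP ->.
rewrite leq_eqVlt => /orP[/eqP -> //|kn nN].
exact: le_trans (ih kn (ltnW nN)) (g_le nN).
Qed.

(** The sum up to [g n] is measurable for the past at [g n], hence orthogonal to the next step, and
    the squares add up. *)
Lemma grid_sum_facts n : (n <= N)%N ->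
  [/\ L2 P (J n), measurable_wrt (F (g n)) (J n) &
   Ex P (fun w => J n w ^+ 2) =
     \sum_(0 <= k < n) Ex P (fun w => p k w ^+ 2 + q k w ^+ 2) * (g k.+1 - g k)].
Proof.
elim: n => [_|n ih nN].
  have -> : J 0 = fun=> 0 by apply/funext => w; rewrite /J big_nil.
  split; [exact: L2_cst|exact: measurable_wrt_cst|].
  by rewrite big_nil -[RHS](@Ex_cst _ _ _ P 0); apply: eq_Ex => w; rewrite expr0n.
have [lJ mJ eJ] := ih (ltnW nN).
have JS : J n.+1 = fun w => J n w + gauss_step (g n) (g n.+1) (p n) (q n) w.
  by apply/funext => w; rewrite /J big_nat_recr.
have [lx mx Jx xx] := gauss_step_facts (g_le nN) lJ mJ (mp nN) (mq nN)
  (fun w => pM w nN) (fun w => qM w nN).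
rewrite JS; split; first exact: L2D.
  apply: measurable_wrtD => //; apply: measurable_wrtS mJ; apply: past_le.
  exact: g_le.
rewrite big_nat_recr //= -eJ -xx.
transitivity (Ex P (fun w => (J n w ^+ 2 + gauss_step (g n) (g n.+1) (p n) (q n) w ^+ 2) +
    2 * (J n w * gauss_step (g n) (g n.+1) (p n) (q n) w))).
  by apply: eq_Ex => w; ring.
rewrite ExD; [|by apply: L1D; exact: L2_sqr|by apply: L1Z; exact: L2M].
by rewrite ExZ ?Jx ?mulr0 ?addr0 ?ExD //; [exact: L2_sqr|exact: L2_sqr|exact: L2M].
Qed.

Lemma grid_sum_mean n G C : (n <= N)%N -> measurable_wrt (F (g 0%N)) G ->
  (forall w, `|G w| <= C) -> Ex P (fun w => G w * J n w) = 0.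
Proof.
move=> nN mG GC; elim: n nN => [_|n ih nN].
  rewrite -[RHS](@Ex_cst _ _ _ P 0); apply: eq_Ex => w.
  by rewrite /J big_nil mulr0.
have lG := past_bounded_L2 mG GC.
have mG' : measurable_wrt (F (g n)) G.
  by apply: measurable_wrtS mG; apply: past_le; apply: grid_mono => //; exact: ltnW.
have [lx _ Gx _] := gauss_step_facts (g_le nN) lG mG' (mp nN) (mq nN)
  (fun w => pM w nN) (fun w => qM w nN).
have [lJ _ _] := grid_sum_facts (ltnW nN).
transitivity (Ex P (fun w => G w * J n w + G w * gauss_step (g n) (g n.+1) (p n) (q n) w)).
  by apply: eq_Ex => w; rewrite /J big_nat_recr //= mulrDr.
by rewrite ExD ?ih ?Gx ?addr0 //; [exact: ltnW|exact: L2M|exact: L2M].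
Qed.

End grid.

Lemma cnorm_sqr (z : R[i]) : cnorm z ^+ 2 = Re z ^+ 2 + Im z ^+ 2.
Proof. by rewrite /cnorm sqr_sqrtr // addr_ge0 // sqr_ge0. Qed.

Lemma Re_le_cnorm (z : R[i]) : `|Re z| <= cnorm z.
Proof.
rewrite -sqrtr_sqr /cnorm ler_sqrt ?addr_ge0 ?sqr_ge0 //.
by rewrite lerDl sqr_ge0.
Qed.

Lemma Im_le_cnorm (z : R[i]) : `|Im z| <= cnorm z.
Proof.
rewrite -sqrtr_sqr /cnorm ler_sqrt ?addr_ge0 ?sqr_ge0 //.
by rewrite lerDr sqr_ge0.
Qed.

Lemma ReD (z w : R[i]) : Re (z + w) = Re z + Re w.
Proof. by case: z w => ? ? [? ?]. Qed.

Lemma ImD (z w : R[i]) : Im (z + w) = Im z + Im w.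
Proof. by case: z w => ? ? [? ?]. Qed.

Lemma ReB (z w : R[i]) : Re (z - w) = Re z - Re w.
Proof. by case: z w => ? ? [? ?]. Qed.

Lemma ImB (z w : R[i]) : Im (z - w) = Im z - Im w.
Proof. by case: z w => ? ? [? ?]. Qed.

Lemma Re_sum n (f : 'I_n -> R[i]) : Re (\sum_(k < n) f k) = \sum_(k < n) Re (f k).
Proof. exact: (big_morph Re ReD). Qed.

Lemma Im_sum n (f : 'I_n -> R[i]) : Im (\sum_(k < n) f k) = \sum_(k < n) Im (f k).
Proof. exact: (big_morph Im ImD). Qed.

Lemma ReM (z w : R[i]) : Re (z * w) = Re z * Re w - Im z * Im w.
Proof. by case: z w => ? ? [? ?]. Qed.

Lemma ImM (z w : R[i]) : Im (z * w) = Re z * Im w + Im z * Re w.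
Proof. by case: z w => ? ? [? ?]. Qed.

Section simple_process.
Variables (s t : R) (S : simple_process P Z s t).

Lemma Re_simple_integral w : Re (simple_integral S w) =
  \sum_(0 <= k < steps S) gauss_step (grid S k) (grid S k.+1)
     (Re \o simple_val S k) (Im \o simple_val S k) w.
Proof.
rewrite /simple_integral Re_sum big_mkord; apply: eq_bigr => k _.
by rewrite ReM ReB ImB.
Qed.

Let S_le k n : (k <= n)%N -> (n <= steps S)%N -> grid S k <= grid S n.
Proof. by apply: grid_mono => i; exact: grid_le. Qed.

(** The intervals are disjoint and exactly one contains [u], so a single indicator is nonzero and
    the square can be taken inside the sum. *)
Let step_sqr n (a b : R) u w : (n <= steps S)%N -> grid S 0%N < u <= grid S n ->
  (Re (\sum_(k < n) (\1_`]grid S k, grid S k.+1] u)%:C * simple_val S k w) - a) ^+ 2 +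
  (Im (\sum_(k < n) (\1_`]grid S k, grid S k.+1] u)%:C * simple_val S k w) - b) ^+ 2 =
  \sum_(0 <= k < n) ((Re (simple_val S k w) - a) ^+ 2 + (Im (simple_val S k w) - b) ^+ 2) *
     \1_`]grid S k, grid S k.+1] u.
Proof.
elim: n => [_|n ih nN]; first by move=> /andP[h /(lt_le_trans h)]; rewrite ltxx.
move=> /andP[gu un]; rewrite big_nat_recr //= big_ord_recr /=.
case: (leP u (grid S n)) => ugn.
  have e : \1_`]grid S n, grid S n.+1] u = 0 :> R.
    by rewrite indicE memNset //= in_itv /= ltNge ugn.
  rewrite e mulr0 addr0 mul0r addr0; apply: ih; first exact: ltnW.
  by rewrite gu ugn.
have e : \1_`]grid S n, grid S n.+1] u = 1 :> R.
  by rewrite indicE mem_set //= in_itv /= ugn un.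
have e0 k : (k < n)%N -> \1_`]grid S k, grid S k.+1] u = 0 :> R.
  move=> kn; rewrite indicE memNset //= in_itv /= => /andP[_].
  by rewrite leNgt (le_lt_trans _ ugn) // S_le // ltnW.
rewrite e mulr1 mul1r.
rewrite [V in Re (V + _)]big1 ?add0r; last by move=> k _; rewrite e0 ?mul0r.
rewrite [V in Im (V + _)]big1 ?add0r; last by move=> k _; rewrite e0 ?mul0r.
by rewrite big1_seq ?add0r // => k; rewrite mem_index_iota /= => kn; rewrite e0 ?mulr0.
Qed.

Lemma integral_simple_eval_sqr (a b : R) w :
  (\int[lebesgue_measure]_(u in `[s, t])
     ((Re (simple_eval S u w) - a) ^+ 2 + (Im (simple_eval S u w) - b) ^+ 2)%:E =
  (\sum_(0 <= k < steps S)
     ((Re (simple_val S k w) - a) ^+ 2 + (Im (simple_val S k w) - b) ^+ 2) *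
     (grid S k.+1 - grid S k))%:E)%E.
Proof.
pose c k := (Re (simple_val S k w) - a) ^+ 2 + (Im (simple_val S k w) - b) ^+ 2.
have c0 k : 0 <= c k by rewrite addr_ge0 // sqr_ge0.
pose h u := \sum_(0 <= k < steps S) c k * \1_`]grid S k, grid S k.+1] u.
have mh : measurable_fun setT h.
  by apply: measurable_sum => k; apply: measurable_funM => //; exact: measurable_indic.
have eh u : u \in (`]s, t]%classic : set R) -> (Re (simple_eval S u w) - a) ^+ 2 +
    (Im (simple_eval S u w) - b) ^+ 2 = h u.
  by rewrite inE /= in_itv /= => us; rewrite /h -step_sqr // grid_start grid_end.
(* At [s] itself [simple_eval] vanishes, its intervals being open on the left; the formula through
   [h] holds on ]s, t]. *)
rewrite -integral_itv_obnd_cbnd; last first.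
  apply/measurable_EFinP; apply: (eq_measurable_fun h); first by move=> u us; rewrite eh.
  exact: measurable_funTS.
have -> : (\int[lebesgue_measure]_(u in `]s, t])
     ((Re (simple_eval S u w) - a) ^+ 2 + (Im (simple_eval S u w) - b) ^+ 2)%:E =
   \int[lebesgue_measure]_(u in `]s, t]) (h u)%:E)%E.
  by apply: eq_integral => u us; rewrite eh.
rewrite /h.
under eq_integral do rewrite -sumEFin.
rewrite ge0_integral_sum //; first last.
- by move=> k u _; rewrite lee_fin mulr_ge0.
- move=> k; apply/measurable_EFinP; apply: measurable_funTS.
  by apply: measurable_funM => //; exact: measurable_indic.
rewrite -sumEFin !big_nat; apply: eq_bigr => k /= kN.
under eq_integral do rewrite EFinM.
rewrite ge0_integralZl_EFin //; last first.
  by apply/measurable_EFinP; apply: measurable_funTS; exact: measurable_indic.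
rewrite integral_indic // EFinM; congr (_ * _)%E.
have gk : grid S k <= grid S k.+1 by exact: grid_le.
rewrite setIidl; last first.
  apply: subset_itv; rewrite bnd_simp.
    by have := S_le (leq0n k) (ltnW kN); rewrite grid_start.
  by have := S_le kN (leqnn _); rewrite grid_end.
rewrite /= lebesgue_measure_itv /= lte_fin; case: ltP => // gk'.
by rewrite (@le_anti _ _ (grid S k.+1) (grid S k)) ?gk ?gk' // subrr.
Qed.

End simple_process.


Lemma ito_approx s t H I e : 0 < e -> is_ito_integral P Z s t H I ->
  exists S : simple_process P Z s t,
   [/\ L2 P (Re \o I), L2 P (fun w => Re (simple_integral S w)),
       Ex P (fun w => (Re (I w) - Re (simple_integral S w)) ^+ 2) <= e &
     (\int[P]_w \int[lebesgue_measure]_(u in `[s, t])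
        (cnorm (simple_eval S u w - H u w) ^+ 2)%:E <= e%:E)%E].
Proof.
move=> e0 [[mI mI'] [S [cS cI]]].
have small (v : nat -> \bar R) : v @ \oo --> 0%E -> \forall n \near \oo, (v n <= e%:E)%E.
  move=> cv; have /fine_cvgP[fv /cvgrPdist_le/(_ _ e0)] := cv.
  move=> fv'; near=> n.
  have f : v n \is a fin_num by near: n.
  rewrite -(fineK f) lee_fin; apply: le_trans (ler_norm _) _.
  by rewrite -normrN -sub0r; near: n.
have [n [hS hI]] : exists n,
    (\int[P]_w \int[lebesgue_measure]_(u in `[s, t])
        (cnorm (simple_eval (S n) u w - H u w) ^+ 2)%:E <= e%:E)%E /\
    (\int[P]_w (cnorm (simple_integral (S n) w - I w) ^+ 2)%:E <= e%:E)%E.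
  have [N _ hN] : \forall n \near \oo,
    (\int[P]_w \int[lebesgue_measure]_(u in `[s, t])
        (cnorm (simple_eval (S n) u w - H u w) ^+ 2)%:E <= e%:E)%E /\
    (\int[P]_w (cnorm (simple_integral (S n) w - I w) ^+ 2)%:E <= e%:E)%E.
    by near=> n; split; near: n; exact: small.
  by exists N; apply: hN => /=.
exists (S n).
have [M hM] := Defs.simple_bounded (S n).
have [lJ mJ _] := @grid_sum_facts (steps (S n)) (grid (S n))
  (fun k => Re \o simple_val (S n) k) (fun k => Im \o simple_val (S n) k) M
  (@Defs.grid_le _ _ _ _ _ _ _ (S n))
  (fun k kN => (simple_adapted kN).1) (fun k kN => (simple_adapted kN).2)
  (fun k w kN => le_trans (Re_le_cnorm _) (hM k w kN))
  (fun k w kN => le_trans (Im_le_cnorm _) (hM k w kN)) _ (leqnn _).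
have JE : (fun w => Re (simple_integral (S n) w)) = (fun w => \sum_(0 <= k < steps (S n))
    gauss_step (grid (S n) k) (grid (S n) k.+1)
     (Re \o simple_val (S n) k) (Im \o simple_val (S n) k) w).
  by apply/funext => w; rewrite Re_simple_integral.
have lR : L2 P (fun w => Re (simple_integral (S n) w)) by rewrite JE.
have mRI := measurable_wrt_measurable (@Fm t) mI.
have md : measurable_fun setT (fun w => (Re (I w) - Re (simple_integral (S n) w)) ^+ 2).
  by apply: measurable_funX; apply: measurable_funB => //; case: lR.
have [ld ed] : L1 P (fun w => (Re (I w) - Re (simple_integral (S n) w)) ^+ 2) /\
    Ex P (fun w => (Re (I w) - Re (simple_integral (S n) w)) ^+ 2) <= e.
  apply: Ex_le_int => //; first by move=> w; exact: sqr_ge0.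
  apply: le_trans hI.
  (* Monotonicity through the supremum over simple functions below, which involves no measurability
     of the integrands. *)
  rewrite !ge0_integralTE; last 2 first.
  - by move=> w; rewrite lee_fin sqr_ge0.
  - by move=> w; rewrite lee_fin sqr_ge0.
  apply: le_ereal_sup => _ [q qh <-]; exists q => // w.
  apply: le_trans (qh w) _; rewrite lee_fin cnorm_sqr ReB -sqrrN opprB lerDl.
  exact: sqr_ge0.
split => //.
have := L2D lR (conj _ ld : L2 P (fun w => Re (I w) - Re (simple_integral (S n) w))).
move=> h; have : L2 P (fun w => Re (simple_integral (S n) w) +
    (Re (I w) - Re (simple_integral (S n) w))).
  by apply: h; apply: measurable_funB => //; case: lR.
by congr L2; apply/funext => w /=; rewrite addrC subrK.
Unshelve. all: by end_near. Qed.

(** Exact for simple processes by [grid_sum_mean]. In the limit, an error eta^2 in mean square costs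
    at most eta in mean, by |x| <= (eta + x^2 / eta) / 2. *)
Lemma ito_mean s t H I G C : is_ito_integral P Z s t H I ->
  measurable_wrt (F s) G -> (forall w, `|G w| <= C) ->
  Ex P (fun w => G w * Re (I w)) = 0.
Proof.
move=> hI mG GC.
have C0 : 0 <= C by exact: le_trans (normr_ge0 _) (GC point).
have mG' := measurable_wrt_measurable (@Fm s) mG.
suff h eta : 0 < eta -> `|Ex P (fun w => G w * Re (I w))| <= C * eta.
  apply/eqP; rewrite -normr_le0; apply/ler_addgt0Pr => e e0; rewrite add0r.
  have C1 : 0 < C + 1 by rewrite ltr_wpDl.
  apply: (le_trans (h (e / (C + 1)) (divr_gt0 e0 C1))).
  rewrite mulrCA ger_pMr // ler_pdivrMr // mul1r lerDl //.
move=> eta0.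
have [S [lI lJ hS _]] := ito_approx (exprn_gt0 2 eta0) hI.
have [M hM] := Defs.simple_bounded S.
have J0 : Ex P (fun w => G w * Re (simple_integral S w)) = 0.
  have := @grid_sum_mean (steps S) (grid S)
   (fun k => Re \o simple_val S k) (fun k => Im \o simple_val S k) M
   (@Defs.grid_le _ _ _ _ _ _ _ S)
   (fun k kN => (simple_adapted kN).1) (fun k kN => (simple_adapted kN).2)
   (fun k w kN => le_trans (Re_le_cnorm _) (hM k w kN))
   (fun k w kN => le_trans (Im_le_cnorm _) (hM k w kN)) _ G C (leqnn _).
  rewrite grid_start => /(_ mG GC) e; rewrite -[RHS]e.
  by apply: eq_Ex => w; rewrite Re_simple_integral.
have ld : L2 P (fun w => Re (I w) - Re (simple_integral S w)) by exact: L2B.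
have -> : Ex P (fun w => G w * Re (I w)) =
    Ex P (fun w => G w * (Re (I w) - Re (simple_integral S w))).
  rewrite -[LHS]subr0 -J0 -ExB; last 2 first.
  - by apply: L1_mul_bounded GC (L2_L1 lI).
  - by apply: L1_mul_bounded GC (L2_L1 lJ).
  by apply: eq_Ex => w; rewrite mulrBr.
have l1 : L1 P (fun w => G w * (Re (I w) - Re (simple_integral S w))).
  by apply: L1_mul_bounded GC (L2_L1 ld).
apply: (le_trans (Ex_norm_le l1)).
have l3 : L1 P (fun w => eta^-1 * (Re (I w) - Re (simple_integral S w)) ^+ 2).
  by apply: L1Z; exact: L2_sqr ld.
have l2 : L1 P (fun w => C / 2 * (eta + eta^-1 * (Re (I w) - Re (simple_integral S w)) ^+ 2)).
  by apply: L1Z; apply: L1D => //; exact: L1_cst.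
apply: (@le_trans _ _ (Ex P (fun w =>
    C / 2 * (eta + eta^-1 * (Re (I w) - Re (simple_integral S w)) ^+ 2)))).
  apply: Ex_le => //; first exact: L1_norm.
  move=> w; rewrite normrM.
  set x := Re (I w) - _.
  have hx : `|x| <= 2^-1 * (eta + eta^-1 * x ^+ 2).
    rewrite -(ler_pM2l eta0) -subr_ge0.
    have -> : eta * (2^-1 * (eta + eta^-1 * x ^+ 2)) - eta * `|x| =
        2^-1 * (eta - `|x|) ^+ 2.
      rewrite -(real_normK (num_real x)); field; exact: lt0r_neq0.
    by rewrite mulr_ge0 ?sqr_ge0.
  apply: (le_trans (ler_wpM2r (normr_ge0 _) (GC w))).
  by rewrite -mulrA ler_wpM2l.
rewrite ExZ; last by apply: L1D => //; exact: L1_cst.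
rewrite ExD //; last exact: L1_cst.
rewrite Ex_cst ExZ; last exact: L2_sqr ld.
rewrite -mulrA ler_wpM2l //.
have : eta^-1 * Ex P (fun w => (Re (I w) - Re (simple_integral S w)) ^+ 2) <= eta.
  by rewrite ler_pdivrMl // -expr2.
lra.
Qed.

(** A simple process approximating [H], minus the constant p + i q, is a simple process on the same
    grid, and the isometry applies to it. The factor 4 comes from two uses of (x + y)^2 <= 2 x^2 + 2
    y^2: between the simple process and [H], and between the simple integral and [I]. *)
Lemma ito_L2 s t H I (p q : T -> R) M (K : T -> R) : s <= t ->
  is_ito_integral P Z s t H I ->
  measurable_wrt (F s) p -> measurable_wrt (F s) q ->
  (forall w, `|p w| <= M) -> (forall w, `|q w| <= M) ->
  L1 P K ->
  {ae P, forall w, [/\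
     measurable_fun `[s, t] (fun u => Re (H u w)),
     measurable_fun `[s, t] (fun u => Im (H u w)) &
     (\int[lebesgue_measure]_(u in `[s, t])
        ((Re (H u w) - p w) ^+ 2 + (Im (H u w) - q w) ^+ 2)%:E <= (K w)%:E)%E]} ->
  L2 P (Re \o I) /\
  Ex P (fun w => (Re (I w) - gauss_step s t p q w) ^+ 2) <= 4 * Ex P K.
Proof.
move=> st hI mp mq pM qM lK hK.
have mp' := measurable_wrt_measurable (@Fm s) mp.
have mq' := measurable_wrt_measurable (@Fm s) mq.
have [lxi _ _ _] := gauss_step_facts st (L2_cst P 0) (measurable_wrt_cst 0 (sF s)) mp mq pM qM.
have lI : L2 P (Re \o I) by have [? []] := ito_approx ltr01 hI.
split => //; apply/ler_addgt0Pr => e e0.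
(* The two approximation errors enter with factors 2 and 4, in all 6 e / 8. *)
have e8 : 0 < e / 8 by rewrite divr_gt0.
have [S [_ lJ hS hE]] := ito_approx e8 hI.
have [M' hM'] := Defs.simple_bounded S.
pose p' k w := Re (simple_val S k w) - p w.
pose q' k w := Im (simple_val S k w) - q w.
have s_le k : (k < steps S)%N -> s <= grid S k.
  move=> kN; have := @grid_mono (steps S) _ (@Defs.grid_le _ _ _ _ _ _ _ S) _ _ (leq0n k) (ltnW kN).
  by rewrite grid_start.
have mp'k k : (k < steps S)%N -> measurable_wrt (F (grid S k)) (p' k).
  move=> kN; apply: measurable_wrtB => //; first exact: (simple_adapted kN).1.
  by apply: measurable_wrtS mp; apply: past_le; exact: s_le.
have mq'k k : (k < steps S)%N -> measurable_wrt (F (grid S k)) (q' k).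
  move=> kN; apply: measurable_wrtB => //; first exact: (simple_adapted kN).2.
  by apply: measurable_wrtS mq; apply: past_le; exact: s_le.
have p'M k w : (k < steps S)%N -> `|p' k w| <= M' + M.
  move=> kN; rewrite (le_trans (ler_normB _ _)) // lerD //.
  exact: le_trans (Re_le_cnorm _) (hM' k w kN).
have q'M k w : (k < steps S)%N -> `|q' k w| <= M' + M.
  move=> kN; rewrite (le_trans (ler_normB _ _)) // lerD //.
  exact: le_trans (Im_le_cnorm _) (hM' k w kN).
have [lD _ eD] := @grid_sum_facts _ _ _ _ _ (@Defs.grid_le _ _ _ _ _ _ _ S)
  mp'k mq'k p'M q'M _ (leqnn _).
have JE w : Re (simple_integral S w) - gauss_step s t p q w =
    \sum_(0 <= k < steps S) gauss_step (grid S k) (grid S k.+1) (p' k) (q' k) w.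
  rewrite Re_simple_integral.
  (* As [p] and [q] do not depend on time, the increments over the grid telescope. *)
  have -> : gauss_step s t p q w = \sum_(0 <= k < steps S)
      gauss_step (grid S k) (grid S k.+1) p q w.
    rewrite /gauss_step sumrB -!mulr_sumr /= !telescope_sumr //.
    by rewrite grid_start grid_end.
  rewrite -sumrB; apply: eq_bigr => k _; rewrite /gauss_step /p' /q' /=; ring.
pose f w := \sum_(0 <= k < steps S) (grid S k.+1 - grid S k) * (p' k w ^+ 2 + q' k w ^+ 2).
have lpq k : (k < steps S)%N -> L1 P (fun w => p' k w ^+ 2 + q' k w ^+ 2).
  by move=> kN; apply: L1D; apply: L2_sqr; [exact: past_bounded_L2 (mp'k k kN) (fun w => p'M k w kN)|
    exact: past_bounded_L2 (mq'k k kN) (fun w => q'M k w kN)].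
have fE : L1 P f /\ Ex P f = Ex P (fun w => (Re (simple_integral S w) - gauss_step s t p q w) ^+ 2).
  pose pq k w := if (k < steps S)%N then p' k w ^+ 2 + q' k w ^+ 2 else 0.
  have lpq' k : L1 P (fun w => (grid S k.+1 - grid S k) * pq k w).
    apply: L1Z; rewrite /pq; case: (boolP (k < steps S)%N) => kN; [exact: lpq|exact: L1_cst].
  have fE' : f = (fun w => \sum_(0 <= k < steps S) (grid S k.+1 - grid S k) * pq k w).
    by apply/funext => w; rewrite /f !big_nat; apply: eq_bigr => k /= kN; rewrite /pq kN.
  rewrite fE'; split; first exact: L1_sum.
  rewrite Ex_sum // -[RHS](@eq_Ex _ _ _ P (fun w => (\sum_(0 <= k < steps S)
    gauss_step (grid S k) (grid S k.+1) (p' k) (q' k) w) ^+ 2)); last first.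
    by move=> w; rewrite JE.
  rewrite eD !big_nat; apply: eq_bigr => k /= kN.
  by rewrite /pq kN ExZ; [rewrite mulrC|exact: lpq].
have [lf ef] := fE.
have f0 w : 0 <= f w.
  rewrite /f big_nat sumr_ge0 // => k /= kN.
  by rewrite mulr_ge0 ?subr_ge0 ?Defs.grid_le // addr_ge0 // sqr_ge0.
(* The double integral is taken in the lower sense: its inner integral is not known to be measurable
   in [w]. *)
have fb : ((Ex P (fun w => 2^-1 * f w))%:E <= \int[P]_w \int[lebesgue_measure]_(u in `[s, t])
        (cnorm (simple_eval S u w - H u w) ^+ 2)%:E + (Ex P K)%:E)%E.
  apply: le_Ex_integral => //; first exact: L1Z.
    by move=> w; apply: integral_ge0 => u _; rewrite lee_fin sqr_ge0.
  apply: filterS hK => w /= [mR mIm hw].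
  apply: le_trans (leeD2l _ hw).
  have fw : (f w)%:E = (\int[lebesgue_measure]_(u in `[s, t])
     ((Re (simple_eval S u w) - p w) ^+ 2 + (Im (simple_eval S u w) - q w) ^+ 2)%:E)%E.
    rewrite integral_simple_eval_sqr; congr (_%:E).
    by apply: eq_bigr => k _; rewrite mulrC.
  have mS : measurable_fun `[s, t] (fun u => Re (simple_eval S u w)) /\
            measurable_fun `[s, t] (fun u => Im (simple_eval S u w)).
    split.
      rewrite (_ : (fun _ => _) = fun u => \sum_(k < steps S)
         \1_`]grid S k, grid S k.+1] u * Re (simple_val S k w)).
        by apply: measurable_sum => k; apply: measurable_funM.
      by apply/funext => u; rewrite Re_sum; apply: eq_bigr => k _; rewrite ReM /= mul0r subr0.
    rewrite (_ : (fun _ => _) = fun u => \sum_(k < steps S)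
         \1_`]grid S k, grid S k.+1] u * Im (simple_val S k w)).
      by apply: measurable_sum => k; apply: measurable_funM.
    by apply/funext => u; rewrite Im_sum; apply: eq_bigr => k _; rewrite ImM /= mul0r addr0.
  have [mSR mSI] := mS.
  have mm : measurable_fun `[s, t] (fun u => ((Re (H u w) - p w) ^+ 2 + (Im (H u w) - q w) ^+ 2)%:E).
    apply/measurable_EFinP; apply: measurable_funD; apply: measurable_funX;
    exact: measurable_funB.
  have mc : measurable_fun `[s, t] (fun u => (cnorm (simple_eval S u w - H u w) ^+ 2)%:E).
    rewrite (_ : (fun _ => _) = fun u => ((Re (simple_eval S u w) - Re (H u w)) ^+ 2 +
       (Im (simple_eval S u w) - Im (H u w)) ^+ 2)%:E); last first.
      by apply/funext => u; rewrite cnorm_sqr ReB ImB.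
    apply/measurable_EFinP; apply: measurable_funD; apply: measurable_funX;
    exact: measurable_funB.
  rewrite EFinM fw -ge0_integralZl_EFin //; first last.
  - apply/measurable_EFinP; apply: measurable_funD; apply: measurable_funX;
    exact: measurable_funB.
  - by move=> u _; rewrite lee_fin addr_ge0 // sqr_ge0.
  rewrite -ge0_integralD //; first last.
  - by move=> u _; rewrite lee_fin addr_ge0 // sqr_ge0.
  - by move=> u _; rewrite lee_fin sqr_ge0.
  apply: ge0_le_integral => //.
  - by move=> u _; rewrite mule_ge0 // lee_fin addr_ge0 // sqr_ge0.
  - apply: emeasurable_funM => //; apply/measurable_EFinP.
    apply: measurable_funD; apply: measurable_funX; exact: measurable_funB.
  - exact: emeasurable_funD.
  - move=> u _; rewrite -EFinM -EFinD lee_fin cnorm_sqr ReB ImB.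
    set a := Re (simple_eval S u w); set b := Im (simple_eval S u w).
    set a' := Re (H u w); set b' := Im (H u w).
    have h1 : 0 <= ((a - a') - (a' - p w)) ^+ 2 by exact: sqr_ge0.
    have h2 : 0 <= ((b - b') - (b' - q w)) ^+ 2 by exact: sqr_ge0.
    nra.
have fb' : Ex P f <= 2 * (e / 8 + Ex P K).
  have := le_trans fb (leeD2r _ hE).
  rewrite -EFinD lee_fin ExZ //; lra.
have ld : L2 P (fun w => Re (I w) - Re (simple_integral S w)) by exact: L2B.
have lj : L2 P (fun w => Re (simple_integral S w) - gauss_step s t p q w) by exact: L2B.
apply: (@le_trans _ _ (Ex P (fun w => 2 * (Re (I w) - Re (simple_integral S w)) ^+ 2 +
   2 * (Re (simple_integral S w) - gauss_step s t p q w) ^+ 2))).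
  apply: Ex_le.
  - by apply: L2_sqr; exact: L2B.
  - by apply: L1D; apply: L1Z; exact: L2_sqr.
  - move=> w; set x := Re (I w); set y := Re (simple_integral S w); set z := gauss_step _ _ _ _ _.
    have : 0 <= ((x - y) - (y - z)) ^+ 2 by exact: sqr_ge0.
    nra.
rewrite ExD; [|by apply: L1Z; exact: L2_sqr|by apply: L1Z; exact: L2_sqr].
rewrite !ExZ; [|exact: L2_sqr lj|exact: L2_sqr ld].
rewrite -ef; lra.
Qed.

End simple_integrals.

(** * Fourier modes of a solution *)

Section trigonometric_bounds.
Context {R : realType}.
Implicit Types a x c : R.

Lemma mean_value_bound (h dh : R -> R) c x : (forall y : R, is_derive y 1 h (dh y)) ->
  h 0 = 0 -> (forall y, `|y| <= `|x| -> `|dh y| <= c) -> `|h x| <= c * `|x|.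
Proof.
move=> dhh h0 hc.
have ch : continuous h.
  by move=> y; apply: differentiable_continuous; apply/derivable1_diffP; have [] := dhh y.
have [x0|x0|->] := ltrgtP x 0; last by rewrite h0 !normr0 mulr0.
- have [z zx] := @MVT R h dh x 0 x0 (fun y _ => dhh y) (continuous_subspaceT ch).
  move: zx; rewrite in_itv /= => /andP[xz z0].
  rewrite h0 sub0r sub0r => e; rewrite -normrN e normrM normrN ler_wpM2r // hc //.
  by rewrite !ltr0_norm // lerN2 ltW.
- have [z zx] := @MVT R h dh 0 x x0 (fun y _ => dhh y) (continuous_subspaceT ch).
  move: zx; rewrite in_itv /= => /andP[z0 zx].
  rewrite h0 !subr0 => e; rewrite e normrM ler_wpM2r // hc //.
  by rewrite !gtr0_norm // ltW.
Qed.

Lemma cosD_taylor0 a x : `|cos (a + x) - cos a| <= `|x|.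
Proof.
rewrite -[leRHS]mul1r.
apply: (@mean_value_bound (fun x => cos (a + x) - cos a) (fun x => - sin (a + x))).
- by move=> y; apply: is_derive_eq; rewrite /GRing.scale /=; ring.
- by rewrite addr0 subrr.
- by move=> y _; rewrite normrN sin_max.
Qed.

Lemma sinD_taylor0 a x : `|sin (a + x) - sin a| <= `|x|.
Proof.
have := cosD_taylor0 (a - pi / 2) x.
by rewrite addrAC !cosBpihalf.
Qed.

(** The derivative of each cosine remainder is, up to sign, the preceding remainder for the sine, so
    [mean_value_bound] raises the order by one; the factorials are dropped. *)
Lemma cosD_taylor1 a x : `|cos (a + x) - cos a + sin a * x| <= x ^+ 2.
Proof.
have -> : x ^+ 2 = `|x| * `|x| by rewrite -expr2 real_normK ?num_real.
apply: (@mean_value_bound (fun x => cos (a + x) - cos a + sin a * x)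
  (fun x => - (sin (a + x) - sin a))).
- by move=> y; apply: is_derive_eq; rewrite /GRing.scale /=; ring.
- by rewrite addr0 subrr mulr0 addr0.
- move=> y yx; rewrite normrN; apply: le_trans yx; exact: sinD_taylor0.
Qed.

Lemma sinD_taylor1 a x : `|sin (a + x) - sin a - cos a * x| <= x ^+ 2.
Proof.
have := cosD_taylor1 (a - pi / 2) x.
by rewrite (addrAC a) !cosBpihalf sinBpihalf mulNr.
Qed.

Lemma cosD_taylor2 a x :
  `|cos (a + x) - cos a + sin a * x + cos a * x ^+ 2 / 2| <= `|x| ^+ 3.
Proof.
have -> : `|x| ^+ 3 = `|x| ^+ 2 * `|x| by rewrite exprSr.
apply: (@mean_value_bound (fun x => cos (a + x) - cos a + sin a * x + cos a * x ^+ 2 / 2)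
  (fun x => - (sin (a + x) - sin a - cos a * x))).
- by move=> y; apply: is_derive_eq; rewrite /GRing.scale /=; field.
- by rewrite addr0 subrr mulr0 expr0n /= mulr0 mul0r !addr0.
- move=> y yx; rewrite normrN; apply: (le_trans (sinD_taylor1 _ _)).
  by rewrite -real_normK ?num_real // lerXn2r // nnegrE.
Qed.

End trigonometric_bounds.

Section joint_measurability.
Context {R : realType} {d : measure_display} {T : measurableType d}.
Variable a : R -> T -> R.
Hypothesis ma : forall u, measurable_fun setT (a u).
Hypothesis ca : forall w, continuous (a ^~ w).

Let grid_pt (n : nat) (u : R) : R := (Num.floor (n.+1%:R * u))%:~R / n.+1%:R.

Let grid_pt_le n u : `|u - grid_pt n u| <= n.+1%:R^-1.
Proof.
have n0 : 0 < n.+1%:R :> R by rewrite ltr0n.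
have -> : u - grid_pt n u = (n.+1%:R * u - (Num.floor (n.+1%:R * u))%:~R) / n.+1%:R.
  by rewrite /grid_pt; field; rewrite gt_eqF.
rewrite normrM [`|_^-1|]gtr0_norm ?invr_gt0 // ler_piMl ?invr_ge0 ?ltW //.
have := floor_itv (n.+1%:R * u); rewrite intrD => /andP[h1 h2].
by rewrite ger0_norm ?subr_ge0 // ltrBlDl.
Qed.

(** Rounding the time down to a multiple of 1 / (n + 1) gives functions that are constant in time on
    countably many intervals, hence jointly measurable. They converge by continuity of the paths. *)
Lemma measurable_fun_continuous_path :
  measurable_fun setT (fun z : R * T => a z.1 z.2).
Proof.
apply: (@measurable_fun_cvg _ _ _ _ (fun n (z : R * T) => a (grid_pt n z.1) z.2)).
  move=> n _ B mB; rewrite setTI.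
  have -> : (fun z : R * T => a (grid_pt n z.1) z.2) @^-1` B =
     \bigcup_(j in [set: int]) ([set u : R | Num.floor (n.+1%:R * u) = j] `*`
        (a (j%:~R / n.+1%:R) @^-1` B)).
    apply/seteqP; split=> [[u w] /= h|[u w] [j _ [/= <-]]] //.
    by exists (Num.floor (n.+1%:R * u)).
  apply: countable_bigcupT_measurable => // j.
  apply: measurableX; last by rewrite -[U in measurable U]setTI; exact: ma.
  rewrite (_ : [set u : R | _] = `[j%:~R / n.+1%:R, (j + 1)%:~R / n.+1%:R[%classic).
    exact: measurable_itv.
  apply/seteqP; split => u /=; rewrite in_itv /= ler_pdivrMr // ltr_pdivlMr // ![u * _]mulrC.
    by move=> <-; exact: floor_itv.
  by move=> h; exact: floor_def.
move=> [u w] _ /=.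
apply: (@continuous_cvg _ _ _ _ _ (fun n => grid_pt n u) (a ^~ w) u).
  exact: ca.
apply/cvgrPdist_le => e e0; near=> n.
apply: le_trans (grid_pt_le n u) _.
rewrite -[leRHS]invrK lef_pV2 ?posrE ?invr_gt0 // ltW //.
apply: (lt_le_trans (archi_boundP _)); first by rewrite invr_ge0 ltW.
rewrite ler_nat; apply: leqW; near: n; exact: nbhs_infty_ge.
Unshelve. all: by end_near. Qed.

End joint_measurability.

Section fubini_bound.
Context {R : realType} {d : measure_display} {T : measurableType d}.
Variable P : probability T R.

Lemma fubini_bound (phi : R -> T -> R) (M c s t : R) : s <= t ->
  measurable_fun setT (fun z : R * T => phi z.1 z.2) ->
  (forall u w, 0 <= phi u w <= M) ->
  (forall u, s <= u <= t -> Ex P (phi u) <= c) ->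
  let K w := \int[lebesgue_measure]_(u in `[s, t]) phi u w in
  [/\ L1 P K, Ex P K <= c * (t - s),
     forall w, measurable_fun setT (phi ^~ w) &
     forall w, (\int[lebesgue_measure]_(u in `[s, t]) (phi u w)%:E = (K w)%:E)%E].
Proof.
move=> st mphi phiM phic K.
have mw w : measurable_fun setT (phi ^~ w).
  exact: (measurableT_comp mphi (pair2_measurable w)).
have mu u : measurable_fun setT (phi u).
  exact: (measurableT_comp mphi (pair1_measurable u)).
have lmu : (lebesgue_measure (`[s, t]%classic : set R) = (t - s)%:E)%E.
  rewrite lebesgue_measure_itv /= lte_fin; case: ltP => // ts.
  by rewrite (@le_anti _ _ s t) ?st // subrr.
have bw w : (\int[lebesgue_measure]_(u in `[s, t]) (phi u w)%:E <= (M * (t - s))%:E)%E.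
  apply: (@le_trans _ _ (\int[lebesgue_measure]_(u in `[s, t]) (cst M%:E u))%E).
    apply: ge0_le_integral => //.
    - by move=> u _; rewrite lee_fin; have /andP[] := phiM u w.
    - by apply/measurable_EFinP; apply: measurable_funTS; exact: mw.
    - by move=> u _; rewrite lee_fin; have /andP[] := phiM u w.
  by rewrite integral_cst //= [lebesgue_measure _]lmu EFinM.
have iK w : (\int[lebesgue_measure]_(u in `[s, t]) (phi u w)%:E = (K w)%:E)%E.
  rewrite /K /Rintegral fineK // ge0_fin_numE; first exact: le_lt_trans (bw w) (ltry _).
  by apply: integral_ge0 => u _; rewrite lee_fin; have /andP[] := phiM u w.
pose f (z : R * T) := (phi z.1 z.2 * \1_`[s, t] z.1)%:E.
have mf : measurable_fun setT f.
  apply/measurable_EFinP; apply: measurable_funM => //.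
  exact: (measurableT_comp (measurable_indic (measurable_itv _)) measurable_fst).
have f0 z : (0 <= f z)%E.
  by rewrite lee_fin mulr_ge0 //; have /andP[] := phiM z.1 z.2.
have Kf w : (K w)%:E = (\int[lebesgue_measure]_u f (u, w))%E.
  rewrite -iK integral_mkcond; apply: eq_integral => u _ /=.
  rewrite /f /patch indicE; case: ifP => /= _; first by rewrite mulr1.
  by rewrite mulr0.
have fub := fubini_tonelli (m1 := lebesgue_measure) (m2 := P) f mf f0.
have mK : measurable_fun setT K.
  apply/measurable_EFinP; rewrite (_ : _ \o _ = fubini_G lebesgue_measure f).
    exact: measurable_fun_fubini_tonelli_G.
  by apply/funext => w /=; rewrite Kf.
have K0 w : 0 <= K w.
  by apply: Rintegral_ge0 => u _; have /andP[] := phiM u w.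
have KM w : K w <= M * (t - s) by rewrite -lee_fin -iK.
have lK : L1 P K.
  by apply: (@L1_bounded _ _ _ P _ (M * (t - s))) => // w; rewrite ger0_norm.
split => //.
rewrite -lee_fin ExE //.
under eq_integral do rewrite Kf.
rewrite -fub.
have lphi u : L1 P (phi u).
  apply: (@L1_bounded _ _ _ P _ M) => // w.
  by have /andP[h1 h2] := phiM u w; rewrite ger0_norm.
have -> : (\int[lebesgue_measure]_x \int[P]_y f (x, y) =
    \int[lebesgue_measure]_(u in `[s, t]) (Ex P (phi u))%:E)%E.
  rewrite [RHS]integral_mkcond; apply: eq_integral => u _ /=.
  rewrite /patch; case: ifPn => us.
    by rewrite ExE //; apply: eq_integral => w _; rewrite /f /= indicE us mulr1.
  by rewrite integral0_eq // => w _; rewrite /f /= indicE (negbTE us) mulr0.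
apply: (@le_trans _ _ (\int[lebesgue_measure]_(u in `[s, t]) (cst c%:E u))%E).
  apply: ge0_le_integral => //.
  - by move=> u _; rewrite lee_fin; apply: Ex_ge0 => w; have /andP[] := phiM u w.
  - apply: measurable_funTS.
    rewrite (_ : (fun _ => _) = fubini_F P (fun z : R * T => (phi z.1 z.2)%:E)); last first.
      by apply/funext => u; rewrite ExE.
    apply: measurable_fun_fubini_tonelli_F; first exact/measurable_EFinP.
    by move=> z; rewrite lee_fin; have /andP[] := phiM z.1 z.2.
by rewrite integral_cst //= [lebesgue_measure _]lmu EFinM.
Qed.

End fubini_bound.

Section more_expectation.
Context {R : realType} {d : measure_display} {T : measurableType d}.
Variable P : probability T R.

Lemma L2_ae_bounded (V : T -> R) K : measurable_fun setT V ->
  {ae P, forall w, `|V w| <= K} -> L2 P V /\ Ex P (fun w => V w ^+ 2) <= K ^+ 2.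
Proof.
move=> mV hV.
have m2 : measurable_fun setT (fun w => V w ^+ 2) by exact: measurable_funX.
have sq w : `|V w| <= K -> V w ^+ 2 <= K ^+ 2.
  move=> h; rewrite -real_normK ?num_real // lerXn2r // nnegrE //.
  exact: le_trans h.
have l1 : L1 P (fun w => V w ^+ 2).
  apply: (@L1_ae_eq _ _ _ P (fun w => Num.min (V w ^+ 2) (K ^+ 2))) => //.
    apply: (@L1_bounded _ _ _ P _ (K ^+ 2)).
      by apply: measurable_minr.
    move=> w; rewrite ger0_norm ?ge_min ?lexx ?orbT //.
    by rewrite le_min !sqr_ge0.
  by apply: filterS hV => w /sq h; rewrite min_l.
split => //; rewrite -[leRHS](@Ex_cst _ _ _ P).
apply: Ex_ae_le => //; first exact: L1_cst.
by apply: filterS hV => w /sq.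
Qed.

(** The inequality between arithmetic and geometric means with a free scale [c]. It replaces the
    Cauchy-Schwarz inequality once [c] is chosen of the order of the root mean square. *)
Lemma Ex_norm_le_sqr (V : T -> R) c : 0 < c -> L2 P V ->
  Ex P (fun w => `|V w|) <= 2^-1 * (c + c^-1 * Ex P (fun w => V w ^+ 2)).
Proof.
move=> c0 lV.
rewrite -(ExZ c^-1 (L2_sqr lV)) -{1}(@Ex_cst _ _ _ P c).
rewrite -ExD; [|exact: L1_cst|by apply: L1Z; exact: L2_sqr].
rewrite -ExZ; last by apply: L1D; [exact: L1_cst|by apply: L1Z; exact: L2_sqr].
apply: Ex_le.
- by apply: L1_norm; exact: L2_L1.
- by apply: L1Z; apply: L1D; [exact: L1_cst|by apply: L1Z; exact: L2_sqr].
- move=> w; set x := V w.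
  rewrite -(ler_pM2l c0) -subr_ge0.
  have -> : c * (2^-1 * (c + c^-1 * x ^+ 2)) - c * `|x| = 2^-1 * (c - `|x|) ^+ 2.
    rewrite -(real_normK (num_real x)); field; exact: lt0r_neq0.
  by rewrite mulr_ge0 ?sqr_ge0.
Qed.

End more_expectation.

Lemma measurable_cosR {R : realType} : measurable_fun setT (@cos R).
Proof. by apply: continuous_measurable_fun; exact: continuous_cos. Qed.

Lemma measurable_sinR {R : realType} : measurable_fun setT (@sin R).
Proof. by apply: continuous_measurable_fun; exact: continuous_sin. Qed.

Section regular_solution.
Context {R : realType} {d : measure_display} {T : measurableType d}.
Variables (P : probability T R) (Z : R -> T -> R[i]).
Hypothesis CBM : two_sided_complex_BM P Z.
Local Notation F := (past P Z).
Variables (beta delta : R).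

Definition drift_rate (u : R) : R := beta / 4 * expR (beta / 4 * u).
Local Notation rate := drift_rate.

(* M stands for the real part of the stochastic integral over [s, t]; of the Ito
   integral only orthogonality to the past and an L^2 comparison with one
   Brownian increment are retained. *)
Record regular_solution (lambda : R) (a : R -> T -> R) : Prop := {
  reg_continuous : forall w, continuous (a ^~ w) ;
  reg_adapted : forall u, measurable_wrt (F u) (a u) ;
  reg_start : {ae P, forall w, a u w @[u --> -oo] --> 0} ;
  reg_sde : forall s t, s <= t -> exists M : T -> R,
    [/\ L2 P M,
     forall G C, measurable_wrt (F s) G -> (forall w, `|G w| <= C) ->
       Ex P (fun w => G w * M w) = 0,
     forall p q C c, measurable_wrt (F s) p -> measurable_wrt (F s) q ->
       (forall w, `|p w| <= C) -> (forall w, `|q w| <= C) ->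
       (forall u, s <= u <= t ->
         Ex P (fun w => (cos (a u w) - 1 - p w) ^+ 2 + (- sin (a u w) - q w) ^+ 2) <= c) ->
       Ex P (fun w => (M w - gauss_step Z s t p q w) ^+ 2) <= 4 * (c * (t - s)) &
     {ae P, forall w, a t w - a s w =
        \int[lebesgue_measure]_(u in `[s, t]) (lambda * rate u - delta * sin (a u w))
        + M w}] }.

Lemma Re_drift (x : R) :
  Re ((expi (- x) - 1) * (- ('i%C * delta%:C))) = - (delta * sin x).
Proof. by rewrite /expi sinN /=; ring. Qed.

Lemma Re_expi_sub1 (x : R) : Re (expi (- x) - 1) = cos x - 1.
Proof. by rewrite /expi /= cosN. Qed.

Lemma Im_expi_sub1 (x : R) : Im (expi (- x) - 1) = - sin x.
Proof. by rewrite /expi /= sinN subr0. Qed.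

Lemma strong_solution_regular lambda a : strong_solution P Z beta delta lambda a ->
  exists2 a', regular_solution lambda a' & {ae P, forall w, forall u, a u w = a' u w}.
Proof.
move=> sol.
have [N0 [mN PN sN]] := sol_continuous sol.
(* Setting the path to 0 on a null set keeps it adapted, because [past] is completed. *)
pose a' u w := a u w * \1_(~` N0) w.
have aN w : ~ N0 w -> forall u, a' u w = a u w.
  by move=> nN u; rewrite /a' indicE mem_set // mulr1.
have ae' : {ae P, forall w, forall u, a u w = a' u w}.
  exists N0; split => // w /= h; apply: contrapT => nN; apply: h => u.
  by rewrite aN.
have ca' w : continuous (a' ^~ w).
  have [Nw|nN] := pselect (N0 w).
    rewrite (_ : a' ^~ w = fun=> 0); first by move=> u; exact: cvg_cst.
    by apply/funext => u; rewrite /a' indicE memNset ?mulr0 //; exact.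
  rewrite (_ : a' ^~ w = a ^~ w); last by apply/funext => u; rewrite aN.
  by apply: contrapT => h; apply: nN; apply: sN.
have ad u : measurable_wrt (F u) (a' u).
  have sF := past_sigma_algebra P Z u.
  apply: measurable_wrtM => //; first exact: (sol_adapted sol).
  have FN : F u (~` N0).
    have : F u N0 by apply: completed_null => //; exact: sigma_of_sigma_algebra.
    by case: sF => _ FC _ /FC; rewrite setTD.
  rewrite -(sigma_algebra_id sF) in FN *.
  by apply/measurable_wrtP; exact: (measurable_indic (T := g_sigma_algebraType (F u))).
have ma' u : measurable_fun setT (a' u).
  by apply: measurable_wrt_measurable (ad u); exact: past_measurable.
have mj := measurable_fun_continuous_path ma' ca'.
exists a' => //; split => //.
  apply: filterS2 ae' (sol_start sol) => w e.
  by rewrite (_ : a ^~ w = a' ^~ w) //; apply/funext.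
move=> s t st.
have [I hI eI] := sol_sde sol st.
have z0 : measurable_wrt (F s) (fun=> 0 : R).
  by apply: measurable_wrt_cst; exact: past_sigma_algebra.
(* [ito_L2] with the time integral of phi as dominating variable: Fubini's theorem turns the bound
   [c] on the mean of phi at each time into a bound on the mean of that integral. *)
have key p q C c : measurable_wrt (F s) p -> measurable_wrt (F s) q ->
    (forall w, `|p w| <= C) -> (forall w, `|q w| <= C) ->
    (forall u, s <= u <= t ->
       Ex P (fun w => (cos (a' u w) - 1 - p w) ^+ 2 + (- sin (a' u w) - q w) ^+ 2) <= c) ->
    L2 P (Re \o I) /\
    Ex P (fun w => (Re (I w) - gauss_step Z s t p q w) ^+ 2) <= 4 * (c * (t - s)).
  move=> mp mq pC qC hc.
  pose phi u w := (cos (a' u w) - 1 - p w) ^+ 2 + (- sin (a' u w) - q w) ^+ 2.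
  have mp' := measurable_wrt_measurable (@past_measurable _ _ _ P Z s) mp.
  have mq' := measurable_wrt_measurable (@past_measurable _ _ _ P Z s) mq.
  have mphi : measurable_fun setT (fun z : R * T => phi z.1 z.2).
    apply: measurable_funD; apply: measurable_funX; apply: measurable_funB.
    - apply: measurable_funB => //; exact: (measurableT_comp measurable_cosR mj).
    - exact: (measurableT_comp mp' measurable_snd).
    - by apply: measurableT_comp => //; exact: (measurableT_comp measurable_sinR mj).
    - exact: (measurableT_comp mq' measurable_snd).
  have phiM u w : 0 <= phi u w <= 2 * (2 + C) ^+ 2.
    rewrite addr_ge0 ?sqr_ge0 //=.
    have h1 := cos_le1 (a' u w); have h2 := cos_geN1 (a' u w).
    have h3 := sin_le1 (a' u w); have h4 := sin_geN1 (a' u w).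
    have := pC w; have := qC w; rewrite !ler_norml => /andP[h5 h6] /andP[h7 h8].
    have sq x : `|x| <= 2 + C -> x ^+ 2 <= (2 + C) ^+ 2.
      move=> h; rewrite -real_normK ?num_real // lerXn2r // nnegrE //.
      exact: le_trans h.
    rewrite mulr_natl mulr2n lerD // sq // ler_norml; apply/andP; split; lra.
  have [lK eK mw iK] := fubini_bound st mphi phiM hc.
  have hae : {ae P, forall w, [/\
     measurable_fun `[s, t] (fun u => Re (expi (- a u w) - 1)),
     measurable_fun `[s, t] (fun u => Im (expi (- a u w) - 1)) &
     (\int[lebesgue_measure]_(u in `[s, t])
        ((Re (expi (- a u w) - 1) - p w) ^+ 2 + (Im (expi (- a u w) - 1) - q w) ^+ 2)%:E <=
      (\int[lebesgue_measure]_(u in `[s, t]) phi u w)%:E)%E]}.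
    apply: filterS ae' => w e; split.
    - rewrite (_ : (fun _ => _) = fun u => cos (a' u w) - 1); last first.
        by apply/funext => u; rewrite Re_expi_sub1 e.
      apply: measurable_funB => //; apply: measurable_funTS.
      apply: (measurableT_comp measurable_cosR).
      by apply: continuous_measurable_fun; exact: ca'.
    - rewrite (_ : (fun _ => _) = fun u => - sin (a' u w)); last first.
        by apply/funext => u; rewrite Im_expi_sub1 e.
      apply: measurableT_comp => //; apply: measurable_funTS.
      apply: (measurableT_comp measurable_sinR).
      by apply: continuous_measurable_fun; exact: ca'.
    - rewrite -iK; under eq_integral do rewrite Re_expi_sub1 Im_expi_sub1 e.
      exact: lexx.
  have [lI hL] := ito_L2 CBM st hI mp mq pC qC lK hae.
  by split => //; apply: le_trans hL _; rewrite ler_pM2l.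
have lI : L2 P (Re \o I) by have [? []] := ito_approx CBM ltr01 hI.
exists (Re \o I); split => //.
- by move=> G C mG GC; exact: (ito_mean CBM hI mG GC).
- by move=> p q C c mp mq pC qC hc; have [] := key p q C c mp mq pC qC hc.
- apply: filterS2 ae' eI => w e; rewrite -!e => ->.
  apply: (f_equal (fun x => x + Re (I w))).
  by apply: eq_Rintegral => u _; rewrite Re_drift e /rate; ring.
Qed.

(** Polarization: th = ((1 + th)^2 - (1 - th)^2) / 4, the factors 1 + th and 1 - th being absorbed
    into the coefficients of two Gaussian steps. *)
Lemma gauss_step_weighted s t p q th C : s <= t ->
  measurable_wrt (F s) p -> measurable_wrt (F s) q -> measurable_wrt (F s) th ->
  (forall w, `|p w| <= C) -> (forall w, `|q w| <= C) -> (forall w, `|th w| <= C) ->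
  L1 P (fun w => th w * gauss_step Z s t p q w ^+ 2) /\
  Ex P (fun w => th w * gauss_step Z s t p q w ^+ 2) =
    Ex P (fun w => th w * (p w ^+ 2 + q w ^+ 2)) * (t - s).
Proof.
move=> st mp mq mth pC qC thC.
have sF := past_sigma_algebra P Z s.
have C0 : 0 <= C by exact: le_trans (normr_ge0 _) (pC point).
pose f (e : R) (g : T -> R) := fun w => (1 + e * th w) * g w.
have mf e g : measurable_wrt (F s) g -> measurable_wrt (F s) (f e g).
  move=> mg; apply: measurable_wrtM => //; apply: measurable_wrtD => //.
    exact: measurable_wrt_cst.
  by apply: measurable_wrtM => //; exact: measurable_wrt_cst.
have fM e g : `|e| <= 1 -> (forall w, `|g w| <= C) -> forall w, `|f e g w| <= (1 + C) * C.
  move=> e1 gC w; rewrite normrM ler_pM //.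
  rewrite (le_trans (ler_normD _ _)) // normr1 lerD2l normrM -[leRHS]mul1r.
  by rewrite ler_pM.
have n1 : `|1 : R| <= 1 by rewrite normr1.
have nN1 : `|-1 : R| <= 1 by rewrite normrN normr1.
have z0 : L2 P (fun=> 0) by exact: L2_cst.
have mz0 : measurable_wrt (F s) (fun=> 0 : R) by exact: measurable_wrt_cst.
have [l1 _ _ e1] := gauss_step_facts CBM st z0 mz0 (mf 1 p mp) (mf 1 q mq) (fM 1 p n1 pC) (fM 1 q n1 qC).
have [l2 _ _ e2] := gauss_step_facts CBM st z0 mz0 (mf (-1) p mp) (mf (-1) q mq) (fM (-1) p nN1 pC) (fM (-1) q nN1 qC).
have key w : th w * gauss_step Z s t p q w ^+ 2 =
    4^-1 * (gauss_step Z s t (f 1 p) (f 1 q) w ^+ 2 - gauss_step Z s t (f (-1) p) (f (-1) q) w ^+ 2).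
  by rewrite /gauss_step /f; field.
have lf e g : `|e| <= 1 -> measurable_wrt (F s) g -> (forall w, `|g w| <= C) -> L2 P (f e g).
  by move=> h1 h2 h3; exact: (past_bounded_L2 (mf e g h2) (fM e g h1 h3)).
split.
  rewrite (_ : (fun _ => _) = fun w => 4^-1 * (gauss_step Z s t (f 1 p) (f 1 q) w ^+ 2 -
     gauss_step Z s t (f (-1) p) (f (-1) q) w ^+ 2)); last by apply/funext.
  by apply: L1Z; apply: L1B; exact: L2_sqr.
rewrite (@eq_Ex _ _ _ P _ _ key) ExZ; last by apply: L1B; exact: L2_sqr.
rewrite ExB; [|exact: L2_sqr|exact: L2_sqr].
rewrite e1 e2 -mulrBl mulrA -ExB; last 2 first.
- by apply: L1D; apply: L2_sqr; exact: lf.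
- by apply: L1D; apply: L2_sqr; exact: lf.
congr (_ * _); rewrite -ExZ; last first.
  by apply: L1B; apply: L1D; apply: L2_sqr; exact: lf.
by apply: eq_Ex => w; rewrite /f; field.
Qed.

Lemma rate_gt0 u : 0 < beta -> 0 < rate u.
Proof. by move=> b0; rewrite mulr_gt0 ?expR_gt0 // divr_gt0. Qed.

Lemma rate_le u v : 0 < beta -> u <= v -> rate u <= rate v.
Proof.
move=> b0 uv; rewrite ler_pM2l ?divr_gt0 // ler_expR ler_pM2l // divr_gt0 //.
Qed.

Lemma rate_lip s u : 0 < beta -> s <= u -> `|rate u - rate s| <= beta / 4 * rate u * (u - s).
Proof.
move=> b0 su; rewrite ger0_norm ?subr_ge0 ?rate_le // /rate.
set b := beta / 4; have b4 : 0 < b by rewrite divr_gt0.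
have h := expR_ge1Dx (b * s - b * u).
have e : expR (b * s) = expR (b * u) * expR (b * s - b * u).
  by rewrite -expRD addrC subrK.
have eu : 0 < expR (b * u) by exact: expR_gt0.
rewrite e -mulrBr -[X in _ <= X]mulrA ler_pM2l //.
apply: (@le_trans _ _ (expR (b * u) * (b * u - b * s))); last first.
  by rewrite le_eqVlt; apply/orP; left; apply/eqP; ring.
rewrite -[X in X - _]mulr1 -mulrBr ler_pM2l //; lra.
Qed.

Section steps.
Variables (lambda : R) (a : R -> T -> R).
Hypotheses (beta_gt0 : 0 < beta) (delta_ge0 : 0 <= delta).
Hypothesis reg : regular_solution lambda a.

Lemma reg_measurable u : measurable_fun setT (a u).
Proof.
by apply: measurable_wrt_measurable (reg_adapted reg u); exact: past_measurable.
Qed.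

Let mj : measurable_fun setT (fun z : R * T => a z.1 z.2).
Proof. exact: (measurable_fun_continuous_path reg_measurable (reg_continuous reg)). Qed.

Let mu := @lebesgue_measure R.

Let int_cont (f : R -> R) s t : continuous f -> mu.-integrable `[s, t] (EFin \o f).
Proof.
move=> cf; apply: continuous_compact_integrable; first exact: segment_compact.
exact: continuous_subspaceT.
Qed.

Let mu_itv s t : s <= t -> fine (mu (`[s, t]%classic : set R)) = t - s.
Proof.
move=> st; rewrite /mu lebesgue_measure_itv /= lte_fin; case: ltP => //= ts.
by rewrite (@le_anti _ _ s t) ?st // subrr.
Qed.

Lemma continuous_rate : continuous rate.
Proof.
move=> u; apply: cvgM; first exact: cvg_cst.
apply: (cvg_comp (fun u => beta / 4 * u) expR); last exact: continuous_expR.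
by apply: cvgM; [exact: cvg_cst|exact: cvg_id].
Qed.

Let cdrift w : continuous (fun u => lambda * rate u - delta * sin (a u w)).
Proof.
move=> u; apply: cvgB; apply: cvgMr; first exact: continuous_rate.
apply: (cvg_comp (a ^~ w) sin); last exact: continuous_sin.
exact: (reg_continuous reg).
Qed.

Lemma step_decomposition s t : s <= t -> exists M V : T -> R,
  [/\ L2 P M, measurable_fun setT V,
     forall w, a t w = a s w + M w + V w &
   [/\ forall G C, measurable_wrt (F s) G -> (forall w, `|G w| <= C) ->
       Ex P (fun w => G w * M w) = 0,
     forall p q C c, measurable_wrt (F s) p -> measurable_wrt (F s) q ->
       (forall w, `|p w| <= C) -> (forall w, `|q w| <= C) ->
       (forall u, s <= u <= t ->
         Ex P (fun w => (cos (a u w) - 1 - p w) ^+ 2 + (- sin (a u w) - q w) ^+ 2) <= c) ->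
       Ex P (fun w => (M w - gauss_step Z s t p q w) ^+ 2) <= 4 * (c * (t - s)) &
     {ae P, forall w, V w =
        \int[lebesgue_measure]_(u in `[s, t]) (lambda * rate u - delta * sin (a u w))}]].
Proof.
move=> st; have [M [lM GM hM eM]] := reg_sde reg st.
(* The drift part is defined as a difference, so that it is measurable and the decomposition holds
   at every [w]; it is the time integral almost everywhere. *)
exists M, (fun w => a t w - a s w - M w); split => //.
- apply: measurable_funB; last exact: L2_measurable lM.
  by apply: measurable_funB; exact: reg_measurable.
- by move=> w; ring.
- split => //.
  by apply: filterS eM => w ->; ring.
Qed.

Definition drift_bound U := `|lambda| * rate U + delta.

Lemma drift_bound_ge0 U : 0 <= drift_bound U.
Proof. by rewrite addr_ge0 // mulr_ge0 // ltW // rate_gt0. Qed.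

Lemma drift_int_le s t U w : s <= t -> t <= U ->
  `|\int[mu]_(u in `[s, t]) (lambda * rate u - delta * sin (a u w))| <=
  drift_bound U * (t - s).
Proof.
move=> st tU; apply: (le_trans (le_normr_Rintegral _ (int_cont _ _ (@cdrift w)))) => //.
rewrite -[leRHS](_ : \int[mu]_(u in `[s, t]) drift_bound U = _); last first.
  by rewrite Rintegral_cst // mu_itv.
apply: le_Rintegral => //.
- apply: int_cont => u; apply: (cvg_comp (fun u => lambda * rate u - delta * sin (a u w)) (fun x => `|x|)).
    exact: cdrift.
  exact: norm_continuous.
- by apply: int_cont => u; exact: cvg_cst.
- move=> u; rewrite /= in_itv /= => /andP[su ut].
  rewrite (le_trans (ler_normB _ _)) // lerD // normrM.
    by rewrite ler_wpM2l // gtr0_norm ?rate_gt0 // rate_le // (le_trans ut).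
  by rewrite ger0_norm // ler_piMr // sin_max.
Qed.

Lemma drift_diff_le s t U w : s <= t -> t <= U ->
  `|\int[mu]_(u in `[s, t]) (lambda * rate u - delta * sin (a u w)) -
    (t - s) * (lambda * rate s - delta * sin (a s w))| <=
  `|lambda| * (beta / 4) * rate U * (t - s) ^+ 2 +
  delta * \int[mu]_(u in `[s, t]) `|sin (a u w) - sin (a s w)|.
Proof.
move=> st tU.
have cs : continuous (fun u => `|sin (a u w) - sin (a s w)|).
  move=> u; apply: (cvg_comp (fun u => sin (a u w) - sin (a s w)) (fun x => `|x|)); last exact: norm_continuous.
  apply: cvgB; last exact: cvg_cst.
  by apply: (cvg_comp (a ^~ w) sin); [exact: (reg_continuous reg)|exact: continuous_sin].
have cc (x : R) : continuous (fun _ : R => x) by move=> u; exact: cvg_cst.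
have -> : (t - s) * (lambda * rate s - delta * sin (a s w)) =
    \int[mu]_(u in `[s, t]) (lambda * rate s - delta * sin (a s w)).
  by rewrite Rintegral_cst // mu_itv // mulrC.
rewrite -RintegralB //; [|exact: int_cont|exact: int_cont].
have cd : continuous (fun u => lambda * rate u - delta * sin (a u w) -
    (lambda * rate s - delta * sin (a s w))).
  by move=> u; apply: cvgB; [exact: cdrift|exact: cvg_cst].
apply: (le_trans (le_normr_Rintegral _ (int_cont _ _ cd))) => //.
pose A := `|lambda| * (beta / 4) * rate U * (t - s).
have -> : `|lambda| * (beta / 4) * rate U * (t - s) ^+ 2 + delta *
    \int[mu]_(u in `[s, t]) `|sin (a u w) - sin (a s w)| =
    \int[mu]_(u in `[s, t]) (A + delta * `|sin (a u w) - sin (a s w)|).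
  rewrite RintegralD //; [|exact: int_cont|]; last first.
    by apply: int_cont => u; apply: cvgMr; exact: cs.
  rewrite RintegralZl //; last exact: int_cont.
  by rewrite Rintegral_cst // mu_itv // /A expr2 mulrA.
apply: le_Rintegral => //.
- apply: int_cont => u; apply: (cvg_comp (fun u => lambda * rate u - delta * sin (a u w) -
    (lambda * rate s - delta * sin (a s w))) (fun x => `|x|)); first exact: cd.
  exact: norm_continuous.
- by apply: int_cont => u; apply: cvgD; [exact: cvg_cst|apply: cvgMr; exact: cs].
- move=> u; rewrite /= in_itv /= => /andP[su ut].
  have -> : lambda * rate u - delta * sin (a u w) - (lambda * rate s - delta * sin (a s w)) =
     lambda * (rate u - rate s) - delta * (sin (a u w) - sin (a s w)) by ring.
  rewrite (le_trans (ler_normB _ _)) // lerD // normrM; last by rewrite ger0_norm.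
  have -> : A = `|lambda| * (beta / 4 * rate U * (t - s)) by rewrite /A; ring.
  rewrite ler_wpM2l // (le_trans (rate_lip beta_gt0 su)) //.
  have b4 : 0 < beta / 4 by rewrite divr_gt0.
  have ru : 0 <= rate u by rewrite ltW // rate_gt0.
  apply: ler_pM; [by rewrite mulr_ge0 // ltW|by rewrite subr_ge0| |by rewrite lerD2r].
  by rewrite ler_pM2l // rate_le // (le_trans ut).
Qed.

(** Keeps the integral of |sin a| where [drift_int_le] bounds the sine by 1: near -oo that integral
    is small in mean. *)
Lemma drift_sin_le s t w : s <= t -> t <= s + 1 ->
  `|\int[mu]_(u in `[s, t]) (lambda * rate u - delta * sin (a u w))| <=
  `|lambda| * rate t + delta * \int[mu]_(u in `[s, t]) `|sin (a u w)|.
Proof.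
move=> st ts1.
have cs : continuous (fun u => `|sin (a u w)|).
  move=> u; apply: (cvg_comp (fun u => sin (a u w)) (fun x => `|x|)); last exact: norm_continuous.
  by apply: (cvg_comp (a ^~ w) sin); [exact: (reg_continuous reg)|exact: continuous_sin].
have A0 : 0 <= `|lambda| * rate t by rewrite mulr_ge0 // ltW // rate_gt0.
apply: (le_trans (le_normr_Rintegral _ (int_cont _ _ (@cdrift w)))) => //.
apply: (@le_trans _ _ (\int[mu]_(u in `[s, t]) (`|lambda| * rate t + delta * `|sin (a u w)|))).
  apply: le_Rintegral => //.
  - apply: int_cont => u; apply: (cvg_comp (fun u => lambda * rate u - delta * sin (a u w)) (fun x => `|x|)).
      exact: cdrift.
    exact: norm_continuous.
  - by apply: int_cont => u; apply: cvgD; [exact: cvg_cst|apply: cvgMr; exact: cs].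
  - move=> u; rewrite /= in_itv /= => /andP[su ut].
    rewrite (le_trans (ler_normB _ _)) // lerD // normrM.
      by rewrite ler_wpM2l // gtr0_norm ?rate_gt0 // rate_le.
    by rewrite ger0_norm.
rewrite RintegralD //; [|by apply: int_cont => u; exact: cvg_cst|]; last first.
  by apply: int_cont => u; apply: cvgMr; exact: cs.
rewrite RintegralZl //; last exact: int_cont.
by rewrite Rintegral_cst // mu_itv // lerD2r ler_piMr // lerBlDl.
Qed.

End steps.

End regular_solution.

(** * Short time estimates for a solution *)

Section ito_step.
Context {R : realType} {d : measure_display} {T : measurableType d}.
Variables (P : probability T R) (Z : R -> T -> R[i]).
Hypothesis CBM : two_sided_complex_BM P Z.
Local Notation F := (past P Z).
Variables (beta delta lambda : R) (a : R -> T -> R).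
Hypotheses (beta_gt0 : 0 < beta) (delta_ge0 : 0 <= delta).
Hypothesis reg : regular_solution P Z beta delta lambda a.
Local Notation rate := (drift_rate beta).

Let ma u : measurable_fun setT (a u). Proof. exact: (reg_measurable reg). Qed.

Let mj : measurable_fun setT (fun z : R * T => a z.1 z.2).
Proof. exact: (measurable_fun_continuous_path ma (reg_continuous reg)). Qed.

Let mcos (k c : R) u : measurable_fun setT (fun w => cos (k * a u w + c)).
Proof.
apply: (measurableT_comp measurable_cosR).
by apply: measurable_funD => //; apply: measurable_funM.
Qed.

Let msin (k c : R) u : measurable_fun setT (fun w => sin (k * a u w + c)).
Proof.
apply: (measurableT_comp measurable_sinR).
by apply: measurable_funD => //; apply: measurable_funM.
Qed.

Let Fcomp u (phi : R -> R) : measurable_fun setT phi -> measurable_wrt (F u) (fun w => phi (a u w)).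
Proof.
move=> mphi; apply: (measurable_wrt_comp (past_sigma_algebra P Z u) mphi).
exact: (reg_adapted reg).
Qed.

Let Fcos u : measurable_wrt (F u) (fun w => cos (a u w) - 1).
Proof.
have h : measurable_fun setT (fun x : R => cos x - 1).
  by apply: measurable_funB => //; exact: measurable_cosR.
exact: (@Fcomp u _ h).
Qed.

Let Fsin u : measurable_wrt (F u) (fun w => - sin (a u w)).
Proof.
have h : measurable_fun setT (fun x : R => - sin x).
  by apply: measurableT_comp => //; exact: measurable_sinR.
exact: (@Fcomp u _ h).
Qed.

Lemma norm_cos_sub1 (x : R) : `|cos x - 1| <= 2.
Proof. by have := cos_le1 x; have := cos_geN1 x; rewrite ler_norml => h1 h2; apply/andP; split; lra. Qed.

Lemma norm_sinN (x : R) : `|- sin x| <= 2.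
Proof. by rewrite normrN (le_trans (sin_max x)) // ler1n. Qed.

Lemma cos_sin_norm2 (x : R) : (cos x - 1) ^+ 2 + (- sin x) ^+ 2 = 2 * (1 - cos x).
Proof. have := cos2Dsin2 x => h; rewrite sqrrN; nra. Qed.

Lemma cos_defect_le4 (x : R) : 2 * (1 - cos x) <= 4.
Proof. have := cos_geN1 x; lra. Qed.

Lemma sqr_sum_le (x y : R) : (x + y) ^+ 2 <= 2 * x ^+ 2 + 2 * y ^+ 2.
Proof. rewrite -subr_ge0 (_ : _ - _ = (x - y) ^+ 2) ?sqr_ge0 //; ring. Qed.

Lemma incr_L2 U : exists2 C, 0 <= C & forall s t, s <= t -> t <= s + 1 -> t <= U ->
  L2 P (fun w => a t w - a s w) /\ Ex P (fun w => (a t w - a s w) ^+ 2) <= C * (t - s).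
Proof.
pose D := drift_bound beta delta lambda U.
have D0 : 0 <= D by exact: drift_bound_ge0.
(* With p = q = 0, |e^{-ia} - 1|^2 <= 4 gives E M^2 <= 16 (t - s), and squaring the sum M + V
   doubles each part. *)
exists (32 + 2 * D ^+ 2); first by rewrite addr_ge0 // mulr_ge0 ?sqr_ge0.
move=> s t st ts1 tU.
have h0 : 0 <= t - s by rewrite subr_ge0.
have h1 : t - s <= 1 by rewrite lerBlDl addrC addrC.
have [M [V [lM mV aE [_ hM eV]]]] := step_decomposition reg st.
have z0 : measurable_wrt (F s) (fun=> 0 : R).
  by apply: measurable_wrt_cst; exact: past_sigma_algebra.
have n0 w : `|(fun=> 0 : R) (w : T)| <= 0 by rewrite normr0.
have M2 : Ex P (fun w => M w ^+ 2) <= 4 * (4 * (t - s)).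
  have := hM _ _ _ 4 z0 z0 n0 n0.
  rewrite (@eq_Ex _ _ _ _ _ (fun w => M w ^+ 2)); last by move=> w; rewrite /gauss_step !mul0r !subr0.
  apply => u _; rewrite -[leRHS](@Ex_cst _ _ _ P); apply: Ex_le.
  - apply: (@L1_bounded _ _ _ _ _ 4).
      apply: measurable_funD; apply: measurable_funX; apply: measurable_funB => //.
        by apply: measurable_funB => //; exact: (measurableT_comp measurable_cosR).
      by apply: measurableT_comp => //; exact: (measurableT_comp measurable_sinR).
    move=> w; rewrite !subr0 cos_sin_norm2 ger0_norm ?mulr_ge0 ?subr_ge0 ?cos_le1 //.
    exact: cos_defect_le4.
  - exact: L1_cst.
  - move=> w; rewrite !subr0 cos_sin_norm2; exact: cos_defect_le4.
have [lV V2] : L2 P V /\ Ex P (fun w => V w ^+ 2) <= (D * (t - s)) ^+ 2.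
  apply: L2_ae_bounded => //; apply: filterS eV => w ->.
  exact: (drift_int_le beta_gt0 delta_ge0 reg).
have dE : (fun w => a t w - a s w) = fun w => M w + V w.
  by apply/funext => w; rewrite aE; ring.
rewrite dE; split; first exact: L2D.
rewrite (@eq_Ex _ _ _ P _ (fun w => (M w + V w) ^+ 2)); last by move=> w; rewrite aE; congr (_ ^+ 2); ring.
apply: (@le_trans _ _ (Ex P (fun w => 2 * M w ^+ 2 + 2 * V w ^+ 2))).
  apply: Ex_le; [by apply: L2_sqr; exact: L2D| |by move=> w; exact: sqr_sum_le].
  by apply: L1D; apply: L1Z; exact: L2_sqr.
rewrite ExD ?ExZ; [|exact: L2_sqr|exact: L2_sqr|by apply: L1Z; exact: L2_sqr|by apply: L1Z; exact: L2_sqr].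
have D2 := sqr_ge0 D; have hh : (t - s) ^+ 2 <= t - s by rewrite expr2 ler_piMl.
have : (D * (t - s)) ^+ 2 <= D ^+ 2 * (t - s) by rewrite exprMn ler_wpM2l.
clear n0; nra.
Qed.

(** By [incr_L2] the solution moves by order sqrt (t - s) in mean square root. Freezing the
    coefficients at [s] therefore costs (t - s)^2 in mean square for the martingale part and (t -
    s)^(3/2) in mean for the drift. *)
Lemma step_estimates U : exists2 C, 0 <= C & forall s t, s < t -> t <= s + 1 -> t <= U ->
  exists M V : T -> R, [/\ L2 P M, L2 P V, forall w, a t w = a s w + M w + V w,
   (forall G K, measurable_wrt (F s) G -> (forall w, `|G w| <= K) ->
       Ex P (fun w => G w * M w) = 0) &
   [/\ Ex P (fun w => (M w -
        gauss_step Z s t (fun w => cos (a s w) - 1) (fun w => - sin (a s w)) w) ^+ 2) <=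
        C * (t - s) ^+ 2,
       Ex P (fun w => V w ^+ 2) <= C * (t - s) ^+ 2 &
       Ex P (fun w => `|V w - (t - s) * (lambda * rate s - delta * sin (a s w))|) <=
         C * ((t - s) * Num.sqrt (t - s))]].
Proof.
have [C0 C00 hC0] := incr_L2 U.
pose D := drift_bound beta delta lambda U.
have D0 : 0 <= D by exact: drift_bound_ge0.
have rU : 0 <= rate U by rewrite ltW // rate_gt0.
pose L := `|lambda| * (beta / 4) * rate U.
have L0 : 0 <= L by rewrite !mulr_ge0 // ltW.
pose C1 := L + delta * (2^-1 * (1 + C0)).
have C10 : 0 <= C1 by rewrite addr_ge0 // !mulr_ge0 // addr_ge0.
exists (8 * C0 + D ^+ 2 + C1); first by apply: addr_ge0 => //; rewrite addr_ge0 ?sqr_ge0 // mulr_ge0.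
move=> s t st ts1 tU; have stW := ltW st.
have h0 : 0 < t - s by rewrite subr_gt0.
have h1 : t - s <= 1 by rewrite lerBlDl addrC addrC.
have [M [V [lM mV aE [GM hM eV]]]] := step_decomposition reg stW.
have [lV V2] : L2 P V /\ Ex P (fun w => V w ^+ 2) <= (D * (t - s)) ^+ 2.
  apply: L2_ae_bounded => //; apply: filterS eV => w ->.
  exact: (drift_int_le beta_gt0 delta_ge0 reg).
exists M, V; split => //.
have h2 := sqr_ge0 (t - s); have D2 := sqr_ge0 D.
have C1h := mulr_ge0 C10 h2; have D2h := mulr_ge0 D2 h2; have C0h := mulr_ge0 C00 h2.
have incr u : s <= u <= t -> L2 P (fun w => a u w - a s w) /\
    Ex P (fun w => (a u w - a s w) ^+ 2) <= C0 * (t - s).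
  move=> /andP[su ut]; have [l e] := hC0 s u su (le_trans ut ts1) (le_trans ut tU).
  by split => //; apply: le_trans e _; rewrite ler_wpM2l // lerD2r.
have dcos u w : `|cos (a u w) - cos (a s w)| <= `|a u w - a s w|.
  by have := cosD_taylor0 (a s w) (a u w - a s w); rewrite subrKC.
have dsin u w : `|sin (a u w) - sin (a s w)| <= `|a u w - a s w|.
  by have := sinD_taylor0 (a s w) (a u w - a s w); rewrite subrKC.
split.
- apply: (@le_trans _ _ (4 * (2 * (C0 * (t - s)) * (t - s)))); last by nra.
  apply: (hM _ _ 2) => //; [by move=> w; exact: norm_cos_sub1|by move=> w; exact: norm_sinN|].
  move=> u /incr[lu eu].
  have sq x y : `|x| <= `|y| -> x ^+ 2 <= y ^+ 2 :> R.
    by move=> h; rewrite -(real_normK (num_real x)) -(real_normK (num_real y)) lerXn2r // nnegrE.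
  have pw w : (cos (a u w) - 1 - (cos (a s w) - 1)) ^+ 2 +
      (- sin (a u w) - - sin (a s w)) ^+ 2 <= 2 * (a u w - a s w) ^+ 2.
    rewrite mulr_natl mulr2n; apply: lerD; apply: sq.
      by rewrite (_ : _ - _ = cos (a u w) - cos (a s w)) //; ring.
    by rewrite (_ : _ - _ = - (sin (a u w) - sin (a s w))) ?normrN //; ring.
  apply: (@le_trans _ _ (Ex P (fun w => 2 * (a u w - a s w) ^+ 2))); last first.
    by rewrite ExZ ?ler_pM2l //; exact: L2_sqr.
  have l2 : L1 P (fun w => 2 * (a u w - a s w) ^+ 2) by apply: L1Z; exact: L2_sqr.
  apply: Ex_le => //; apply: L1_le l2 _.
    apply: measurable_funD; apply: measurable_funX; apply: measurable_funB.
    + by apply: measurable_funB => //; exact: (measurableT_comp measurable_cosR).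
    + by apply: measurable_funB => //; exact: (measurableT_comp measurable_cosR).
    + by apply: measurableT_comp => //; exact: (measurableT_comp measurable_sinR).
    + by apply: measurableT_comp => //; exact: (measurableT_comp measurable_sinR).
  by move=> w; rewrite ger0_norm // addr_ge0 // sqr_ge0.
- apply: (le_trans V2); rewrite exprMn; nra.
- pose phi u w := `|sin (a u w) - sin (a s w)|.
  set e := Num.sqrt (t - s).
  have e0 : 0 < e by rewrite sqrtr_gt0.
  have e2 : e ^+ 2 = t - s by rewrite sqr_sqrtr // ltW.
  have e1 : e <= 1 by rewrite -sqrtr1 ler_sqrt.
  have mphi : measurable_fun setT (fun z : R * T => phi z.1 z.2).
    apply: measurableT_comp => //; apply: measurable_funB.
      exact: (measurableT_comp measurable_sinR mj).
    by apply: (measurableT_comp measurable_sinR); exact: (measurableT_comp (ma s) measurable_snd).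
  have phiM u w : 0 <= phi u w <= 2.
    rewrite normr_ge0 /= (le_trans (ler_normB _ _)) // -[leRHS]/(1 + 1).
    by rewrite lerD // sin_max.
  have phic u : s <= u <= t -> Ex P (phi u) <= 2^-1 * (1 + C0) * e.
    move=> /incr[lu eu]; have := Ex_norm_le_sqr e0 lu.
    have : Ex P (phi u) <= Ex P (fun w => `|a u w - a s w|).
      apply: Ex_le; [|by apply: L1_norm; exact: L2_L1|by move=> w; exact: dsin].
      apply: (@L1_bounded _ _ _ _ _ 2).
        exact: (measurableT_comp mphi (pair1_measurable u)).
      by move=> w; rewrite normr_id; have /andP[] := phiM u w.
    have : e^-1 * Ex P (fun w => (a u w - a s w) ^+ 2) <= C0 * e.
      by rewrite mulrC ler_pdivrMr // -mulrA -expr2 e2.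
    lra.
  have [lK eK _ _] := fubini_bound stW mphi phiM phic.
  set K := (fun w => _) in lK eK.
  have lLK : L1 P (fun w => L * (t - s) ^+ 2 + delta * K w).
    by apply: L1D; [exact: L1_cst|exact: L1Z].
  apply: (@le_trans _ _ (Ex P (fun w => L * (t - s) ^+ 2 + delta * K w))).
    apply: Ex_ae_le => //.
      apply: L1_norm; apply: L1B; first exact: L2_L1.
      apply: L1Z; apply: L1B; first exact: L1_cst.
      apply: L1Z; apply: (@L1_bounded _ _ _ _ _ 1); first exact: (measurableT_comp measurable_sinR).
      by move=> w; exact: sin_max.
    apply: filterS eV => w ->; exact: (drift_diff_le beta_gt0 delta_ge0 reg).
  rewrite ExD ?Ex_cst ?ExZ //; [|exact: L1_cst|exact: L1Z].
  have : delta * Ex P K <= delta * (2^-1 * (1 + C0) * e * (t - s)) by rewrite ler_wpM2l.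
  have he : 0 <= (t - s) * e by rewrite mulr_ge0 // ltW.
  have : L * (t - s) ^+ 2 <= L * ((t - s) * e).
    by rewrite ler_wpM2l // -e2; have := ltW e0; nra.
  have := mulr_ge0 C00 he; have := mulr_ge0 D2 he.
  by rewrite /C1; nra.
Qed.

(** The phase [c] lets one formula serve for cosines, c = 0, and for sines, c = - pi / 2. *)
Definition mean_cos (k c u : R) : R := Ex P (fun w => cos (k * a u w + c)).

Lemma L1_cos k c u : L1 P (fun w => cos (k * a u w + c)).
Proof. by apply: (@L1_bounded _ _ _ _ _ 1) => // w; exact: cos_max. Qed.

(** This is (z + y)^3 <= 4 (z^3 + y^3) at z = 2 x. The 2 bounds the coefficient |cos a - 1| of a
    Gaussian step; the other coefficient, a sine, is at most 1. *)
Lemma cube_sum_le (x y : R) : 0 <= x -> 0 <= y ->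
  (2 * x + y) ^+ 3 <= 32 * x ^+ 3 + 4 * y ^+ 3.
Proof.
move=> x0 y0; rewrite -subr_ge0.
have -> : 32 * x ^+ 3 + 4 * y ^+ 3 - (2 * x + y) ^+ 3 =
  3 * (2 * x + y) * (2 * x - y) ^+ 2 by ring.
by rewrite mulr_ge0 ?sqr_ge0 // mulr_ge0 // addr_ge0 // mulr_ge0.
Qed.

(** Meant for [x1] of order e and [x2] of order e^2: Taylor expansion to second order in [x1] and
    first order in [x2]. The mixed product is split with weight [e], which balances its two halves
    at order e^3. *)
Lemma cos_increment_le (k th x1 x2 e : R) : 0 < e ->
  `|cos (th + k * (x1 + x2)) - cos th + k * sin th * (x1 + x2) +
    k ^+ 2 / 2 * (cos th * x1 ^+ 2)| <=
  k ^+ 2 * x2 ^+ 2 + k ^+ 2 / 2 * (e * x1 ^+ 2 + e^-1 * x2 ^+ 2) + `|k| ^+ 3 * `|x1| ^+ 3.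
Proof.
move=> e0.
have h1 := cosD_taylor1 (th + k * x1) (k * x2).
have h2 := sinD_taylor0 th (k * x1).
have h3 := cosD_taylor2 th (k * x1).
have -> : cos (th + k * (x1 + x2)) - cos th + k * sin th * (x1 + x2) +
    k ^+ 2 / 2 * (cos th * x1 ^+ 2) =
  (cos (th + k * x1 + k * x2) - cos (th + k * x1) + sin (th + k * x1) * (k * x2))
  - (sin (th + k * x1) - sin th) * (k * x2)
  + (cos (th + k * x1) - cos th + sin th * (k * x1) + cos th * (k * x1) ^+ 2 / 2).
  by rewrite mulrDr addrA; field.
rewrite (le_trans (ler_normD _ _)) // lerD //; last first.
  by rewrite (le_trans h3) // normrM exprMn.
rewrite (le_trans (ler_normB _ _)) // lerD //; first by rewrite (le_trans h1) // exprMn.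
rewrite normrM (le_trans (ler_wpM2r (normr_ge0 _) h2)) // !normrM.
have -> : `|k| * `|x1| * (`|k| * `|x2|) = k ^+ 2 / 2 * (2 * (`|x1| * `|x2|)).
  by rewrite -(real_normK (num_real k)); field.
apply: ler_wpM2l; first by rewrite mulr_ge0 ?sqr_ge0.
rewrite -(ler_pM2l e0) -subr_ge0.
have -> : e * (e * x1 ^+ 2 + e^-1 * x2 ^+ 2) - e * (2 * (`|x1| * `|x2|)) =
   (e * `|x1| - `|x2|) ^+ 2.
  rewrite -(real_normK (num_real x1)) -(real_normK (num_real x2)); field; exact: lt0r_neq0.
exact: sqr_ge0.
Qed.

(* Ito's formula in the mean, with an explicit error over short intervals. *)
Lemma ito_cos k c U : exists2 C, 0 <= C & forall s t, s <= t -> t <= s + 1 -> t <= U ->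
  `|mean_cos k c t - mean_cos k c s - (t - s) * Ex P (fun w =>
      - (k * (sin (k * a s w + c) * (lambda * rate s - delta * sin (a s w))))
      - k ^+ 2 * (cos (k * a s w + c) * (1 - cos (a s w))))| <=
  C * ((t - s) * Num.sqrt (t - s)).
Proof.
have [C C0 hC] := step_estimates U.
(* One summand for each error: the drift replaced by its value at [s], the square of [x2], the mixed
   product, and the cubic term, where 144 = 32 * 4 + 4 * 4. *)
pose K := `|k| * C + k ^+ 2 * (4 * C) + k ^+ 2 / 2 * (4 + 4 * C) + `|k| ^+ 3 * 144.
have k2 := sqr_ge0 k; have k22 : 0 <= k ^+ 2 / 2 by rewrite mulr_ge0.
have k3 : 0 <= `|k| ^+ 3 by rewrite exprn_ge0.
exists K.
  apply: addr_ge0; last by rewrite mulr_ge0.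
  apply: addr_ge0; last by rewrite mulr_ge0 // addr_ge0 // mulr_ge0.
  by apply: addr_ge0; apply: mulr_ge0 => //; apply: mulr_ge0.
move=> s t; rewrite le_eqVlt => /orP[/eqP <- _ _|st ts1 tU].
  by rewrite !subrr sqrtr0 !mul0r subrr normr0 !mulr0.
have stW := ltW st.
have h0 : 0 < t - s by rewrite subr_gt0.
have h1 : t - s <= 1 by rewrite lerBlDl addrC addrC.
have [M [V [lM lV aE GM [hN hV hW]]]] := hC s t st ts1 tU.
set e := Num.sqrt (t - s).
have e0 : 0 < e by rewrite sqrtr_gt0.
have e2 : e ^+ 2 = t - s by rewrite sqr_sqrtr // ltW.
have e1 : e <= 1 by rewrite -sqrtr1 ler_sqrt.
set x1 := gauss_step Z s t _ _ in hN.
set V0 := (fun w => lambda * rate s - delta * sin (a s w)) in hW *.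
pose W w := V w - (t - s) * V0 w.
(* The increment M + V equals x1 + x2: [x1] is the Gaussian step with coefficients frozen at [s],
   and the rest [x2] has mean square of order (t - s)^2. *)
pose x2 w := V w + (M w - x1 w).
pose sn w := sin (k * a s w + c); pose cn w := cos (k * a s w + c).
have msn : measurable_fun setT sn by exact: msin.
have mcn : measurable_fun setT cn by exact: mcos.
have snM w : `|sn w| <= 1 by exact: sin_max.
have cnM w : `|cn w| <= 1 by exact: cos_max.
have z0 : measurable_wrt (F s) (fun=> 0 : R).
  by apply: measurable_wrt_cst; exact: past_sigma_algebra.
have pb := fun w => norm_cos_sub1 (a s w).
have qb := fun w => norm_sinN (a s w).
have [lx1 _ _ x1E] := gauss_step_facts CBM stW (L2_cst P 0) z0 (@Fcos s) (@Fsin s) pb qb.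
rewrite -/x1 in lx1 x1E.
have Fcn : measurable_wrt (F s) cn.
  have h : measurable_fun setT (fun x : R => cos (k * x + c)).
    apply: (measurableT_comp measurable_cosR).
    by apply: measurable_funD => //; apply: measurable_funM.
  exact: (@Fcomp s _ h).
have Fsn : measurable_wrt (F s) sn.
  have h : measurable_fun setT (fun x : R => sin (k * x + c)).
    apply: (measurableT_comp measurable_sinR).
    by apply: measurable_funD => //; apply: measurable_funM.
  exact: (@Fcomp s _ h).
have cnM2 w : `|cn w| <= 2 by rewrite (le_trans (cnM w)) // ler1n.
have [lcx cxE] := gauss_step_weighted CBM stW (@Fcos s) (@Fsin s) Fcn pb qb cnM2.
rewrite -/x1 in lcx cxE.
have x1sq : Ex P (fun w => x1 w ^+ 2) <= 4 * (t - s).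
  rewrite x1E ler_pM2r // -[leRHS](@Ex_cst _ _ _ P); apply: Ex_le; last 2 first.
  - exact: L1_cst.
  - by move=> w; rewrite cos_sin_norm2; exact: cos_defect_le4.
  by apply: L1D; apply: L2_sqr; [exact: (past_bounded_L2 (@Fcos s) pb)|exact: (past_bounded_L2 (@Fsin s) qb)].
have [_ _ _ lX3 eX3] := BM_incr_moments (CBM_Re CBM) stW.
have [_ _ _ lY3 eY3] := BM_incr_moments (CBM_Im CBM) stW.
rewrite -/e in eX3 eY3.
have [l3 E3] : L1 P (fun w => `|x1 w| ^+ 3) /\ Ex P (fun w => `|x1 w| ^+ 3) <= 144 * ((t - s) * e).
  set X3 := (fun w => _) in lX3 eX3; set Y3 := (fun w => _) in lY3 eY3.
  have lXY : L1 P (fun w => 32 * X3 w + 4 * Y3 w) by apply: L1D; apply: L1Z.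
  have le3 w : `|x1 w| ^+ 3 <= 32 * X3 w + 4 * Y3 w.
    apply: le_trans (cube_sum_le (normr_ge0 _) (normr_ge0 _)); rewrite lerXn2r ?nnegrE ?addr_ge0 ?mulr_ge0 //.
    rewrite /x1 /gauss_step (le_trans (ler_normB _ _)) // !normrM lerD //.
      by rewrite ler_wpM2r.
    by rewrite -[leRHS]mul1r ler_wpM2r // normrN; exact: sin_max.
  have l3 : L1 P (fun w => `|x1 w| ^+ 3).
    apply: L1_le lXY _.
      by apply: measurable_funX; apply: measurableT_comp => //; exact: L2_measurable lx1.
    by move=> w; rewrite ger0_norm ?exprn_ge0.
  split => //; apply: (le_trans (Ex_le l3 lXY le3)).
  rewrite ExD; [|exact: L1Z|exact: L1Z].
  rewrite !ExZ //.
  have -> : 144 * ((t - s) * e) = 32 * (4 * e ^+ 3) + 4 * (4 * e ^+ 3) by rewrite -e2; ring.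
  by rewrite lerD // ler_pM2l.
have lN : L2 P (fun w => M w - x1 w) by exact: L2B.
have lx2 : L2 P x2 by exact: L2D.
have E2 : Ex P (fun w => x2 w ^+ 2) <= 4 * C * (t - s) ^+ 2.
  have ll : L1 P (fun w => 2 * V w ^+ 2 + 2 * (M w - x1 w) ^+ 2).
    by apply: L1D; apply: L1Z; apply: L2_sqr.
  apply: (le_trans (Ex_le (L2_sqr lx2) ll (fun w => sqr_sum_le (V w) (M w - x1 w)))).
  rewrite ExD; [|by apply: L1Z; exact: L2_sqr|by apply: L1Z; exact: L2_sqr].
  rewrite !ExZ; [|exact: L2_sqr|exact: L2_sqr].
  by move: hN hV; set E1 := Ex P _; set E2 := Ex P _; move=> ? ?; lra.
have lV0 : L1 P V0.
  apply: L1B; first exact: L1_cst.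
  apply: L1Z; apply: (@L1_bounded _ _ _ _ _ 1); first exact: (measurableT_comp measurable_sinR).
  by move=> w; exact: sin_max.
have lW : L1 P W by apply: L1B; [exact: L2_L1|exact: L1Z].
have lsM : L1 P (fun w => sn w * M w) by apply: L1_mul_bounded snM (L2_L1 lM).
have lsW : L1 P (fun w => sn w * W w) by apply: L1_mul_bounded snM lW.
have lsV : L1 P (fun w => sn w * V0 w) by apply: L1_mul_bounded snM lV0.
pose B w := k ^+ 2 * x2 w ^+ 2 + k ^+ 2 / 2 * (e * x1 w ^+ 2 + e^-1 * x2 w ^+ 2) +
   `|k| ^+ 3 * `|x1 w| ^+ 3.
(* The Taylor remainder with its linear part split: the term in [M] has mean 0, the term in [W] is
   an error, and the last two terms give the claimed derivative. *)
pose R1 w := cos (k * a t w + c) - cn w + (k * (sn w * M w) + (k * (sn w * W w) +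
   ((t - s) * (k * (sn w * V0 w)) + k ^+ 2 / 2 * (cn w * x1 w ^+ 2)))).
have R1B w : `|R1 w| <= B w.
  have := cos_increment_le k (k * a s w + c) (x1 w) (x2 w) e0.
  rewrite -/(sn w) -/(cn w) -/(B w); congr (`|_| <= _); rewrite /R1 /W.
  rewrite (_ : k * a s w + c + k * (x1 w + x2 w) = k * a t w + c); last first.
    by rewrite aE /x2; ring.
  by rewrite /x2; ring.
have lT1 : L1 P (fun w => cos (k * a t w + c) - cn w) by apply: L1B; exact: L1_cos.
have lT2 : L1 P (fun w => k * (sn w * M w)) by exact: L1Z.
have lT3 : L1 P (fun w => k * (sn w * W w)) by exact: L1Z.
have lT4 : L1 P (fun w => (t - s) * (k * (sn w * V0 w))) by do 2 apply: L1Z.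
have lT5 : L1 P (fun w => k ^+ 2 / 2 * (cn w * x1 w ^+ 2)) by exact: L1Z.
have lT45 := L1D lT4 lT5; have lT345 := L1D lT3 lT45; have lT25 := L1D lT2 lT345.
have lR1 : L1 P R1 by exact: (L1D lT1 lT25).
have lB1 : L1 P (fun w => k ^+ 2 * x2 w ^+ 2) by apply: L1Z; exact: L2_sqr.
have lB2' : L1 P (fun w => e * x1 w ^+ 2 + e^-1 * x2 w ^+ 2).
  by apply: L1D; apply: L1Z; exact: L2_sqr.
have lB2 := L1Z (k ^+ 2 / 2) lB2'.
have lB3 := L1Z (`|k| ^+ 3) l3.
have lB12 := L1D lB1 lB2.
have lB : L1 P B by exact: (L1D lB12 lB3).
have cx2E : Ex P (fun w => cn w * ((cos (a s w) - 1) ^+ 2 + (- sin (a s w)) ^+ 2)) =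
    Ex P (fun w => cn w * (2 * (1 - cos (a s w)))).
  by apply: eq_Ex => w; rewrite cos_sin_norm2.
have eR1 : Ex P R1 = mean_cos k c t - mean_cos k c s + (k * Ex P (fun w => sn w * W w) +
    ((t - s) * (k * Ex P (fun w => sn w * V0 w)) +
     k ^+ 2 / 2 * (Ex P (fun w => cn w * (2 * (1 - cos (a s w)))) * (t - s)))).
  rewrite (ExD lT1 lT25) (ExD lT2 lT345) (ExD lT3 lT45) (ExD lT4 lT5).
  rewrite (ExB (L1_cos k c t) (L1_cos k c s)) !ExZ //; last by exact: L1Z.
  by rewrite (GM sn 1 Fsn snM) mulr0 add0r cxE cx2E.
have eB : Ex P B = k ^+ 2 * Ex P (fun w => x2 w ^+ 2) +
   k ^+ 2 / 2 * (e * Ex P (fun w => x1 w ^+ 2) + e^-1 * Ex P (fun w => x2 w ^+ 2)) +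
   `|k| ^+ 3 * Ex P (fun w => `|x1 w| ^+ 3).
  rewrite (ExD lB12 lB3) (ExD lB1 lB2) !ExZ //; [|exact: L2_sqr].
  by rewrite ExD ?ExZ //; try exact: L2_sqr; apply: L1Z; exact: L2_sqr.
have el : Ex P (fun w => - (k * (sin (k * a s w + c) * (lambda * rate s - delta * sin (a s w))))
      - k ^+ 2 * (cos (k * a s w + c) * (1 - cos (a s w)))) =
   - (k * Ex P (fun w => sn w * V0 w)) - k ^+ 2 / 2 * Ex P (fun w => cn w * (2 * (1 - cos (a s w)))).
  have lc : L1 P (fun w => cn w * (2 * (1 - cos (a s w)))).
    apply: L1_mul_bounded cnM _ => //; apply: L1Z; apply: L1B; first exact: L1_cst.
    apply: (@L1_bounded _ _ _ _ _ 1); first exact: (measurableT_comp measurable_cosR).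
    by move=> w; exact: cos_max.
  rewrite -ExZ // -ExN; last exact: L1Z.
  rewrite -ExZ // -ExB; [|by apply: L1N; exact: L1Z|exact: L1Z].
  by apply: eq_Ex => w; rewrite /sn /cn /V0; field.
have -> : mean_cos k c t - mean_cos k c s - (t - s) * Ex P (fun w =>
      - (k * (sin (k * a s w + c) * (lambda * rate s - delta * sin (a s w))))
      - k ^+ 2 * (cos (k * a s w + c) * (1 - cos (a s w)))) =
    Ex P R1 - k * Ex P (fun w => sn w * W w).
  by rewrite eR1 el; ring.
have W1 : `|Ex P (fun w => sn w * W w)| <= C * ((t - s) * e).
  apply: le_trans hW; apply: (le_trans (Ex_norm_le lsW)); apply: Ex_le.
  - exact: L1_norm.
  - exact: L1_norm.
  - by move=> w; rewrite normrM -[leRHS]mul1r ler_wpM2r.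
have R2 : `|Ex P R1| <= Ex P B.
  apply: (le_trans (Ex_norm_le lR1)); apply: Ex_le => //; exact: L1_norm.
rewrite (le_trans (ler_normB _ _)) // normrM.
have kW : `|k| * `|Ex P (fun w => sn w * W w)| <= `|k| * (C * ((t - s) * e)).
  by rewrite ler_wpM2l.
have he0 : 0 <= (t - s) * e by rewrite mulr_ge0 // ltW.
have he1 : t - s <= e by rewrite -e2 expr2 ler_piMl // ltW.
have hh : (t - s) ^+ 2 <= (t - s) * e by rewrite expr2 ler_wpM2l // ltW.
have Y2 : Ex P (fun w => x2 w ^+ 2) <= 4 * C * ((t - s) * e).
  by apply: (le_trans E2); rewrite ler_wpM2l // mulr_ge0.
have Y4 : e * Ex P (fun w => x1 w ^+ 2) <= 4 * ((t - s) * e).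
  by have := ler_wpM2l (ltW e0) x1sq; congr (_ <= _); ring.
have Y5 : e^-1 * Ex P (fun w => x2 w ^+ 2) <= 4 * C * ((t - s) * e).
  rewrite mulrC ler_pdivrMr // (le_trans E2) // le_eqVlt; apply/orP; left; apply/eqP.
  by rewrite -e2; ring.
have Z1 := ler_wpM2l k2 Y2; have Z2 := ler_wpM2l k22 (lerD Y4 Y5).
have Z3 := ler_wpM2l k3 E3.
apply: (le_trans (lerD R2 kW)); rewrite eB.
apply: (le_trans (lerD (lerD (lerD Z1 Z2) Z3) (lexx _))).
by rewrite le_eqVlt; apply/orP; left; apply/eqP; rewrite /K; ring.
Qed.

(** Stated for the increment, whose integrability is known at this stage; that of the solution
    itself is [solution_L1]. *)
Lemma mean_step U : exists2 C, 0 <= C & forall s t, s <= t -> t <= s + 1 -> t <= U ->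
  `|Ex P (fun w => a t w - a s w) -
    (t - s) * Ex P (fun w => lambda * rate s - delta * sin (a s w))| <=
  C * ((t - s) * Num.sqrt (t - s)).
Proof.
have [C C0 hC] := step_estimates U; exists C => //.
move=> s t; rewrite le_eqVlt => /orP[/eqP <- _ _|st ts1 tU].
  rewrite subrr mul0r subr0 (@eq_Ex _ _ _ _ _ (fun=> 0)) => [|w]; last by rewrite subrr.
  by rewrite Ex_cst normr0 mul0r mulr0.
have [M [V [lM lV aE GM [hN hV hW]]]] := hC s t st ts1 tU.
have lV0 : L1 P (fun w => lambda * rate s - delta * sin (a s w)).
  apply: L1B; first exact: L1_cst.
  apply: L1Z; apply: (@L1_bounded _ _ _ _ _ 1); first exact: (measurableT_comp measurable_sinR).
  by move=> w; exact: sin_max.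
have -> : Ex P (fun w => a t w - a s w) = Ex P V.
  rewrite (@eq_Ex _ _ _ _ _ (fun w => M w + V w)) => [|w]; last by rewrite aE; ring.
  rewrite ExD; [|exact: L2_L1|exact: L2_L1].
  have := GM (fun=> 1) 1; rewrite (@eq_Ex _ _ _ _ _ M) => [->|w]; rewrite ?add0r ?mul1r //.
    by apply: measurable_wrt_cst; exact: past_sigma_algebra.
  by move=> w; rewrite normr1.
rewrite -ExZ // -ExB; [|exact: L2_L1|exact: L1Z].
by apply: le_trans hW; apply: Ex_norm_le; apply: L1B; [exact: L2_L1|exact: L1Z].
Qed.

(** As |e^{-ia} - 1|^2 = 2 (1 - cos a), the martingale part has mean square at most 8 e^2, hence
    absolute mean at most 9 e / 2; and sin^2 a <= 2 (1 - cos a) bounds the mean of |sin a| by 2 e.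
    The point is that the bound is small near -oo, where [e] can be taken small. *)
Lemma incr_L1 s t e : s <= t -> t <= s + 1 -> 0 < e ->
  (forall u, s <= u <= t -> Ex P (fun w => 1 - cos (a u w)) <= e ^+ 2) ->
  L1 P (fun w => a t w - a s w) /\
  Ex P (fun w => `|a t w - a s w|) <= `|lambda| * rate t + (2 * delta + 5) * e.
Proof.
move=> st ts1 e0 he.
have h0 : 0 <= t - s by rewrite subr_ge0.
have h1 : t - s <= 1 by rewrite lerBlDl addrC addrC.
have e20 := sqr_ge0 e.
have [M [V [lM mV aE [GM hM eV]]]] := step_decomposition reg st.
have [lV _] : L2 P V /\ Ex P (fun w => V w ^+ 2) <= (drift_bound beta delta lambda t * (t - s)) ^+ 2.
  apply: L2_ae_bounded => //; apply: filterS eV => w ->.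
  exact: (drift_int_le beta_gt0 delta_ge0 reg).
have z0 : measurable_wrt (F s) (fun=> 0 : R).
  by apply: measurable_wrt_cst; exact: past_sigma_algebra.
have n0 w : `|(fun=> 0 : R) (w : T)| <= 0 by rewrite normr0.
have lcos u : L1 P (fun w => 1 - cos (a u w)).
  apply: L1B; first exact: L1_cst.
  apply: (@L1_bounded _ _ _ _ _ 1); first exact: (measurableT_comp measurable_cosR).
  by move=> w; exact: cos_max.
have M2 : Ex P (fun w => M w ^+ 2) <= 8 * e ^+ 2.
  have := hM _ _ _ (2 * e ^+ 2) z0 z0 n0 n0.
  rewrite (@eq_Ex _ _ _ _ _ (fun w => M w ^+ 2)); last by move=> w; rewrite /gauss_step !mul0r !subr0.
  move=> h; apply: (@le_trans _ _ (4 * (2 * e ^+ 2 * (t - s)))).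
    apply: h => u /he hu.
    rewrite (@eq_Ex _ _ _ _ _ (fun w => 2 * (1 - cos (a u w)))); last first.
      by move=> w; rewrite !subr0 cos_sin_norm2.
    by rewrite ExZ // ler_pM2l.
  by clear n0 h; nra.
have M1 : Ex P (fun w => `|M w|) <= 9 / 2 * e.
  have := Ex_norm_le_sqr e0 lM.
  have : e^-1 * Ex P (fun w => M w ^+ 2) <= 8 * e.
    by rewrite mulrC ler_pdivrMr // -mulrA -expr2.
  by clear n0; lra.
pose phi u w := `|sin (a u w)|.
have mphi : measurable_fun setT (fun z : R * T => phi z.1 z.2).
  by apply: measurableT_comp => //; exact: (measurableT_comp measurable_sinR mj).
have phiM u w : 0 <= phi u w <= 1 by rewrite normr_ge0 /= sin_max.
have lsin u : L2 P (fun w => sin (a u w)).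
  apply: (@L2_bounded _ _ _ _ _ 1); first exact: (measurableT_comp measurable_sinR).
  by move=> w; exact: sin_max.
have phic u : s <= u <= t -> Ex P (phi u) <= 2 * e.
  move=> /he hu; have := Ex_norm_le_sqr e0 (lsin u).
  have : Ex P (fun w => sin (a u w) ^+ 2) <= 2 * e ^+ 2.
    apply: (@le_trans _ _ (Ex P (fun w => 2 * (1 - cos (a u w))))).
      apply: Ex_le; [by exact: L2_sqr|by exact: L1Z|].
      by move=> w; rewrite -cos_sin_norm2 sqrrN lerDr sqr_ge0.
    by rewrite ExZ // ler_pM2l.
  move=> h2; have : e^-1 * Ex P (fun w => sin (a u w) ^+ 2) <= 2 * e.
    by rewrite mulrC ler_pdivrMr // -mulrA -expr2.
  rewrite -/(phi u); clear n0; set E1 := Ex _ _; set E2 := Ex _ (phi u); lra.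
have [lK eK _ _] := fubini_bound st mphi phiM phic.
set K := (fun w => _) in lK eK.
have rt : 0 <= rate t by rewrite ltW // rate_gt0.
have V1 : Ex P (fun w => `|V w|) <= `|lambda| * rate t + delta * (2 * e).
  apply: (@le_trans _ _ (Ex P (fun w => `|lambda| * rate t + delta * K w))).
    apply: Ex_ae_le; first by apply: L1_norm; exact: L2_L1.
      by apply: L1D; [exact: L1_cst|exact: L1Z].
    by apply: filterS eV => w ->; exact: (drift_sin_le beta_gt0 delta_ge0 reg).
  rewrite ExD ?Ex_cst ?ExZ //; [|exact: L1_cst|exact: L1Z].
  rewrite lerD2l ler_wpM2l // (le_trans eK) // ler_piMr // mulr_ge0 // ltW //.
have dE : (fun w => a t w - a s w) = fun w => M w + V w.
  by apply/funext => w; rewrite aE; ring.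
have la : L1 P (fun w => a t w - a s w).
  by rewrite dE; apply: L1D; exact: L2_L1.
split => //.
apply: (@le_trans _ _ (Ex P (fun w => `|M w| + `|V w|))).
  apply: Ex_le; first exact: L1_norm.
    by apply: L1D; apply: L1_norm; exact: L2_L1.
  by move=> w; rewrite aE (_ : _ - _ = M w + V w) ?ler_normD //; ring.
rewrite ExD; [|by apply: L1_norm; exact: L2_L1|by apply: L1_norm; exact: L2_L1].
move: M1 V1; clear n0; set E1 := Ex _ _; set E2 := Ex _ _; lra.
Qed.

(** Product-to-sum formulas: multiplying by sin a or cos a shifts the frequency [k] by one in both
    directions, which closes the system on the moments. *)
Lemma mean_cos_ode k c s : Ex P (fun w =>
      - (k * (sin (k * a s w + c) * (lambda * rate s - delta * sin (a s w))))
      - k ^+ 2 * (cos (k * a s w + c) * (1 - cos (a s w)))) =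
  - (k * lambda * rate s) * mean_cos k (c - pi / 2) s - k ^+ 2 * mean_cos k c s
  + k * (k + delta) / 2 * mean_cos (k - 1) c s
  + k * (k - delta) / 2 * mean_cos (k + 1) c s.
Proof.
have l1 := L1_cos k (c - pi / 2) s; have l2 := L1_cos k c s.
have l3 := L1_cos (k - 1) c s; have l4 := L1_cos (k + 1) c s.
rewrite /mean_cos -!ExZ // -ExB; [|exact: L1Z|exact: L1Z].
have l12 := L1B (L1Z (- (k * lambda * rate s)) l1) (L1Z (k ^+ 2) l2).
rewrite -ExD //; last exact: L1Z.
rewrite -ExD //; [|by apply: L1D => //; exact: L1Z|exact: L1Z].
apply: eq_Ex => w.
have -> : k * a s w + (c - pi / 2) = k * a s w + c - pi / 2 by ring.
rewrite cosBpihalf.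
have -> : (k - 1) * a s w + c = k * a s w + c - a s w by ring.
have -> : (k + 1) * a s w + c = k * a s w + c + a s w by ring.
by move: (k * a s w + c) => th; rewrite cosB cosD; field.
Qed.

Lemma mean_cos_holder k c U : exists2 C, 0 <= C & forall s t, s <= t -> t <= s + 1 -> t <= U ->
  `|mean_cos k c t - mean_cos k c s| <= C * Num.sqrt (t - s).
Proof.
have [C C0 hC] := incr_L2 U; exists (`|k| * (2^-1 * (1 + C))).
  by rewrite !mulr_ge0 // addr_ge0.
move=> s t; rewrite le_eqVlt => /orP[/eqP <- _ _|st ts1 tU].
  by rewrite !subrr sqrtr0 normr0 mulr0.
have [l2 e2] := hC s t (ltW st) ts1 tU.
have e0 : 0 < Num.sqrt (t - s) by rewrite sqrtr_gt0 subr_gt0.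
have := Ex_norm_le_sqr e0 l2; set e := Num.sqrt _ in e0 *.
have : e^-1 * Ex P (fun w => (a t w - a s w) ^+ 2) <= C * e.
  by rewrite mulrC ler_pdivrMr // -mulrA -expr2 sqr_sqrtr // ?subr_ge0 ?(ltW st).
move=> h1 h2; rewrite -ExB; [|exact: L1_cos|exact: L1_cos].
apply: (le_trans (Ex_norm_le (L1B (L1_cos k c t) (L1_cos k c s)))).
apply: (@le_trans _ _ (Ex P (fun w => `|k| * `|a t w - a s w|))).
  apply: Ex_le.
  - by apply: L1_norm; apply: L1B; exact: L1_cos.
  - by apply: L1Z; apply: L1_norm; exact: L2_L1.
  - move=> w; have := cosD_taylor0 (k * a s w + c) (k * (a t w - a s w)).
    rewrite normrM; congr (`|cos _ - _| <= _); ring.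
rewrite ExZ; last by apply: L1_norm; exact: L2_L1.
rewrite -mulrA ler_wpM2l //; move: h1 h2; set E1 := _ * Ex _ _; set E2 := Ex _ _; lra.
Qed.

End ito_step.

Section derivative_of_estimate.
Context {R : realType}.
Implicit Types f l : R -> R.

Let small_near0 : \forall h \near (0:R), `|h| < 1.
Proof.
by have /cvgrPdist_lt /(_ _ ltr01) := @cvg_id _ (nbhs (0 : R)); apply: filterS => h; rewrite sub0r normrN.
Qed.

Let sqrt_norm_cvg (C x : R) : C * Num.sqrt `|y - x| @[y --> x] --> (0 : R).
Proof.
have h : C * Num.sqrt `|y - x| @[y --> x] --> C * Num.sqrt `|x - x|.
  apply: cvgM; first exact: cvg_cst.
  apply: (@cvg_comp _ _ _ (fun y : R => `|y - x|) Num.sqrt (nbhs x) (nbhs (`|x - x| : R))); last exact: sqrt_continuous.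
  apply: (@cvg_comp _ _ _ (fun y : R => y - x) (fun y : R => `|y|) (nbhs x) (nbhs (x - x))); last exact: (@norm_continuous R R).
  by apply: cvgB; [exact: cvg_id|exact: cvg_cst].
by move: h; rewrite subrr normr0 sqrtr0 mulr0.
Qed.

Let shift_cvg (l : R -> R) (x : R) : continuous l -> l (h + x) @[h --> (0 : R)] --> l x.
Proof.
move=> cl.
apply: (@cvg_comp _ _ _ (fun h : R => h + x) l (nbhs (0 : R)) (nbhs x)); last exact: cl.
have : (h + x) @[h --> (0 : R)] --> 0 + x by apply: cvgD; [exact: cvg_id|exact: cvg_cst].
by rewrite add0r.
Qed.

Lemma holder_continuous f : (forall U, exists2 C, 0 <= C &
    forall s t, s <= t -> t <= s + 1 -> t <= U -> `|f t - f s| <= C * Num.sqrt (t - s)) ->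
  continuous f.
Proof.
move=> hf x; have [C C0 hC] := hf (x + 1).
apply/cvgrPdist_le => e e0; near=> y.
have y1 : `|x - y| < 1.
  by near: y; have /cvgrPdist_lt /(_ _ ltr01) := @cvg_id _ (nbhs (x : R)).
have : `|0 - C * Num.sqrt `|y - x| | <= e.
  by near: y; have /cvgrPdist_le /(_ _ e0) := @sqrt_norm_cvg C x.
rewrite sub0r normrN ger0_norm ?mulr_ge0 //; apply: le_trans.
move: y1; rewrite ltr_norml => /andP[h1 h2].
have [xy|yx] := leP x y.
  rewrite distrC (ger0_norm (x := y - x)) ?subr_ge0 //; apply: hC => //; lra.
rewrite (ltr0_norm (x := y - x)) ?subr_lt0 // opprB; apply: hC; lra.
Unshelve. all: end_near. Qed.

(** The estimate takes the rate at the left end of the interval. To the left of [x] that end is h +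
    x, and continuity of [l] brings the rate back to [x]. *)
Lemma derive_of_estimate f l : continuous l -> (forall U, exists2 C, 0 <= C &
    forall s t, s <= t -> t <= s + 1 -> t <= U ->
    `|f t - f s - (t - s) * l s| <= C * ((t - s) * Num.sqrt (t - s))) ->
  forall x : R, is_derive x 1 f (l x).
Proof.
move=> cl hf x; have [C C0 hC] := hf (x + 1).
have h0 : \forall h \near (0:R)^', `|h^-1 *: (f (h + x) - f x) - l x| <=
    C * Num.sqrt `|h| + `|l (h + x) - l x|.
  near=> h.
  have hn0 : h != 0 by near: h; exact: nbhs_dnbhs_neq.
  have h1 : `|h| < 1.
    by near: h; apply: nbhs_dnbhs; exact: small_near0.
  move: h1; rewrite ltr_norml => /andP[h1 h2].
  have a0 : 0 < `|h| by rewrite normr_gt0.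
  rewrite -(ler_pM2l a0) -normrM [X in _ <= X]mulrDr.
  have -> : h * (h^-1 *: (f (h + x) - f x) - l x) = f (h + x) - f x - h * l x.
    by rewrite mulrBr /GRing.scale /= mulrA mulfV // mul1r.
  have [h0|h0] := leP 0 h.
    have hh := hC x (h + x); rewrite addrK in hh.
    rewrite -[leLHS]addr0; apply: lerD; last by rewrite mulr_ge0.
    rewrite (ger0_norm h0) mulrCA; apply: hh; lra.
  have hh := hC (h + x) x.
  rewrite (_ : x - (h + x) = - h) in hh; last by ring.
  rewrite (_ : _ - _ - _ = - (f x - f (h + x) - - h * l (h + x)) + h * (l (h + x) - l x)); last by ring.
  rewrite (le_trans (ler_normD _ _)) // normrN normrM lerD //.
  rewrite (ltr0_norm h0) mulrCA; apply: hh; lra.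
have hl : h^-1 *: (f (h + x) - f x) @[h --> (0:R)^'] --> l x.
  apply/cvgrPdist_le => e e0.
  have e2 : 0 < e / 2 by rewrite divr_gt0.
  have c1 : \forall h \near (0:R)^', `|0 - C * Num.sqrt `|h| | <= e / 2.
    have /cvgrPdist_le /(_ _ e2) := @sqrt_norm_cvg C 0.
    by move=> /(nbhs_dnbhs) ; apply: filterS => h; rewrite subr0.
  have c2 : \forall h \near (0:R)^', `|l x - l (h + x)| <= e / 2.
    by have /cvgrPdist_le /(_ _ e2) := @shift_cvg _ x cl; exact: nbhs_dnbhs.
  near=> h.
  have : `|h^-1 *: (f (h + x) - f x) - l x| <= C * Num.sqrt `|h| + `|l (h + x) - l x| by near: h.
  rewrite distrC => /le_trans; apply.
  rewrite (splitr e) lerD //.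
    have : `|0 - C * Num.sqrt `|h| | <= e / 2 by near: h.
    by rewrite sub0r normrN ger0_norm // mulr_ge0.
  by rewrite distrC; near: h.
have e1 : (fun h : R => h^-1 *: ((f \o shift x) (h *: 1) - f x)) = fun h => h^-1 *: (f (h + x) - f x).
  by apply/funext => h; rewrite /= [h *: 1]mulr1.
apply: DeriveDef.
  by apply/cvg_ex; exists (l x); rewrite e1.
by rewrite /derive e1; exact/cvg_lim.
Unshelve. all: end_near. Qed.

End derivative_of_estimate.

(** * The infinite system *)

Section sequences.
Context {R : realType}.

(** Put y k = (k + b) W k. The recurrence says that y decreases by 2 p W k at each step, so the
    series telescopes. Were the limit of y positive, [W] would dominate a multiple of the harmonic
    series. *)
Lemma raabe_summable (W : nat -> R) (b p : R) : 0 < b -> 0 < p -> (forall k, 0 <= W k) ->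
  (forall k, (k.+1%:R + b) * W k.+1 = (k%:R + b) * W k - 2 * p * W k) ->
  cvgn (series W) /\ (k%:R + b) * W k @[k --> \oo] --> (0 : R).
Proof.
move=> b0 p0 W0 WS; pose y k := (k%:R + b) * W k.
have y0 k : 0 <= y k by rewrite mulr_ge0 // addr_ge0 // ltW.
have ny : nonincreasing_seq y.
  by apply/nonincreasing_seqP => k; rewrite /y WS lerBlDr lerDl !mulr_ge0 // ltW.
have cy : cvgn y.
  by apply: nonincreasing_is_cvgn => //; exists 0 => _ [k _ <-].
have sE : series W = fun n => (2 * p)^-1 * (y 0%N - y n).
  have p20 : 2 * p != 0 by rewrite mulf_neq0 // gt_eqF.
  apply/funext; elim=> [|n ih]; first by rewrite subrr mulr0 /series /= big_geq.
  have yS : y n.+1 = y n - 2 * p * W n by exact: WS.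
  rewrite seriesSr ih yS; move: (y n) (y 0%N) (W n) => *; field.
  by rewrite gt_eqF.
have cW : cvgn (series W).
  rewrite sE; apply: is_cvgMr; apply: is_cvgB => //; exact: is_cvg_cst.
split => //.
have l0 : 0 <= limn y by apply: limr_ge => //; exact: nearW.
suff <- : limn y = 0 by exact: cy.
apply/eqP; rewrite eq_le l0 andbT leNgt; apply/negP => lpos.
apply: (@dvg_harmonic R); apply: (@series_le_cvg _ _ (fun k => (b + 1) / limn y * W k)).
- by move=> n; rewrite /harmonic /= invr_ge0.
- by move=> n; rewrite !mulr_ge0 ?invr_ge0 // ?addr_ge0 // ltW.
- move=> n; have h : limn y <= y n by exact: nonincreasing_cvgn_ge.
  rewrite /harmonic /= -[leLHS]mul1r ler_pdivrMr ?ltr0Sn // mulrAC -mulrA -mulrAC.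
  rewrite ler_pdivlMr // mul1r (le_trans h) // /y.
  have h1 : n%:R + b <= n.+1%:R * (b + 1).
    rewrite -natr1; have := ler0n R n; have := ltW b0; set m := n%:R; nra.
  rewrite [X in _ <= X](_ : _ = (n.+1%:R * (b + 1)) * W n); last by ring.
  by rewrite ler_wpM2r.
- have -> : series (fun k => (b + 1) / limn y * W k) = fun n => (b + 1) / limn y * series W n.
    by apply/funext => n; rewrite /series /= mulr_sumr.
  by apply: is_cvgMr.
Qed.

(** Each ratio is 1 - (1 + 2 p) / (k + 2 + m + p), so the weights decay like k^(-1 - 2 p): they are
    summable, and k times the weight tends to 0. For delta = p + eta, the [p] in the ratio
    compensates the part p of delta exactly, and the shift [m] leaves room for eta. *)
Fixpoint weight (m : nat) (p : R) (k : nat) : R :=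
  if k is k'.+1 then weight m p k' * ((k'.+1%:R + m%:R - p) / (k'.+2%:R + m%:R + p)) else 1.

Section weight.
Variables (m : nat) (p eta : R).
Hypotheses (p_gt0 : 0 < p) (p_le : p <= 1 / 2) (eta_ge0 : 0 <= eta) (eta_le : 2 * eta <= m%:R).
Local Notation W := (weight m p).
Local Notation delta := (p + eta).

Let num_gt0 k : 0 < k.+1%:R + m%:R - p.
Proof.
have := ler0n R m; have := ler0n R k; rewrite -[k.+1%:R]natr1; move: p_le.
set a := k%:R; set b := m%:R; lra.
Qed.

Let den_gt0 k : 0 < k%:R + m%:R + p.
Proof. by rewrite ltr_wpDl // addr_ge0. Qed.

Lemma weight_gt0 k : 0 < W k.
Proof. by elim: k => [|k ih] //=; rewrite mulr_gt0 // divr_gt0. Qed.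

Lemma weightS k : (k.+2%:R + m%:R + p) * W k.+1 = (k.+1%:R + m%:R - p) * W k.
Proof.
rewrite /= mulrC -mulrA divfK; first by rewrite mulrC.
by rewrite gt_eqF.
Qed.

Lemma weight_le k : W k.+1 <= W k.
Proof.
rewrite -(ler_pM2l (den_gt0 k.+2)) weightS ler_pM2r ?weight_gt0 //.
rewrite -[k.+2%:R]natr1; move: p_gt0; set b := m%:R; set a := k.+1%:R; lra.
Qed.

(** Half the coefficient of the product of modes k + 1 and k + 2 in the quadratic form, to which the
    equations of both modes contribute. *)
Definition cross_weight k : R :=
  2^-1 * (W k * (k.+1%:R - delta) + W k.+1 * (k.+2%:R + delta)).

(** Multiplication by the denominator of the ratio leaves a polynomial inequality, in which 1 + 2 p
    <= 2 and 2 eta <= m make the first product dominate. *)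
Lemma cross_weight_ge0 k : 0 <= cross_weight k.
Proof.
rewrite /cross_weight mulr_ge0 // -(pmulr_rge0 _ (den_gt0 k.+2)).
have -> : (k.+2%:R + m%:R + p) * (W k * (k.+1%:R - delta) + W k.+1 * (k.+2%:R + delta)) =
  W k * ((k.+2%:R + m%:R + p) * (k.+1%:R - delta) + (k.+1%:R + m%:R - p) * (k.+2%:R + delta)).
  by rewrite mulrDr [in X in _ + X]mulrA weightS; ring.
apply: mulr_ge0; first exact/ltW/weight_gt0.
have := ler0n R k; rewrite -[k.+2%:R]natr1 -[k.+1%:R]natr1.
move: p_gt0 p_le eta_ge0 eta_le; set b := m%:R; set a := k%:R => h1 h2 h3 h4 h5.
have -> : (a + 1 + 1 + b + p) * (a + 1 - (p + eta)) + (a + 1 + b - p) * (a + 1 + 1 + (p + eta)) =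
  (a + 2 + b + p) * (2 * a + 3) - (1 + 2 * p) * (a + 2 + p + eta) by ring.
nra.
Qed.

Lemma cross_weight0 : cross_weight 0 <= 2 * W 0.
Proof.
have h := weight_le 0; have h0 := weight_gt0 1.
have : W 1 * (2 + delta) <= W 0 * (2 + delta).
  by rewrite ler_wpM2r // !addr_ge0 // ltW.
have := weight_gt0 0; rewrite /cross_weight; move: (W 0) (W 1) => a b; nra.
Qed.

(** By the recurrence, the left side minus the right side is half of m (2 W_{k+1} - W_k - W_{k+2}) +
    eta (W_{k+2} - W_k), and the weights are decreasing and convex. *)
Lemma cross_weight_le k : cross_weight k + cross_weight k.+1 <= 2 * k.+2%:R * W k.+1.
Proof.
have e1 := weightS k; have e2 := weightS k.+1.
have w0 := weight_gt0 k; have w1 := weight_gt0 k.+1; have w2 := weight_gt0 k.+2.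
have l1 := weight_le k; have l2 := weight_le k.+1.
have n1 := num_gt0 k.
have cvx : W k.+1 - W k.+2 <= W k - W k.+1.
  have d3 := den_gt0 k.+3.
  have q1 : (k.+3%:R + m%:R + p) * (W k.+1 - W k.+2) = (1 + 2 * p) * W k.+1.
    by rewrite mulrBr e2 -[k.+3%:R]natr1; ring.
  have q2 : (k.+1%:R + m%:R - p) * (W k - W k.+1) = (1 + 2 * p) * W k.+1.
    by rewrite mulrBr -e1 -[k.+2%:R]natr1; ring.
  rewrite -(ler_pM2l d3) q1 -q2 ler_wpM2r ?subr_ge0 //.
  by rewrite -[k.+3%:R]natr1 -[k.+2%:R]natr1; move: p_gt0; set b := m%:R; set a := k.+1%:R; lra.
have hm : m%:R * (2 * W k.+1 - W k - W k.+2) <= 0.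
  by rewrite mulr_ge0_le0 //; move: cvx; move: (W k) (W k.+1) (W k.+2) => *; lra.
have he : eta * (W k.+2 - W k) <= 0.
  by rewrite mulr_ge0_le0 // subr_le0 (le_trans l2).
have f1 : W k * (k.+1%:R - delta) = (k.+2%:R + m%:R + p) * W k.+1 - m%:R * W k - eta * W k.
  by rewrite e1; ring.
have f2 : W k.+2 * (k.+3%:R + delta) = (k.+2%:R + m%:R - p) * W k.+1 - m%:R * W k.+2 + eta * W k.+2.
  by rewrite -e2; ring.
rewrite /cross_weight f1 f2; move: hm he; clear.
move: (W k) (W k.+1) (W k.+2) (k.+2%:R : R) (m%:R : R) => a b c d e h1 h2; nra.
Qed.

Lemma weight_summable : cvgn (series W) /\ k.+1%:R * W k @[k --> \oo] --> (0 : R).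
Proof.
have [||||c l] := @raabe_summable W (m%:R + 1 + p) p.
- by rewrite ltr_wpDl // addr_ge0.
- exact: p_gt0.
- by move=> k; exact/ltW/weight_gt0.
- move=> k; have := weightS k; rewrite -[k.+2%:R]natr1 -[k.+1%:R]natr1.
  move: (k%:R : R) (m%:R : R) (W k) (W k.+1) => a b c d e.
  have -> : (a + 1 + (b + 1 + p)) * d = (a + 1 + 1 + b + p) * d by ring.
  by rewrite e; ring.
split => //; apply: (@squeeze_cvgr _ _ _ _ (fun=> 0) (fun k => (k%:R + (m%:R + 1 + p)) * W k)) => //.
  apply: nearW => k; have w := ltW (weight_gt0 k); rewrite mulr_ge0 //=.
  by rewrite ler_wpM2r // -natr1 lerD2l -addrAC lerDr addr_ge0 // ltW.
exact: cvg_cst.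
Qed.

End weight.
End sequences.

Section quadratic_form.
Context {R : realType}.
Variables (W : nat -> R) (delta : R).
Let h k : R := 2^-1 * (W k * (k.+1%:R - delta) + W k.+1 * (k.+2%:R + delta)).
Hypothesis h_ge0 : forall k, 0 <= h k.
Hypotheses (h_0 : h 0 <= 2 * W 0) (h_le : forall k, h k + h k.+1 <= 2 * k.+2%:R * W k.+1).
Variables (x y : nat -> R).
Hypotheses (x0 : x 0%N = 0) (y0 : y 0%N = 0).

(** Diagonal dominance: a product of neighbouring modes is at most the mean of their squares, so
    mode k + 2 is charged h k + h (k + 1), which its diagonal term covers. The last cross product
    involves the mode beyond the truncation and is left over; the term in [h K] is kept to pay for
    it at the next step of the induction. *)
Lemma quadratic_form_le K :
  \sum_(k < K.+1) W k * (- (2 * k.+1%:R * (x k.+1 ^+ 2 + y k.+1 ^+ 2))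
     + (k.+1%:R + delta) * (x k.+1 * x k + y k.+1 * y k)
     + (k.+1%:R - delta) * (x k.+1 * x k.+2 + y k.+1 * y k.+2)) <=
  - (h K * (x K.+1 ^+ 2 + y K.+1 ^+ 2)) +
  W K * (K.+1%:R - delta) * (x K.+1 * x K.+2 + y K.+1 * y K.+2).
Proof.
elim: K => [|K ih].
  rewrite big_ord_recr big_ord0 /= x0 y0 !mulr0 addr0 mulr0 add0r addr0 mulrDr mulrA lerD2r.
  have := addr_ge0 (sqr_ge0 (x 1%N)) (sqr_ge0 (y 1%N)); move: h_0.
  by move: (h 0) (W 0) (_ + _) => *; nra.
rewrite big_ord_recr /=; apply: (le_trans (lerD ih (lexx _))).
have := h_le K; have := h_ge0 K.
have hE : W K * (K.+1%:R - delta) = 2 * h K - W K.+1 * (K.+2%:R + delta).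
  by rewrite /h; field.
rewrite hE; set cr := x K.+1 * x K.+2 + y K.+1 * y K.+2.
have cr2 : 2 * cr <= (x K.+1 ^+ 2 + y K.+1 ^+ 2) + (x K.+2 ^+ 2 + y K.+2 ^+ 2).
  rewrite -subr_ge0 (_ : _ - _ = (x K.+1 - x K.+2) ^+ 2 + (y K.+1 - y K.+2) ^+ 2).
    by rewrite addr_ge0 ?sqr_ge0.
  by rewrite /cr; ring.
rewrite (_ : x K.+2 * x K.+1 + y K.+2 * y K.+1 = cr); last by rewrite /cr; ring.
set cr' := x K.+2 * x K.+3 + y K.+2 * y K.+3.
have q2 := addr_ge0 (sqr_ge0 (x K.+2)) (sqr_ge0 (y K.+2)).
move: cr2 q2; move: (x K.+1 ^+ 2 + y K.+1 ^+ 2) (x K.+2 ^+ 2 + y K.+2 ^+ 2) cr cr' => q1 q2 c c'.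
move: (h K) (h K.+1) (W K.+1) (K.+2%:R : R) => g g' w n h1 h2 h3 h4.
have t1 := ler_wpM2l h3 h1; have t2 := ler_wpM2r h2 h4.
rewrite -subr_ge0.
rewrite (_ : _ - _ = (g * (q1 + q2) - g * (2 * c)) + (2 * n * w * q2 - (g + g') * q2)); last by ring.
by rewrite addr_ge0 // subr_ge0.
Qed.

End quadratic_form.

Lemma derive_increment_le {R : realType} (f g df dg : R -> R) (v u : R) :
  (forall z : R, is_derive z 1 f (df z)) -> (forall z : R, is_derive z 1 g (dg z)) ->
  (forall z, df z <= dg z) -> v <= u -> f u - f v <= g u - g v.
Proof.
move=> hf hg fg; rewrite le_eqVlt => /orP[/eqP ->|vu]; first by rewrite !subrr.
have hd (z : R) : is_derive z 1 (f \- g) (df z - dg z).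
  by have h1 := hf z; have h2 := hg z; apply: is_deriveB.
have cd : continuous (f \- g).
  by move=> y; apply: differentiable_continuous; apply/derivable1_diffP; have [] := hd y.
have [z _] := @MVT R (f \- g) (fun z => df z - dg z) v u vu (fun y _ => hd y)
  (continuous_subspaceT cd).
move=> /= e; have : (df z - dg z) * (u - v) <= 0.
  by rewrite mulr_le0_ge0 // ?subr_le0 ?subr_ge0 // ltW.
rewrite -e; lra.
Qed.

(* (x k) and (y k) are real and imaginary parts of the k-th Fourier mode of a
   solution minus its initial value, or of the difference of two solutions. The
   weights W make the quadratic form of the system nonpositive, so the energy E is
   controlled by the source term f alone. *)
Section energy.
Context {R : realType}.
Variables (W : nat -> R) (delta : R).
Let h k : R := 2^-1 * (W k * (k.+1%:R - delta) + W k.+1 * (k.+2%:R + delta)).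
Hypotheses (delta_ge0 : 0 <= delta) (W_ge0 : forall k, 0 <= W k) (h_ge0 : forall k, 0 <= h k).
Hypotheses (h_0 : h 0 <= 2 * W 0) (h_le : forall k, h k + h k.+1 <= 2 * k.+2%:R * W k.+1).
Hypotheses (W_sum : cvgn (series W)) (W_lim : k.+1%:R * W k @[k --> \oo] --> (0 : R)).
Variables (x y : nat -> R -> R) (b : R) (rho f g G : R -> R).
Hypotheses (x0 : forall u, x 0%N u = 0) (y0 : forall u, y 0%N u = 0).
Hypotheses (xb : forall k u, `|x k u| <= b) (yb : forall k u, `|y k u| <= b).
Hypothesis dx : forall k (u : R), is_derive u 1 (x k.+1)
  (- (k.+1%:R * rho u) * y k.+1 u - k.+1%:R ^+ 2 * x k.+1 u
   + k.+1%:R * (k.+1%:R + delta) / 2 * x k u + k.+1%:R * (k.+1%:R - delta) / 2 * x k.+2 u).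
Hypothesis dy : forall k (u : R), is_derive u 1 (y k.+1)
  (k.+1%:R * rho u * x k.+1 u - k.+1%:R ^+ 2 * y k.+1 u
   + k.+1%:R * (k.+1%:R + delta) / 2 * y k u + k.+1%:R * (k.+1%:R - delta) / 2 * y k.+2 u
   + k.+1%:R * f u).
Hypotheses (dG : forall u : R, is_derive u 1 G (g u)) (fg : forall u, `|f u| <= g u).
Hypothesis G_ge0 : forall u, 0 <= G u.
Hypothesis xlim : forall k u, x k (u - n%:R) @[n --> \oo] --> (0 : R).
Hypothesis ylim : forall k u, y k (u - n%:R) @[n --> \oo] --> (0 : R).

(** Division by k + 1 cancels one power of the frequency in the equations; the terms in [rho] cancel
    between [x] and [y]. *)
Let E K u : R := \sum_(k < K) W k / k.+1%:R * (x k.+1 u ^+ 2 + y k.+1 u ^+ 2).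
Let S := limn (series W).
(** A bound for the product of the last mode with the first one beyond the truncation. *)
Let eps K := W K * (K.+1%:R + delta) * (2 * b ^+ 2).

Let b_ge0 : 0 <= b. Proof. exact: le_trans (xb 0 0). Qed.

Let sq (v : R) : `|v| <= b -> v ^+ 2 <= b ^+ 2.
Proof. by move=> vb; rewrite -real_normK ?num_real // lerXn2r // nnegrE. Qed.

Let Wsum_le K : \sum_(k < K) W k <= S.
Proof.
rewrite -(big_mkord xpredT W); apply: nondecreasing_cvgn_le => //.
by apply/nondecreasing_seqP => n; rewrite seriesSr lerDl.
Qed.

Let S_ge0 : 0 <= S. Proof. by apply: le_trans (Wsum_le 0); rewrite big_ord0. Qed.

Let dE K (u : R) : is_derive u 1 (E K)
  (\sum_(k < K) W k / k.+1%:R * (2 * x k.+1 u *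
  (- (k.+1%:R * rho u) * y k.+1 u - k.+1%:R ^+ 2 * x k.+1 u
   + k.+1%:R * (k.+1%:R + delta) / 2 * x k u + k.+1%:R * (k.+1%:R - delta) / 2 * x k.+2 u)
   + 2 * y k.+1 u *
  (k.+1%:R * rho u * x k.+1 u - k.+1%:R ^+ 2 * y k.+1 u
   + k.+1%:R * (k.+1%:R + delta) / 2 * y k u + k.+1%:R * (k.+1%:R - delta) / 2 * y k.+2 u
   + k.+1%:R * f u))).
Proof.
have -> : E K = \sum_(k < K) (fun u => W k / k.+1%:R * (x k.+1 u ^+ 2 + y k.+1 u ^+ 2)).
  by apply/funext => v; rewrite fct_sumE.
apply: is_derive_sum => k.
have h1 := dx k u; have h2 := dy k u.
apply: is_derive_eq; rewrite /GRing.scale /=; ring.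
Qed.

Let dE_le K (u : R) : \sum_(k < K.+1) W k / k.+1%:R * (2 * x k.+1 u *
  (- (k.+1%:R * rho u) * y k.+1 u - k.+1%:R ^+ 2 * x k.+1 u
   + k.+1%:R * (k.+1%:R + delta) / 2 * x k u + k.+1%:R * (k.+1%:R - delta) / 2 * x k.+2 u)
   + 2 * y k.+1 u *
  (k.+1%:R * rho u * x k.+1 u - k.+1%:R ^+ 2 * y k.+1 u
   + k.+1%:R * (k.+1%:R + delta) / 2 * y k u + k.+1%:R * (k.+1%:R - delta) / 2 * y k.+2 u
   + k.+1%:R * f u)) <= 2 * b * S * g u + eps K.
Proof.
have -> : \sum_(k < K.+1) W k / k.+1%:R * (2 * x k.+1 u *
  (- (k.+1%:R * rho u) * y k.+1 u - k.+1%:R ^+ 2 * x k.+1 u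
   + k.+1%:R * (k.+1%:R + delta) / 2 * x k u + k.+1%:R * (k.+1%:R - delta) / 2 * x k.+2 u)
   + 2 * y k.+1 u *
  (k.+1%:R * rho u * x k.+1 u - k.+1%:R ^+ 2 * y k.+1 u
   + k.+1%:R * (k.+1%:R + delta) / 2 * y k u + k.+1%:R * (k.+1%:R - delta) / 2 * y k.+2 u
   + k.+1%:R * f u)) =
  \sum_(k < K.+1) W k * (2 * y k.+1 u * f u) +
  \sum_(k < K.+1) W k * (- (2 * k.+1%:R * (x k.+1 u ^+ 2 + y k.+1 u ^+ 2))
     + (k.+1%:R + delta) * (x k.+1 u * x k u + y k.+1 u * y k u)
     + (k.+1%:R - delta) * (x k.+1 u * x k.+2 u + y k.+1 u * y k.+2 u)).
  rewrite -big_split /=; apply: eq_bigr => k _.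
  have : (k.+1%:R : R) != 0 by rewrite pnatr_eq0.
  move: (k.+1%:R : R) (x k.+1 u) (x k u) (x k.+2 u) (y k.+1 u) (y k u) (y k.+2 u).
  by move=> n x1 x2 x3 y1 y2 y3 n0; field.
apply: lerD.
  have g0 : 0 <= g u by exact: le_trans (fg u).
  apply: (@le_trans _ _ (\sum_(k < K.+1) W k * (2 * b * g u))).
    apply: ler_sum => k _; rewrite ler_wpM2l // -!mulrA ler_wpM2l //.
    by rewrite (le_trans (ler_norm _)) // normrM ler_pM.
  rewrite -mulr_suml [leRHS](_ : _ = S * (2 * b * g u)); last by ring.
  by apply: ler_wpM2r; [rewrite !mulr_ge0|exact: Wsum_le].
have := @quadratic_form_le R W delta h_ge0 h_0 h_le (x ^~ u) (y ^~ u) (x0 u) (y0 u) K.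
move=> /le_trans; apply; rewrite /eps.
have q0 : 0 <= h K * (x K.+1 u ^+ 2 + y K.+1 u ^+ 2) by rewrite mulr_ge0 // addr_ge0 ?sqr_ge0.
apply: (@le_trans _ _ (W K * (K.+1%:R - delta) * (x K.+1 u * x K.+2 u + y K.+1 u * y K.+2 u))).
  by rewrite gerDr oppr_le0.
rewrite (le_trans (ler_norm _)) // normrM ler_pM //.
  rewrite normrM ger0_norm // ler_wpM2l // (le_trans (ler_normB _ _)) //.
  by rewrite ger0_norm // (ger0_norm delta_ge0).
rewrite (le_trans (ler_normD _ _)) // !normrM mulr_natl mulr2n expr2.
by apply: lerD; apply: ler_pM.
Qed.

Let eps_lim : eps K @[K --> \oo] --> (0 : R).
Proof.
have eps0 K : 0 <= eps K.
  by rewrite /eps mulr_ge0 ?mulr_ge0 ?sqr_ge0 // addr_ge0.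
apply: (@squeeze_cvgr _ _ _ _ (fun=> 0) (fun K => (1 + delta) * (2 * b ^+ 2) * (K.+1%:R * W K))).
- apply: nearW => K; rewrite eps0 /= /eps.
  have W0 := W_ge0 K; have bb := sqr_ge0 b.
  have n1 : (1 : R) <= K.+1%:R by rewrite ler1n.
  have : K.+1%:R + delta <= (1 + delta) * K.+1%:R.
    move: n1; move: (K.+1%:R : R) => n n1; have := delta_ge0; nra.
  move=> e; rewrite [leRHS](_ : _ = W K * ((1 + delta) * K.+1%:R) * (2 * b ^+ 2)); last by ring.
  by rewrite ler_wpM2r ?mulr_ge0 // ler_wpM2l.
- exact: cvg_cst.
- by rewrite -[X in _ --> X](mulr0 ((1 + delta) * (2 * b ^+ 2))); apply: cvgM => //; exact: cvg_cst.
Qed.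

Let E_incr K u v : v <= u ->
  E K.+1 u - E K.+1 v <= 2 * b * S * G u + eps K * (u - v).
Proof.
move=> vu.
pose Gt z := 2 * b * S * G z + eps K * z.
have dGt (z : R) : is_derive z 1 Gt (2 * b * S * g z + eps K).
  by have h1 := dG z; apply: is_derive_eq; rewrite /GRing.scale /=; ring.
have := derive_increment_le (dE K.+1) dGt (dE_le K) vu.
have : 0 <= 2 * b * S * G v by rewrite !mulr_ge0.
rewrite /Gt; lra.
Qed.

Let E_term k K u : (k < K)%N -> W k / k.+1%:R * (x k.+1 u ^+ 2 + y k.+1 u ^+ 2) <= E K u.
Proof.
move=> kK; rewrite /E (bigD1 (Ordinal kK)) //= lerDl sumr_ge0 // => i _.
by rewrite mulr_ge0 ?divr_ge0 // addr_ge0 ?sqr_ge0.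
Qed.

Let E_tail K1 K u : (K1 <= K)%N -> E K u <= E K1 u + 2 * b ^+ 2 * (S - \sum_(k < K1) W k).
Proof.
move=> K1K; rewrite /E -!(big_mkord xpredT (fun k => W k / k.+1%:R * (x k.+1 u ^+ 2 + y k.+1 u ^+ 2))).
rewrite (big_cat_nat _ K1K) //= lerD2l.
apply: (@le_trans _ _ (2 * b ^+ 2 * \sum_(K1 <= k < K) W k)).
  rewrite mulr_sumr; apply: ler_sum => k _; rewrite mulrC; apply: ler_pM.
  - by rewrite addr_ge0 ?sqr_ge0.
  - by rewrite divr_ge0.
  - by rewrite mulr_natl mulr2n; apply: lerD; apply: sq.
  - by rewrite ler_piMr // invf_le1 ?ler1n // ltr0n.
rewrite ler_wpM2l ?mulr_ge0 ?sqr_ge0 // lerBrDl.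
by apply: le_trans (Wsum_le K); rewrite -!(big_mkord xpredT W) [leRHS](big_cat_nat _ K1K).
Qed.

Let E_lim K u : E K (u - n%:R) @[n --> \oo] --> (0 : R).
Proof.
elim: K => [|K ih].
  by rewrite /E; under eq_fun do rewrite big_ord0; exact: cvg_cst.
have hsq (v : nat -> R) : v n @[n --> \oo] --> (0 : R) -> v n ^+ 2 @[n --> \oo] --> (0 : R).
  move=> hv; under eq_fun do rewrite expr2.
  have : v n * v n @[n --> \oo] --> (0 * 0 : R) by apply: cvgM.
  by rewrite mul0r.
have hs : W K / K.+1%:R * (x K.+1 (u - n%:R) ^+ 2 + y K.+1 (u - n%:R) ^+ 2) @[n --> \oo] -->
    (W K / K.+1%:R * (0 + 0) : R).
  by apply: cvgM; [exact: cvg_cst|apply: cvgD; exact: hsq].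
have eS : (fun n : nat => E K.+1 (u - n%:R)) = (fun n => E K (u - n%:R) +
    W K / K.+1%:R * (x K.+1 (u - n%:R) ^+ 2 + y K.+1 (u - n%:R) ^+ 2)).
  by apply/funext => n; rewrite /E big_ord_recr.
by rewrite eS; have hh := cvgD ih hs; rewrite addr0 mulr0 addr0 in hh; exact: hh.
Qed.

Lemma energy_le k u : W k / k.+1%:R * (x k.+1 u ^+ 2 + y k.+1 u ^+ 2) <= 2 * b * S * G u.
Proof.
suff h' (e : R) : 0 < e -> W k / k.+1%:R * (x k.+1 u ^+ 2 + y k.+1 u ^+ 2) <= e + 2 * b * S * G u.
  by apply/ler_addgt0Pl => e /h'.
move=> e0; have e3 : 0 < e / 3 by rewrite divr_gt0.
(* The order of the choices matters: [K1] makes the tail of the energy small at all times, [n] makes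
   the first K1 modes small at time u - n, and [K] comes last because eps K is multiplied by the
   elapsed time n. *)
have [K1 hK1] : exists K1, 2 * b ^+ 2 * (S - \sum_(k < K1) W k) <= e / 3.
  have : 2 * b ^+ 2 * (S - series W n) @[n --> \oo] --> 2 * b ^+ 2 * (S - S).
    by apply: cvgM; [exact: cvg_cst|apply: cvgB => //; exact: cvg_cst].
  rewrite subrr mulr0 => /cvgrPdist_le /(_ _ e3) [N _ hN]; exists N.
  have := hN N (leqnn N); rewrite sub0r normrN /series /= big_mkord.
  by apply: le_trans; exact: ler_norm.
have [n hn] : exists n : nat, E K1 (u - n%:R) <= e / 3.
  have /cvgrPdist_le /(_ _ e3) [N _ hN] := @E_lim K1 u; exists N.
  by have := hN N (leqnn N); rewrite sub0r normrN; apply: le_trans; exact: ler_norm.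
have [K [kK hK]] : exists K, (maxn k K1 <= K)%N /\ eps K * n%:R <= e / 3.
  have : eps m * n%:R @[m --> \oo] --> (0 * n%:R : R) by apply: cvgM => //; exact: cvg_cst.
  rewrite mul0r => /cvgrPdist_le /(_ _ e3) [N _ hN]; exists (maxn N (maxn k K1)).
  split; first exact: leq_maxr.
  have := hN (maxn N (maxn k K1)) (leq_maxl _ _); rewrite sub0r normrN.
  by apply: le_trans; exact: ler_norm.
have nu : u - n%:R <= u by rewrite gerBl.
have := E_incr K nu; rewrite subKr.
have kK1 : (k < K.+1)%N by rewrite ltnS (leq_trans _ kK) // leq_maxl.
have K1K : (K1 <= K.+1)%N by rewrite leqW // (leq_trans _ kK) // leq_maxr.
have := E_term u kK1; have := @E_tail K1 K.+1 (u - n%:R) K1K.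
move: hK hn hK1; move: (E K.+1 u) (E K.+1 _) (E K1 _) (eps K * _) (2 * b ^+ 2 * _) (2 * b * S * _) (W k / _ * _).
move=> a1 a2 a3 a4 a5 a6 a7; lra.
Qed.

End energy.

(** * The law of Theta *)

Section coefficients.
Context {R : realType}.
Variable delta : R.
Hypothesis delta_gt0 : 0 < delta.

Definition rising_ratio (k : nat) : R := rising (- delta) k / rising (1 + delta) k.

Lemma rising_gt0 k : 0 < rising (1 + delta) k.
Proof. by rewrite /rising prodr_gt0 // => i _; rewrite ltr_wpDr // addr_gt0. Qed.

Lemma rising_ratio0 : rising_ratio 0 = 1.
Proof. by rewrite /rising_ratio /rising !big_ord0 divr1. Qed.

Lemma rising_ratioS k : (k.+1%:R + delta) * rising_ratio k.+1 = (k%:R - delta) * rising_ratio k.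
Proof.
have h := rising_gt0 k.
have h1 : 0 < 1 + delta + k%:R by rewrite ltr_wpDr // addr_gt0.
rewrite /rising_ratio {1 2}/rising !big_ord_recr /= -/(rising _ k) -/(rising (1 + delta) k) -[k.+1%:R]natr1.
move: h h1; move: (rising (- delta) k) (rising (1 + delta) k) (k%:R : R) => a b c b0 c0.
by field; rewrite gt_eqF //= (gt_eqF c0).
Qed.

(** From an index m >= delta on, the factor k - delta is nonnegative, so [rising_ratioS] passes to
    absolute values and becomes the recurrence of [raabe_summable] with p = delta. The second limit
    is the boundary term of the telescoping sum below. *)
Lemma rising_ratio_summable : cvgn (series (fun k => `|rising_ratio k.+1|)) /\
  (k%:R - delta) * rising_ratio k @[k --> \oo] --> (0 : R).
Proof.
have [m hm] : exists m : nat, delta <= m%:R.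
  by exists (Num.trunc delta).+1; rewrite ltW // truncnS_gt.
have mS j : m%:R + j%:R - delta >= 0 by rewrite subr_ge0 (le_trans hm) // lerDl.
have [||||c l] := @raabe_summable R (fun j => `|rising_ratio (m + j)|) (m%:R + delta) delta.
- by rewrite ltr_wpDl.
- exact: delta_gt0.
- by [].
- move=> j; have := rising_ratioS (m + j); rewrite -addnS.
  have p1 : 0 < (m + j.+1)%:R + delta by rewrite ltr_wpDl.
  have -> : j.+1%:R + (m%:R + delta) = (m + j.+1)%:R + delta by rewrite natrD; ring.
  move=> e; rewrite -{1}(gtr0_norm p1) -normrM e.
  rewrite normrM ger0_norm; last by rewrite natrD.
  by rewrite natrD; ring.
have cv : cvgn (series (fun k => `|rising_ratio k|)).
  rewrite -(is_cvg_series_restrict m).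
  have : cvgn (series (fun j => `|rising_ratio (m + j)|)) by [].
  move=> /cvg_ex[L hL]; apply/cvg_ex; exists L.
  rewrite -(cvg_shiftn m); apply: cvg_trans hL.
  apply: near_eq_cvg; apply: nearW => n /=.
  by rewrite /series /= -{2}[m]add0n big_addn addnK; apply: eq_bigr => i _; rewrite addnC.
split.
  move: cv; rewrite -(is_cvg_series_restrict 1) => /cvg_ex[L hL]; apply/cvg_ex; exists L.
  move: hL; rewrite -(cvg_shiftn 1); apply: cvg_trans.
  apply: near_eq_cvg; apply: nearW => n /=.
  by rewrite /series /= -{1}[1%N]add0n big_addn addnK; apply: eq_bigr => i _; rewrite addn1.
rewrite -(cvg_shiftn m); apply/cvgrPdist_le => e e0.
move/cvgrPdist_le: l => /(_ e e0); apply: filterS => j.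
rewrite !sub0r !normrN; apply: le_trans.
suff : `|((j + m)%:R - delta) * rising_ratio (j + m)| <= `|(j%:R + (m%:R + delta)) * `|rising_ratio (m + j)| | by [].
have -> : `|(j%:R + (m%:R + delta)) * `|rising_ratio (m + j)| | = (j%:R + (m%:R + delta)) * `|rising_ratio (m + j)|.
  by rewrite ger0_norm // mulr_ge0 // !addr_ge0 // ltW.
rewrite [(j + m)%N]addnC normrM.
apply: ler_pM => //; rewrite natrD ger0_norm //.
have := delta_gt0; move: (m%:R : R) (j%:R : R) => *; lra.
Qed.

Definition psum (v : nat -> R) (K : nat) : R := \sum_(k < K) rising_ratio k.+1 * v k.+1.
Definition lsum (v : nat -> R) : R := limn (series (fun k => rising_ratio k.+1 * v k.+1)).
(** Bounds the remainder of [lsum] uniformly over all sequences [v] bounded by 1, so that it serves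
    every exchange of the series with a derivative or an expectation. *)
Definition tail (K : nat) : R :=
  limn (series (fun k => `|rising_ratio k.+1|)) - \sum_(k < K) `|rising_ratio k.+1|.

Lemma tail_cvg : tail K @[K --> \oo] --> (0 : R).
Proof.
rewrite /tail -[X in _ --> X](subrr (limn (series (fun k => `|rising_ratio k.+1|)))).
apply: cvgB; first exact: cvg_cst.
have [c _] := rising_ratio_summable.
have -> : (fun K => \sum_(k < K) `|rising_ratio k.+1|) = series (fun k => `|rising_ratio k.+1|).
  by apply/funext => n; rewrite /series /= big_mkord.
exact: c.
Qed.

Lemma psum_seriesE v : psum v = series (fun k => rising_ratio k.+1 * v k.+1).
Proof. by apply/funext => n; rewrite /psum /series /= big_mkord. Qed.

Lemma psum_cvg v : (forall k, `|v k| <= 1) -> psum v K @[K --> \oo] --> lsum v.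
Proof.
move=> v1; rewrite psum_seriesE.
have [c _] := rising_ratio_summable.
suff : cvgn (series (fun k => rising_ratio k.+1 * v k.+1)) by [].
apply: normed_cvg; apply: (series_le_cvg _ _ _ c) => n /=; rewrite ?normr_ge0 //.
by rewrite normrM ler_piMr.
Qed.

Lemma lsum_tail v K : (forall k, `|v k| <= 1) -> `|lsum v - psum v K| <= tail K.
Proof.
move=> v1.
have h : `|psum v n - psum v K| @[n --> \oo] --> `|lsum v - psum v K|.
  by apply: cvg_norm; apply: cvgB; [exact: psum_cvg|exact: cvg_cst].
have [c _] := rising_ratio_summable.
apply: (@cvgr_to_le _ _ _ _ _ _ _ h); exists K => // n /= Kn.
rewrite /psum -!(big_mkord xpredT (fun k => rising_ratio k.+1 * v k.+1)) (big_cat_nat _ Kn) //= addrAC subrr add0r.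
apply: (@le_trans _ _ (\sum_(K <= k < n) `|rising_ratio k.+1|)).
  rewrite (le_trans (ler_norm_sum _ _ _)) //; apply: ler_sum => k _.
  by rewrite normrM ler_piMr.
rewrite /tail lerBrDl -(big_mkord xpredT (fun k => `|rising_ratio k.+1|)) -big_cat_nat //=.
apply: (nondecreasing_cvgn_le _ c).
by apply/nondecreasing_seqP => i; rewrite seriesSr lerDl.
Qed.

(* The left-hand side is what remains, apart from the drift in lambda, of the
   derivative of the truncated series for E[Theta_cdf (alpha_lambda(u))]. *)
Lemma rising_ratio_telescope (v : nat -> R) K : v 0%N = 0 ->
  - (delta / 2 * v 1%N) + \sum_(k < K) rising_ratio k.+1 *
    (- (k.+1%:R * v k.+1) + (k.+1%:R - delta) / 2 * v k.+2 + (k.+1%:R + delta) / 2 * v k) =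
  2^-1 * ((K%:R - delta) * rising_ratio K) * (v K.+1 - v K).
Proof.
move=> v0; elim: K => [|K ih].
  by rewrite big_ord0 rising_ratio0 v0; field.
rewrite big_ord_recr /= addrA ih.
have := rising_ratioS K; move: (rising_ratio K) (rising_ratio K.+1) (v K) (v K.+1) (v K.+2) (K%:R : R) (K.+1%:R : R).
by move=> a b x y z n n' e; rewrite -e; field.
Qed.

End coefficients.

Section uniform_limits.
Context {R : realType}.

Lemma uniform_limit_continuous_seq (gK : nat -> R -> R) (g : R -> R) (eps : nat -> R) :
  (forall K, continuous (gK K)) -> eps K @[K --> \oo] --> (0 : R) ->
  (forall K x, `|g x - gK K x| <= eps K) -> continuous g.
Proof.
move=> cg e0 hg x; apply/cvgrPdist_le => e ep.
have e3 : 0 < e / 3 by rewrite divr_gt0.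
have [K hK] : exists K, eps K <= e / 3.
  move/cvgrPdist_le: e0 => /(_ _ e3) [N _ hN]; exists N.
  by have := hN N (leqnn N); rewrite sub0r normrN; apply: le_trans; exact: ler_norm.
have /cvgrPdist_le /(_ _ e3) := cg K x; apply: filterS => y h.
have -> : g x - g y = (g x - gK K x) + (gK K x - gK K y) - (g y - gK K y) by ring.
rewrite (le_trans (ler_normB _ _)) //.
rewrite (le_trans (lerD (ler_normD _ _) (lexx _))) //.
have := hg K x; have := hg K y; move: hK h; move: `|_| `|_| `|_| (eps K) => a b c d'.
have -> : e = e / 3 + e / 3 + e / 3 by field.
move: (e / 3) => f h1 h2 h3 h4; lra.
Qed.

(** The error is uniform on half-lines x <= U only, because in [derive_level_mean] it carries the
    factor [drift_rate], which grows without bound to the right. *)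
Lemma derive_locally_uniform_limit (f g : R -> R) (fK dfK : nat -> R -> R) :
  (forall K (x : R), is_derive x 1 (fK K) (dfK K x)) ->
  (forall x, fK K x @[K --> \oo] --> f x) ->
  (forall U, exists2 eps : nat -> R, eps K @[K --> \oo] --> (0 : R) &
     forall K x, x <= U -> `|g x - dfK K x| <= eps K) ->
  continuous g -> forall x : R, is_derive x 1 f (g x).
Proof.
move=> hd hf hgU cg x; have [eps e0 hg] := hgU (x + 1).
have key e : 0 < e -> \forall h \near (0 : R), `|f (h + x) - f x - h * g x| <= e * `|h|.
  move=> ep; have /cvgrPdist_lt /(_ _ ep) := cg x.
  rewrite -[X in nbhs X]add0r => hn.
  have [r /= r0 hr] := hn; near=> h.
  have hh : `|h| < r.
    by near: h; have /cvgrPdist_lt /(_ _ r0) := @cvg_id _ (nbhs (0 : R)); apply: filterS => h; rewrite sub0r normrN.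
  have hh1 : `|h| < 1.
    by near: h; have /cvgrPdist_lt /(_ _ ltr01) := @cvg_id _ (nbhs (0 : R)); apply: filterS => h; rewrite sub0r normrN.
  have hK K : `|fK K (h + x) - fK K x - h * g x| <= (e + eps K) * `|h|.
    apply: (@mean_value_bound R (fun y => fK K (y + x) - fK K x - y * g x)
      (fun y => dfK K (y + x) - g x)).
    - move=> y; have h1 := hd K (y + x).
      have h2 : is_derive (y : R) 1 (fun y => fK K (y + x)) (dfK K (y + x)).
        have h3 : is_derive (y : R) 1 (fun y => y + x) 1.
          by apply: is_derive_eq; rewrite addr0.
        by have := @is_derive1_comp R (fK K) (fun y => y + x) y _ _ h1 h3; rewrite mulr1.
      by apply: is_derive_eq; rewrite /GRing.scale /=; ring.
    - by rewrite add0r subrr mul0r subr0.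
    - move=> y yh.
      have -> : dfK K (y + x) - g x = - (g (y + x) - dfK K (y + x)) + (g (y + x) - g x) by ring.
      rewrite (le_trans (ler_normD _ _)) // normrN addrC lerD //; last first.
        apply: hg; rewrite addrC lerD2l (le_trans (ler_norm y)) // (le_trans yh) //.
      rewrite distrC ltW //; apply: hr; rewrite /ball_ /= add0r opprD addrCA subrr addr0 normrN.
      exact: le_lt_trans hh.
  have l1 : (e + eps K) * `|h| @[K --> \oo] --> (e + 0) * `|h|.
    by apply: cvgM; [apply: cvgD => //; exact: cvg_cst|exact: cvg_cst].
  have l2 : `|fK K (h + x) - fK K x - h * g x| @[K --> \oo] --> `|f (h + x) - f x - h * g x|.
    by apply: cvg_norm; apply: cvgB; [apply: cvgB; exact: hf|exact: cvg_cst].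
  rewrite -[e]addr0; apply: (ler_cvg_to l2 l1); exact: nearW.
have hl : h^-1 *: (f (h + x) - f x) @[h --> (0:R)^'] --> g x.
  apply/cvgrPdist_le => e ep; have hh : \forall h \near (0 : R)^', `|f (h + x) - f x - h * g x| <= e * `|h|.
    exact: nbhs_dnbhs (key e ep).
  near=> h; have hn0 : h != 0 by near: h; exact: nbhs_dnbhs_neq.
  have a0 : 0 < `|h| by rewrite normr_gt0.
  rewrite distrC -(ler_pM2l a0) -normrM.
  have -> : h * (h^-1 *: (f (h + x) - f x) - g x) = f (h + x) - f x - h * g x.
    by rewrite mulrBr /GRing.scale /= mulrA mulfV // mul1r.
  by rewrite [leRHS]mulrC; near: h.
have e1 : (fun h : R => h^-1 *: ((f \o shift x) (h *: 1) - f x)) = fun h => h^-1 *: (f (h + x) - f x).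
  by apply/funext => h; rewrite /= [h *: 1]mulr1.
apply: DeriveDef.
  by apply/cvg_ex; exists (g x); rewrite e1.
by rewrite /derive e1; exact/cvg_lim.
Unshelve. all: end_near. Qed.

Lemma derive_uniform_limit (f g : R -> R) (fK dfK : nat -> R -> R) (eps : nat -> R) :
  (forall K (x : R), is_derive x 1 (fK K) (dfK K x)) ->
  (forall x, fK K x @[K --> \oo] --> f x) ->
  (forall K x, `|g x - dfK K x| <= eps K) -> eps K @[K --> \oo] --> (0 : R) ->
  continuous g -> forall x : R, is_derive x 1 f (g x).
Proof.
move=> hd hf hg e0; apply: (derive_locally_uniform_limit hd hf) => U.
by exists eps => // K x _; exact: hg.
Qed.

End uniform_limits.

Section fourier.
Context {R : realType}.
Variable delta : R.
Hypothesis delta_gt0 : 0 < delta.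
Local Notation pi := (@pi R).
Local Notation lsum := (lsum delta).
Local Notation psum := (psum delta).
Local Notation tail := (tail delta).

(** Given by its Fourier series, hence 2 pi-periodic; [Theta_density_pdf] identifies it with the
    density of Theta on the open period. *)
Definition Theta_density (x : R) : R := 1 / (2 * pi) + 1 / pi * lsum (fun k => cos (k%:R * x)).
Definition Theta_cdf (x : R) : R := x / (2 * pi) + 1 / pi * lsum (fun k => sin (k%:R * x) / k%:R).
Local Notation S := Theta_density.
Local Notation T := Theta_cdf.

Let SK K (x : R) : R := 1 / (2 * pi) + 1 / pi * psum (fun k => cos (k%:R * x)) K.

Let cos1 (x : R) (k : nat) : `|cos (k%:R * x)| <= 1. Proof. exact: cos_max. Qed.

Lemma sin_div_le1 (x : R) (k : nat) : `|sin x / k%:R| <= 1.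
Proof.
case: k => [|k]; first by rewrite invr0 mulr0 normr0.
rewrite normrM normfV normr_nat ler_pdivrMr // mul1r (le_trans (sin_max _)) //.
by rewrite ler1n.
Qed.

Let pi_neq0 : pi != 0. Proof. by rewrite gt_eqF // pi_gt0. Qed.

Let pi_inv_gt0 : 0 < 1 / pi. Proof. by rewrite divr_gt0 // pi_gt0. Qed.

Let S_SK K x : `|S x - SK K x| <= 1 / pi * tail K.
Proof.
rewrite /S /SK opprD addrACA subrr add0r -mulrBr normrM (gtr0_norm pi_inv_gt0).
by rewrite ler_wpM2l ?(ltW pi_inv_gt0) //; exact: lsum_tail.
Qed.

Let tail0 (c : R) : c * tail K @[K --> \oo] --> (0 : R).
Proof.
have : c * tail K @[K --> \oo] --> (c * 0 : R).
  by apply: cvgM; [exact: cvg_cst|exact: tail_cvg].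
by rewrite mulr0.
Qed.

Let SK_derive K (x : R) : is_derive x 1 (SK K)
  (1 / pi * \sum_(k < K) rising_ratio delta k.+1 * (- (k.+1%:R * sin (k.+1%:R * x)))).
Proof.
rewrite /SK /psum.
have -> : (fun x : R => 1 / (2 * pi) + 1 / pi * (\sum_(k < K) rising_ratio delta k.+1 * cos (k.+1%:R * x))) =
  (fun x => 1 / (2 * pi) + 1 / pi * (\sum_(k < K) (fun x => rising_ratio delta k.+1 * cos (k.+1%:R * x))) x).
  by apply/funext => y; rewrite fct_sumE.
have h : is_derive x 1 (\sum_(k < K) (fun x : R => rising_ratio delta k.+1 * cos (k.+1%:R * x)))
    (\sum_(k < K) rising_ratio delta k.+1 * (- (k.+1%:R * sin (k.+1%:R * x)))).
  apply: is_derive_sum => k; apply: is_derive_eq; rewrite /GRing.scale /=; ring.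
by apply: is_derive_eq; rewrite /GRing.scale /=; ring.
Qed.

Let derivable_continuous (f df : R -> R) :
  (forall x : R, is_derive x 1 f (df x)) -> continuous f.
Proof.
by move=> h x; apply: differentiable_continuous; apply/derivable1_diffP; have [] := h x.
Qed.

Lemma continuous_Theta_density : continuous S.
Proof.
apply: (@uniform_limit_continuous_seq R SK S (fun K => 1 / pi * tail K)) => //.
by move=> K; exact: (derivable_continuous (SK_derive K)).
Qed.

Lemma derive_Theta_cdf (x : R) : is_derive x 1 T (S x).
Proof.
pose TK K (x : R) := x / (2 * pi) + 1 / pi * psum (fun k => sin (k%:R * x) / k%:R) K.
apply: (@derive_uniform_limit R T S TK SK (fun K => 1 / pi * tail K)).
- move=> K y; rewrite /TK /SK /psum.
  have -> : (fun x : R => x / (2 * pi) + 1 / pi * (\sum_(k < K) rising_ratio delta k.+1 * (sin (k.+1%:R * x) / k.+1%:R))) =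
    (fun x => x / (2 * pi) + 1 / pi * (\sum_(k < K) (fun x => rising_ratio delta k.+1 * (sin (k.+1%:R * x) / k.+1%:R))) x).
    by apply/funext => z; rewrite fct_sumE.
  have h : is_derive y 1 (\sum_(k < K) (fun x : R => rising_ratio delta k.+1 * (sin (k.+1%:R * x) / k.+1%:R)))
      (\sum_(k < K) rising_ratio delta k.+1 * cos (k.+1%:R * y)).
    apply: is_derive_sum => k; apply: is_derive_eq; rewrite /GRing.scale /=; field.
    by rewrite nat1r pnatr_eq0.
  by apply: is_derive_eq; rewrite /GRing.scale /=; move: (trigo.pi) pi_neq0 => p p0; field.
- move=> y; apply: cvgD; first exact: cvg_cst.
  apply: cvgM; first exact: cvg_cst.
  by apply: psum_cvg => // k; exact: sin_div_le1.
- by move=> K y; exact: S_SK.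
- exact: tail0.
- exact: continuous_Theta_density.
Qed.

(* The recurrence of the coefficients becomes a first-order linear differential
   equation, whose solutions are multiples of (1 - cos x)^delta. *)
Lemma derive_weighted_density (x : R) :
  is_derive x 1 (fun x => (1 - cos x) * S x) ((1 + delta) * sin x * S x).
Proof.
pose eK K := `|1 / pi * ((K%:R - delta) * rising_ratio delta K)| + (1 + delta) * (1 / pi * tail K).
pose dq K x := sin x * SK K x + (1 - cos x) *
  (1 / pi * \sum_(k < K) rising_ratio delta k.+1 * (- (k.+1%:R * sin (k.+1%:R * x)))).
apply: (@derive_uniform_limit R (fun x => (1 - cos x) * S x) (fun x => (1 + delta) * sin x * S x)
  (fun K x => (1 - cos x) * SK K x) dq eK).
- move=> K y; have h := SK_derive K y.
  by apply: is_derive_eq; rewrite /dq /GRing.scale /=; ring.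
- move=> y; apply: cvgM; first exact: cvg_cst.
  apply/cvgrPdist_le => e e0.
  have /cvgrPdist_le /(_ _ e0) := tail0 (1 / pi); apply: filterS => K.
  rewrite sub0r normrN => h; apply: (le_trans (S_SK K y)).
  by apply: le_trans h; exact: ler_norm.
- move=> K y.
  have s0 : sin (0%:R * y) = 0 by rewrite mul0r sin0.
  have tel := @rising_ratio_telescope R delta delta_gt0 (fun k => sin (k%:R * y)) K s0.
  rewrite /= in tel.
  have dqE : dq K y = (1 + delta) * sin y * SK K y +
      1 / pi * (2^-1 * ((K%:R - delta) * rising_ratio delta K) * (sin (K.+1%:R * y) - sin (K%:R * y))).
    rewrite mul1r in tel; rewrite -tel /dq.
    (* Product-to-sum formulas for (1 - cos y) sin(k y) produce the combination that telescopes,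
       plus delta sin y times the cosine sum. *)
    have e1 : (1 - cos y) * (1 / pi * \sum_(k < K) rising_ratio delta k.+1 * (- (k.+1%:R * sin (k.+1%:R * y)))) -
        1 / pi * (\sum_(k < K) rising_ratio delta k.+1 * (- (k.+1%:R * sin (k.+1%:R * y)) +
           (k.+1%:R - delta) / 2 * sin (k.+2%:R * y) + (k.+1%:R + delta) / 2 * sin (k%:R * y))) =
       1 / pi * (delta * sin y * psum (fun k => cos (k%:R * y)) K).
      rewrite mulrCA -mulrBr; congr (_ * _).
      rewrite /psum !mulr_sumr -sumrB; apply: eq_bigr => k _.
      have -> : k.+2%:R * y = k.+1%:R * y + y by rewrite -[k.+2%:R]natr1; ring.
      have -> : k%:R * y = k.+1%:R * y - y by rewrite -[k.+1%:R]natr1; ring.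
      move: (k.+1%:R : R) => n; move: (n * y) => t; rewrite sinD sinB; by field.
    have -> : (1 - cos y) * (1 / pi * \sum_(k < K) rising_ratio delta k.+1 * (- (k.+1%:R * sin (k.+1%:R * y)))) =
        1 / pi * (\sum_(k < K) rising_ratio delta k.+1 * (- (k.+1%:R * sin (k.+1%:R * y)) +
           (k.+1%:R - delta) / 2 * sin (k.+2%:R * y) + (k.+1%:R + delta) / 2 * sin (k%:R * y))) +
        1 / pi * (delta * sin y * psum (fun k => cos (k%:R * y)) K) by rewrite -e1; ring.
    by rewrite /SK; move: (trigo.pi) pi_neq0 (psum _ K) (bigop _ _ _) => p p0 a1 a2; field.
  rewrite dqE opprD addrA -mulrBr (le_trans (ler_normB _ _)) // addrC; apply: lerD.
    have h : `|sin (K.+1%:R * y) - sin (K%:R * y)| <= 2.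
      by rewrite (le_trans (ler_normB _ _)) // -[leRHS]/(1 + 1) lerD // sin_max.
    rewrite [X in `|X|](_ : _ = 1 / pi * ((K%:R - delta) * rising_ratio delta K) * (2^-1 * (sin (K.+1%:R * y) - sin (K%:R * y)))); last by move: (trigo.pi) pi_neq0 => p p0; field.
    rewrite normrM ler_piMr // normrM ger0_norm // mulrC ler_pdivrMr // mul1r //.
  rewrite normrM; apply: ler_pM => //.
  by rewrite normrM ger0_norm ?addr_ge0 ?(ltW delta_gt0) // ler_piMr ?addr_ge0 ?(ltW delta_gt0) // sin_max.
- have [_ h1] := rising_ratio_summable delta_gt0.
  have h2 : `|1 / pi * ((K%:R - delta) * rising_ratio delta K)| @[K --> \oo] --> `|1 / pi * 0 : R|.
    by apply: cvg_norm; apply: cvgM => //; exact: cvg_cst.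
  have h3 : (1 + delta) * (1 / pi * tail K) @[K --> \oo] --> ((1 + delta) * 0 : R).
    by apply: cvgM; [exact: cvg_cst|exact: tail0].
  have := cvgD h2 h3; rewrite !mulr0 normr0 addr0; exact.
- move=> y; apply: cvgM; last exact: continuous_Theta_density.
  by apply: cvgM; [exact: cvg_cst|exact: continuous_sin].
Qed.

Let sinDn (x : R) (n : nat) : sin (n%:R * (x + 2 * pi)) = sin (n%:R * x).
Proof.
have -> : n%:R * (x + 2 * pi) = n%:R * x + pi *+ 2 *+ n.
  by rewrite mulrDr -(mulr_natl (pi *+ 2) n) -(mulr_natl pi 2).
exact: (periodicn (@sinD2pi R)).
Qed.

Let cosDn (x : R) (n : nat) : cos (n%:R * (x + 2 * pi)) = cos (n%:R * x).
Proof.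
have -> : n%:R * (x + 2 * pi) = n%:R * x + pi *+ 2 *+ n.
  by rewrite mulrDr -(mulr_natl (pi *+ 2) n) -(mulr_natl pi 2).
exact: (periodicn (@cosD2pi R)).
Qed.

Lemma Theta_cdfD2pi x : T (x + 2 * pi) = T x + 1.
Proof.
rewrite /T (_ : (fun k => sin (k%:R * (x + 2 * pi)) / k%:R) = (fun k => sin (k%:R * x) / k%:R)).
  by move: (trigo.pi) pi_neq0 => p p0; field.
by apply/funext => k; rewrite sinDn.
Qed.

Lemma Theta_densityD2pi x : S (x + 2 * pi) = S x.
Proof. by rewrite /S; under eq_fun do rewrite cosDn. Qed.

Lemma Theta_cdf0 : T 0 = 0.
Proof.
rewrite /T mul0r add0r (_ : lsum _ = 0) ?mulr0 // /lsum.
rewrite (_ : series _ = fun=> 0) ?lim_cst //; apply/funext => n.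
by rewrite /series /= big1 // => k _; rewrite mulr0 sin0 mul0r mulr0.
Qed.

End fourier.

Section density.
Context {R : realType}.
Variable delta : R.
Hypothesis delta_gt0 : 0 < delta.
Local Notation pi := (@pi R).
Local Notation S := (Theta_density delta).
Local Notation mu := (@lebesgue_measure R).

Let psi (x : R) : R := (1 - cos x) `^ delta.

Let pi_neq0 : pi != 0. Proof. by rewrite gt_eqF // pi_gt0. Qed.

Lemma cos_lt1 (x : R) : 0 < x < 2 * pi -> cos x < 1.
Proof.
move=> /andP[x0 xpi]; rewrite lt_neqAle cos_le1 andbT; apply/negP => /eqP cx.
have e : cos x = 1 - 2 * sin (x / 2) ^+ 2.
  have := cosD (x / 2) (x / 2); rewrite -splitr => ->.
  by have := cos2Dsin2 (x / 2) => h; rewrite -!expr2; lra.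
have s0 : 0 < sin (x / 2).
  apply: sin_gt0_pi; rewrite divr_gt0 //= ltr_pdivrMr //; lra.
have : 0 < sin (x / 2) ^+ 2 by rewrite exprn_gt0.
lra.
Qed.

(** [E] is the integrating factor (1 - cos x)^(-1 - delta) of the equation in
    [derive_weighted_density]: the product [f] has derivative 0 on the open period, where 1 - cos x
    > 0. *)
Lemma Theta_density_power : exists C, forall x, 0 < x < 2 * pi -> S x = C * psi x.
Proof.
pose E x := expR (- (1 + delta) * ln (1 - cos x)).
pose f x := (1 - cos x) * S x * E x.
have df (x : R) : 0 < x < 2 * pi -> is_derive x 1 f 0.
  move=> hx; have c0 : 0 < 1 - cos x by rewrite subr_gt0 cos_lt1.
  have h1 := derive_weighted_density delta_gt0 x.
  have h2 : is_derive x 1 (fun x => 1 - cos x) (sin x).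
    by apply: is_derive_eq; rewrite /GRing.scale /=; ring.
  have h3 : is_derive x 1 (fun x => ln (1 - cos x)) ((1 - cos x)^-1 * sin x).
    exact: (@is_derive1_comp R (@ln R) (fun x => 1 - cos x) x _ _ (is_derive1_ln c0) h2).
  have h4 : is_derive x 1 (fun x => - (1 + delta) * ln (1 - cos x))
      (- (1 + delta) * ((1 - cos x)^-1 * sin x)).
    by apply: is_derive_eq; rewrite /GRing.scale /=; ring.
  have h5 : is_derive x 1 E (E x * (- (1 + delta) * ((1 - cos x)^-1 * sin x))).
    exact: (@is_derive1_comp R (@expR R) (fun x => - (1 + delta) * ln (1 - cos x)) x _ _
      (is_derive_expR _) h4).
  apply: is_derive_eq; rewrite /GRing.scale /=.
  by move: c0; move: (1 - cos x) (E x) (S x) (sin x) => a b c d a0; field; rewrite gt_eqF.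
have cst x y : 0 < x < 2 * pi -> 0 < y < 2 * pi -> x < y -> f x = f y.
  move=> /andP[x0 x1] /andP[y0 y1] xy.
  have hz z : z \in `[x, y] -> 0 < z < 2 * pi.
    rewrite in_itv /= => /andP[xz zy].
    by rewrite (lt_le_trans x0 xz) (le_lt_trans zy y1).
  have [||z _] := @MVT R f (fun=> 0) x y xy.
  - by move=> z zxy; apply: df; apply: hz; exact: subset_itv_oo_cc.
  - apply: derivable_within_continuous => z /hz /df; by case.
  - by rewrite mul0r => /eqP; rewrite subr_eq0 => /eqP ->.
have pi0 : 0 < pi := pi_gt0 R.
have pin : 0 < pi < 2 * pi by rewrite pi0 /=; lra.
exists (f pi) => x hx.
have c0 : 0 < 1 - cos x by rewrite subr_gt0 cos_lt1.
have fE : f x = f pi.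
  by have [h|h|->//] := ltgtP x pi; [exact: cst|rewrite -(cst pi x)].
rewrite -fE /f /E /psi /powR gt_eqF //.
have -> : expR (- (1 + delta) * ln (1 - cos x)) = (expR (delta * ln (1 - cos x)))^-1 * (1 - cos x)^-1.
  rewrite -{3}(lnK (x := 1 - cos x)) ?posrE // -!expRN -expRD; congr expR; ring.
have e0 := expR_gt0 (delta * ln (1 - cos x)).
by field; rewrite !gt_eqF.
Qed.

Let psi_ge0 x : 0 <= psi x. Proof. exact: powR_ge0. Qed.

Let integral_S : (\int[mu]_(x in `]0%R, (2 * pi)%R[) (S x)%:E = 1%:E)%E.
Proof.
have p0 : 0 < 2 * pi by rewrite mulr_gt0 // pi_gt0.
have cS := continuous_Theta_density delta_gt0.
have mS : measurable_fun setT S by exact: continuous_measurable_fun.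
rewrite -(@integral_itv_bndoo _ 0 (2 * pi) _ true false); last first.
  by apply/measurable_EFinP; exact: measurable_funTS.
rewrite (@continuous_FTC2 _ S (Theta_cdf delta)) //.
- by rewrite -[in X in (X%:E - _)%E](add0r (2 * pi)) Theta_cdfD2pi // Theta_cdf0 // add0r sube0.
- exact: continuous_subspaceT.
- have dT := derive_Theta_cdf delta_gt0.
  have cT : continuous (Theta_cdf delta).
    by move=> x; apply: differentiable_continuous; apply/derivable1_diffP; have [] := dT x.
  split; [by move=> x _; have [] := dT x| |].
    exact: cvg_at_right_filter (cT _).
  exact: cvg_at_left_filter (cT _).
- move=> x _; have dx := derive_Theta_cdf delta_gt0 x; by rewrite derive1E (@derive_val _ _ _ _ _ _ _ dx).
Qed.

(** Both 1 - e^{-ix} and 1 - e^{ix} have squared modulus 2 (1 - cos x), and their arguments are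
    opposite, so the phases of the two powers cancel. *)
Lemma Theta_pdf_power x : 0 < x < 2 * pi -> Theta_pdf delta x =
  (2 * pi)^-1 * (Gamma (1 + delta) ^+ 2 / Gamma (1 + 2 * delta)) * (2 `^ delta) * psi x.
Proof.
move=> hx; have c0 : 0 < 1 - cos x by rewrite subr_gt0 cos_lt1.
pose N := Num.sqrt (2 * (1 - cos x)).
have z1 : 1 - expi (- x) = (1 - cos x) +i* sin x.
  by rewrite /expi cosN sinN; apply/eqP; rewrite eq_complex /= !eqxx /= sub0r opprK.
have z2 : 1 - expi x = (1 - cos x) +i* (- sin x).
  by rewrite /expi; apply/eqP; rewrite eq_complex /= !eqxx /= sub0r.
have Nsq : (1 - cos x) ^+ 2 + sin x ^+ 2 = 2 * (1 - cos x).
  have := cos2Dsin2 x => h; nra.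
have n1 : cnorm (1 - expi (- x)) = N by rewrite z1 /cnorm /= Nsq.
have n2 : cnorm (1 - expi x) = N by rewrite z2 /cnorm /= sqrrN Nsq.
have N0 : 0 < N by rewrite sqrtr_gt0 mulr_gt0.
have ph : carg (1 - expi x) = - carg (1 - expi (- x)).
  rewrite /carg n1 n2 z1 z2 /= oppr_ge0.
  have [s0|s0|s0] := ltgtP (sin x) 0; [by rewrite opprK|by []|].
  (* For sin x = 0 both arguments fall in the same branch of [carg]; they are still opposite because
     cos x = -1 makes them 0. *)
  have cN1 : cos x = -1.
    have := cos2Dsin2 x; rewrite s0 expr0n addr0 => /eqP; rewrite sqrf_eq1 => /orP[/eqP h|/eqP //].
    by move: c0; rewrite h subrr ltxx.
  have -> : N = 1 - cos x.
    by rewrite /N cN1 opprK -[2 * _]/(2 * 2) -expr2 sqrtr_sqr ger0_norm.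
  by rewrite divff ?gt_eqF // acos1 oppr0.
rewrite /Theta_pdf /cpow n1 n2 ph; set t := carg _.
have e : expi (delta * t) * expi (delta * - t) = 1 :> R[i].
  rewrite mulrN /expi cosN sinN; apply/eqP; rewrite eq_complex /=.
  by have := cos2Dsin2 (delta * t) => h; apply/andP; split; apply/eqP; [rewrite mulrN opprK -!expr2|ring].
set K := Gamma _ ^+ 2 / _.
have -> : ((2 * pi)^-1)%:C * K%:C * ((N `^ delta)%:C * expi (delta * t)) * ((N `^ delta)%:C * expi (delta * - t)) =
   ((2 * pi)^-1 * K * (N `^ delta * N `^ delta))%:C.
  rewrite -[RHS]mulr1 -e !rmorphM /=; ring.
rewrite /= -[RHS]mulrA; congr (_ * _).
rewrite -powRM; [|exact: ltW|exact: ltW].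
by rewrite -expr2 /N sqr_sqrtr ?mulr_ge0 ?ltW // powRM // ltW.
Qed.

(* The two functions are proportional and both have integral 1, so the Gamma
   factors need not be evaluated: [Theta_law] contains the normalization. *)
Lemma Theta_density_pdf {d} {T : measurableType d} (P : probability T R) (Theta : T -> R) :
  Theta_law P delta Theta ->
  (forall x, 0 < x < 2 * pi -> Theta_pdf delta x = S x) /\ (forall x, 0 <= S x).
Proof.
move=> [mTheta _ law].
have [C hC] := Theta_density_power.
set K := (2 * pi)^-1 * (Gamma (1 + delta) ^+ 2 / Gamma (1 + 2 * delta)) * (2 `^ delta).
have mpsi : measurable_fun setT psi.
  apply: (measurableT_comp (measurable_powR delta)).
  by apply: measurable_funB => //; exact: measurable_cosR.
have inI (x : R) : x \in (`]0%R, (2 * pi)%R[%classic : set R) -> 0 < x < 2 * pi.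
  by rewrite inE /= in_itv.
have iS := integral_S.
have iK : (\int[mu]_(x in `]0%R, (2 * pi)%R[) (K * psi x)%:E = 1%:E)%E.
  have := law setT measurableT; rewrite preimage_setT probability_setT setTI => ->.
  have eK : (\int[mu]_(x in `]0%R, (2 * pi)%R[) (K * psi x)%:E =
             \int[mu]_(x in `]0%R, (2 * pi)%R[) (Theta_pdf delta x)%:E)%E.
    by apply: eq_integral => x /inI hx; rewrite Theta_pdf_power.
  rewrite eK; symmetry; apply: integral_itv_bndoo.
  apply: (eq_measurable_fun (fun x => (K * psi x)%:E)).
    by move=> x /inI hx; rewrite Theta_pdf_power.
  by apply/measurable_EFinP; apply: measurable_funTS; apply: measurable_funM.
have iC : (\int[mu]_(x in `]0%R, (2 * pi)%R[) (C * psi x)%:E = 1%:E)%E.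
  by rewrite -iS; apply: eq_integral => x /inI hx; rewrite hC.
have mp : measurable_fun (`]0%R, (2 * pi)%R[ : set R) (fun x => (psi x)%:E).
  by apply/measurable_EFinP; exact: measurable_funTS.
have neg c : c < 0 -> (\int[mu]_(x in `]0%R, (2 * pi)%R[) (c * psi x)%:E <= 0)%E.
  move=> c0; have e x : (c * psi x)%:E = (- (- c * psi x)%:E)%E by rewrite -EFinN mulNr opprK.
  under eq_integral do rewrite e.
  rewrite integral_ge0N; last by move=> x _; rewrite lee_fin mulr_ge0 // oppr_ge0 ltW.
  rewrite leeNl oppe0; apply: integral_ge0 => x _.
  by rewrite lee_fin mulr_ge0 // oppr_ge0 ltW.
(* The sign of [K] is not known in advance: total mass 1 excludes K <= 0, and for K > 0 it shows
   that the integral of psi is finite and nonzero. *)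
have [ip fip ip0] : exists2 i : R, (\int[mu]_(x in `]0%R, (2 * pi)%R[) (psi x)%:E = i%:E)%E & i != 0.
  have p0 : (0 <= \int[mu]_(x in `]0%R, (2 * pi)%R[) (psi x)%:E)%E.
    by apply: integral_ge0 => x _; rewrite lee_fin.
  have [K0|K0|K0] := ltgtP K 0.
  - have : (\int[mu]_(x in `]0%R, (2 * pi)%R[) (K * psi x)%:E <= 0)%E.
      exact: neg.
    by rewrite iK lee_fin ler10.
  - have : (\int[mu]_(x in `]0%R, (2 * pi)%R[) (K * psi x)%:E = K%:E * \int[mu]_(x in `]0%R, (2 * pi)%R[) (psi x)%:E)%E.
      under eq_integral do rewrite EFinM.
      by apply: ge0_integralZl_EFin => //; [move=> x _; rewrite lee_fin|exact: ltW].
    rewrite iK; move: p0; case: (integral _ _ _) => [r| |] // r0.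
      move=> [] h; exists r => //; apply/negP => /eqP r00; move: h; rewrite r00 mulr0 => /eqP.
      by rewrite oner_eq0.
    by rewrite gt0_muley ?lte_fin.
  - by move: iK; rewrite K0; under eq_integral do rewrite mul0r; rewrite integral0 => -[] /eqP; rewrite eq_sym oner_eq0.
have ipsi : mu.-integrable (`]0%R, (2 * pi)%R[) (fun x => (psi x)%:E).
  apply/integrableP; split => //.
  under eq_integral => x _ do rewrite gee0_abs ?lee_fin //.
  by rewrite fip; exact: ltry.
have scal c : (\int[mu]_(x in `]0%R, (2 * pi)%R[) (c * psi x)%:E = (c * ip)%:E)%E.
  under eq_integral do rewrite EFinM.
  by rewrite integralZl // fip.
have CK : K = C.
  move: iK iC; rewrite !scal => -[h1] [h2].
  by apply: (mulIf ip0); rewrite h1 h2.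
split; first by move=> x hx; rewrite Theta_pdf_power // hC // -CK.
have C0 : 0 <= C.
  rewrite leNgt; apply/negP => C0.
  have : (\int[mu]_(x in `]0%R, (2 * pi)%R[) (C * psi x)%:E <= 0)%E.
    exact: neg.
  by rewrite iC lee_fin ler10.
have S0 x : 0 < x < 2 * pi -> 0 <= S x by move=> hx; rewrite hC // mulr_ge0.
have Sn (n : nat) x : S (x + 2 * pi * n%:R) = S x.
  elim: n => [|n ih]; first by rewrite mulr0 addr0.
  have -> : x + 2 * pi * n.+1%:R = x + 2 * pi * n%:R + 2 * pi by rewrite -natr1; ring.
  by rewrite Theta_densityD2pi.
have Sz (n : int) x : S (x + 2 * pi * n%:~R) = S x.
  case: n => n; first exact: Sn.
  by rewrite NegzE mulrNz mulrN -(Sn n.+1 (x - _)) subrK.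
have p0 : 0 < 2 * pi by rewrite mulr_gt0 // pi_gt0.
(* The power formula holds on the open period; at 0 the sign follows by continuity. *)
have S00 : 0 <= S 0.
  rewrite leNgt; apply/negP => h.
  have h' : 0 < - S 0 by rewrite oppr_gt0.
  have /cvgrPdist_lt /(_ _ h') [r /= r0 hr] := @continuous_Theta_density R delta delta_gt0 0.
  pose x := Num.min (r / 2) pi.
  have x0 : 0 < x by rewrite lt_min divr_gt0 //= pi_gt0.
  have xr : x < r by rewrite gt_min ltr_pdivrMr // ltr_pMr // ltr1n.
  have xp : x < 2 * pi.
    apply: (@le_lt_trans _ _ pi); first by rewrite ge_min lexx orbT.
    have := pi_gt0 R; lra.
  have := hr x; rewrite /ball_ /= sub0r normrN gtr0_norm // => /(_ xr).
  have : 0 <= S x by apply: S0; rewrite x0.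
  by move=> h1; rewrite ltr_norml => /andP[h2 _]; move: h2; rewrite opprK -subr_gt0 addrAC subrr add0r oppr_gt0 ltNge h1.
move=> x; pose n := Num.floor (x / (2 * pi)).
pose y := x - 2 * pi * n%:~R.
have -> : S x = S y by rewrite -(Sz n y) /y subrK.
have /andP[n1 n2] := floor_itv (x / (2 * pi)).
have y0 : 0 <= y by rewrite /y subr_ge0 mulrC -ler_pdivlMr.
have y1 : y < 2 * pi.
  rewrite /y ltrBlDr -[X in X + _]mulr1 -mulrDr mulrC -ltr_pdivrMr //.
  by rewrite addrC; move: n2; rewrite -/n intrD.
move: y0; rewrite le_eqVlt => /orP[/eqP <- //|y0].
by apply: S0; rewrite y0.
Qed.

End density.

(** The weight inequalities ask for p <= 1/2, so [p] is delta capped at 1/2 and the excess eta is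
    met by a shift m >= 2 eta. *)
Lemma energy_weight_exists {R : realType} (delta : R) : 0 < delta -> exists W : nat -> R,
  let h k := 2^-1 * (W k * (k.+1%:R - delta) + W k.+1 * (k.+2%:R + delta)) in
  [/\ forall k, 0 < W k, forall k, 0 <= h k, h 0%N <= 2 * W 0%N,
      forall k, h k + h k.+1 <= 2 * k.+2%:R * W k.+1 &
      cvgn (series W) /\ k.+1%:R * W k @[k --> \oo] --> (0 : R)].
Proof.
move=> d0; pose p := Num.min delta (1 / 2); pose eta := delta - p.
have p0 : 0 < p by rewrite lt_min d0 /= divr_gt0.
have p1 : p <= 1 / 2 by rewrite ge_min lexx orbT.
have e0 : 0 <= eta by rewrite subr_ge0 ge_min lexx.
have [m hm] : exists m : nat, 2 * eta <= m%:R.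
  by exists (Num.trunc (2 * eta)).+1; rewrite ltW // truncnS_gt.
have dE : delta = p + eta by rewrite /eta addrC subrK.
exists (weight m p) => h; split.
- by move=> k; exact: weight_gt0.
- by move=> k; rewrite /h dE; exact: cross_weight_ge0.
- by rewrite /h dE; exact: cross_weight0.
- by move=> k; rewrite /h dE; exact: cross_weight_le.
- exact: weight_summable.
Qed.

(** * Moments as functions of lambda *)

Section solution_moments.
Context {R : realType} {d : measure_display} {T : measurableType d}.
Variables (P : probability T R) (Z : R -> T -> R[i]).
Hypothesis CBM : two_sided_complex_BM P Z.
Variables (beta delta : R).
Hypotheses (beta_gt0 : 0 < beta) (delta_gt0 : 0 < delta).
Local Notation rate := (drift_rate beta).
Local Notation regular := (regular_solution P Z beta delta).

Definition mc (a : R -> T -> R) (k : nat) (u : R) : R := mean_cos P a k%:R 0 u.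
Definition ms (a : R -> T -> R) (k : nat) (u : R) : R := mean_cos P a k%:R (- (pi / 2)) u.

Lemma mcE a k u : mc a k u = Ex P (fun w => cos (k%:R * a u w)).
Proof. by apply: eq_Ex => w; rewrite addr0. Qed.

Lemma msE a k u : ms a k u = Ex P (fun w => sin (k%:R * a u w)).
Proof. by apply: eq_Ex => w; rewrite cosBpihalf. Qed.

Section one_solution.
Variables (lambda : R) (a : R -> T -> R).
Hypothesis reg : regular lambda a.

Let ma u : measurable_fun setT (a u). Proof. exact: (reg_measurable reg). Qed.

Lemma continuous_mean_cos k c : continuous (mean_cos P a k c).
Proof.
apply: holder_continuous => U.
have [C C0 hC] := mean_cos_holder beta_gt0 (ltW delta_gt0) reg k c U.
by exists C => // s t st ts1 tU; exact: hC.
Qed.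

Lemma derive_mean_cos k c (u : R) : is_derive u 1 (mean_cos P a k c)
  (- (k * lambda * rate u) * mean_cos P a k (c - pi / 2) u - k ^+ 2 * mean_cos P a k c u
  + k * (k + delta) / 2 * mean_cos P a (k - 1) c u
  + k * (k - delta) / 2 * mean_cos P a (k + 1) c u).
Proof.
move: u; apply: derive_of_estimate.
  have cm := continuous_mean_cos => u.
  apply: cvgD; last by apply: cvgM; [exact: cvg_cst|exact: cm].
  apply: cvgD; last by apply: cvgM; [exact: cvg_cst|exact: cm].
  apply: cvgB; last by apply: cvgM; [exact: cvg_cst|exact: cm].
  apply: cvgM; last exact: cm.
  apply: cvgN; apply: cvgM; first exact: cvg_cst.
  exact: continuous_rate.
move=> U; have [C C0 hC] := ito_cos CBM beta_gt0 (ltW delta_gt0) reg k c U.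
by exists C => // s t st ts1 tU; have := hC s t st ts1 tU; rewrite (mean_cos_ode reg).
Qed.

Lemma derive_mc k (u : R) : is_derive u 1 (mc a k.+1)
  (- (k.+1%:R * (lambda * rate u)) * ms a k.+1 u - k.+1%:R ^+ 2 * mc a k.+1 u
   + k.+1%:R * (k.+1%:R + delta) / 2 * mc a k u + k.+1%:R * (k.+1%:R - delta) / 2 * mc a k.+2 u).
Proof.
have h := derive_mean_cos k.+1%:R 0 u; apply: is_derive_eq.
rewrite /mc /ms sub0r.
have -> : k.+1%:R - 1 = k%:R :> R by rewrite -natr1 addrK.
have -> : k.+1%:R + 1 = k.+2%:R :> R by rewrite natr1.
ring.
Qed.

Lemma derive_ms k (u : R) : is_derive u 1 (ms a k.+1)
  (k.+1%:R * (lambda * rate u) * mc a k.+1 u - k.+1%:R ^+ 2 * ms a k.+1 u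
   + k.+1%:R * (k.+1%:R + delta) / 2 * ms a k u + k.+1%:R * (k.+1%:R - delta) / 2 * ms a k.+2 u).
Proof.
have h := derive_mean_cos k.+1%:R (- (pi / 2)) u; apply: is_derive_eq.
(* The phase of the sine shifted once more by - pi / 2 gives minus the cosine. *)
have -> : mean_cos P a k.+1%:R (- (pi / 2) - pi / 2) u = - mc a k.+1 u.
  rewrite /mc /mean_cos -ExN; last exact: (L1_cos (P := P) reg).
  apply: eq_Ex => w; rewrite addr0.
  have -> : k.+1%:R * a u w + (- (pi / 2) - pi / 2) = k.+1%:R * a u w - pi by field.
  by rewrite cosB cospi sinpi mulr0 addr0 mulrN1.
have -> : k.+1%:R - 1 = k%:R :> R by rewrite -natr1 addrK.
have -> : k.+1%:R + 1 = k.+2%:R :> R by rewrite natr1.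
rewrite -/(ms a k u) -/(ms a k.+2 u) -/(ms a k.+1 u); ring.
Qed.

Lemma mean_cos_le1 k c u : `|mean_cos P a k c u| <= 1.
Proof.
have l := L1_cos (P := P) reg k c u.
rewrite (le_trans (Ex_norm_le l)) // -[leRHS](@Ex_cst _ _ _ P); apply: Ex_le.
- exact: L1_norm.
- exact: L1_cst.
- by move=> w; exact: cos_max.
Qed.

Lemma mc0 u : mc a 0 u = 1.
Proof. by rewrite mcE -[RHS](@Ex_cst _ _ _ P); apply: eq_Ex => w; rewrite mul0r cos0. Qed.

Lemma ms0 u : ms a 0 u = 0.
Proof. by rewrite msE -[RHS](@Ex_cst _ _ _ P); apply: eq_Ex => w; rewrite mul0r sin0. Qed.

Lemma cvg_start u : {ae P, forall w, a (u - n%:R) w @[n --> \oo] --> (0 : R)}.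
Proof.
apply: filterS (reg_start reg) => w h.
apply: (cvg_comp (fun n : nat => u - n%:R) (a ^~ w) _ h).
apply/cvgrNyPle => A; near=> n.
by rewrite lerBlDl -lerBlDr; near: n; exact: nbhs_infty_ger.
Unshelve. all: end_near. Qed.

Lemma mean_cos_start k c u : mean_cos P a k c (u - n%:R) @[n --> \oo] --> cos c.
Proof.
pose f n w := cos (k * a (u - n%:R) w + c).
have mf n : measurable_fun setT (f n).
  apply: (measurableT_comp measurable_cosR).
  by apply: measurable_funD => //; apply: measurable_funM.
have [|||||_ _ h] := @dominated_convergence _ T R P setT measurableT
  (fun n w => (f n w)%:E) (fun w => (cos c)%:E) (fun=> 1%:E).
- by move=> n; exact/measurable_EFinP.
- exact: measurable_cst.
- apply: filterS (cvg_start u) => w h _.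
  apply: cvg_EFin; first by apply: nearW.
  rewrite -[X in cos X]add0r -[X in cos (X + c)](mulr0 k).
  apply: (@cvg_comp _ _ _ (fun n => k * a (u - n%:R) w + c) cos _ (nbhs (k * 0 + c))); last exact: continuous_cos.
  by apply: cvgD; [apply: cvgM => //; exact: cvg_cst|exact: cvg_cst].
- exact: L1_cst.
- by apply: aeW => w n _; rewrite lee_fin; exact: cos_max.
move: h; have -> : (\int[P]_w (cos c)%:E = (cos c)%:E)%E.
  by rewrite -(ExE (L1_cst P (cos c))) Ex_cst.
by move=> h; exact: (fine_cvg h).
Qed.

Lemma mc_start k u : mc a k (u - n%:R) @[n --> \oo] --> (1 : R).
Proof. by have := @mean_cos_start k%:R 0 u; rewrite cos0. Qed.

Lemma ms_start k u : ms a k (u - n%:R) @[n --> \oo] --> (0 : R).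
Proof. by have := @mean_cos_start k%:R (- (pi / 2)) u; rewrite cosN cos_pihalf. Qed.

End one_solution.

Definition scaled_param (lambda u : R) : R := lambda * expR (beta / 4 * u).
Local Notation clock := scaled_param.

Lemma derive_clock lambda (u : R) : is_derive u 1 (clock lambda) (lambda * rate u).
Proof.
rewrite /clock.
have h : is_derive u 1 (fun u => beta / 4 * u) (beta / 4).
  by apply: is_derive_eq; rewrite /GRing.scale /= mulr1.
have h2 := @is_derive1_comp R (@expR R) (fun u => beta / 4 * u) u _ _ (is_derive_expR _) h.
have h3 : is_derive u 1 (fun u => expR (beta / 4 * u)) (rate u).
  by have -> : rate u = expR (beta / 4 * u) * (beta / 4) by rewrite /drift_rate [RHS]mulrC.
by apply: is_derive_eq; rewrite /GRing.scale /=; ring.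
Qed.

(** The constant modes mc = 1, ms = 0 solve the system without drift. In terms of 1 - mc and - ms
    the drift therefore leaves a source of size |lambda| rate, whose primitive vanishing at -oo is
    [clock]. That [C] does not depend on lambda gives continuity of the intensity at 0. *)
Lemma mean_near_start k : exists2 C, 0 <= C & forall lambda a, regular lambda a ->
  forall u, (1 - mc a k u) ^+ 2 + ms a k u ^+ 2 <= C * clock `|lambda| u.
Proof.
case: k => [|k].
  exists 0 => // lambda a reg u; rewrite mc0 ms0 subrr expr0n /= addr0 mul0r //.
have [W [W0 h0 h1 h2 [W1 W2]]] := energy_weight_exists delta_gt0.
have S0 : 0 <= limn (series W).
  apply: limr_ge => //; apply: nearW => n; rewrite /series /= sumr_ge0 // => i _.
  exact: ltW.
exists (2 * 2 * limn (series W) * (k.+1%:R / W k)).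
  by rewrite !mulr_ge0 ?invr_ge0 // ltW.
move=> lambda a reg u.
pose x j v := 1 - mc a j v; pose y j v := - ms a j v.
have := @energy_le R W delta (ltW delta_gt0) (fun k => ltW (W0 k)) h0 h1 h2 W1 W2
  x y 2 (fun u => lambda * rate u) (fun u => - (lambda * rate u)) (fun u => `|lambda| * rate u)
  (clock `|lambda|).
move=> /(_ _ _ _ _ _ _ _ _ _ _ _ k u).
have -> : W k / k.+1%:R * (x k.+1 u ^+ 2 + y k.+1 u ^+ 2) <= 2 * 2 * limn (series W) * clock `|lambda| u =
   ((1 - mc a k.+1 u) ^+ 2 + ms a k.+1 u ^+ 2 <= 2 * 2 * limn (series W) * (k.+1%:R / W k) * clock `|lambda| u).
  rewrite -[X in _ = X](ler_pM2r (x := W k / k.+1%:R)) ?divr_gt0 //.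
  rewrite /x /y sqrrN; congr (_ <= _); first exact: mulrC.
  by field; rewrite nat1r pnatr_eq0 /= gt_eqF.
apply.
- by move=> v; rewrite /x mc0 subrr.
- by move=> v; rewrite /y ms0 oppr0.
- move=> j v; rewrite /x (le_trans (ler_normB _ _)) // normr1 -[leRHS]/(1 + 1) lerD2l.
  exact: (mean_cos_le1 reg).
- by move=> j v; rewrite /y normrN (le_trans (mean_cos_le1 reg _ _ _)) // ler1n.
- move=> j v; have h := derive_mc reg j v.
  by apply: is_derive_eq; rewrite /x /y; field.
- move=> j v; have h := derive_ms reg j v.
  by apply: is_derive_eq; rewrite /x /y; field.
- by move=> v; exact: derive_clock.
- by move=> v; rewrite normrN normrM (gtr0_norm (rate_gt0 v beta_gt0)).
- by move=> v; rewrite mulr_ge0 // ltW // expR_gt0.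
- move=> j v; rewrite -[X in _ --> X](subrr 1); apply: cvgB; first exact: cvg_cst.
  exact: (mc_start reg).
- by move=> j v; rewrite -oppr0; apply: cvgN; exact: (ms_start reg).
Qed.

(* Both families solve the same system with the same limit at -oo. *)
Lemma mean_scaling lambda a v a' : regular lambda a -> regular (clock lambda v) a' ->
  forall k u, mc a k (u + v) = mc a' k u /\ ms a k (u + v) = ms a' k u.
Proof.
move=> reg reg' k u.
have [W [W0 h0 h1 h2 [W1 W2]]] := energy_weight_exists delta_gt0.
case: k => [|k]; first by rewrite !mc0 !ms0.
pose x j u := mc a j (u + v) - mc a' j u; pose y j u := ms a j (u + v) - ms a' j u.
have rE z : lambda * rate (z + v) = clock lambda v * rate z.
  by rewrite /clock /drift_rate mulrDr expRD; ring.
have sh (f : R -> R) (l z : R) : is_derive (z + v) 1 f l -> is_derive z 1 (fun z => f (z + v)) l.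
  move=> hf; have h3 : is_derive z 1 (fun y => y + v) 1.
    by apply: is_derive_eq; rewrite addr0.
  by have := @is_derive1_comp R f (fun y => y + v) z _ _ hf h3; rewrite mulr1.
have := @energy_le R W delta (ltW delta_gt0) (fun k => ltW (W0 k)) h0 h1 h2 W1 W2
  x y 2 (fun u => clock lambda v * rate u) (fun=> 0) (fun=> 0) (fun=> 0).
move=> /(_ _ _ _ _ _ _ _ _ _ _ _ k u); rewrite mulr0.
have -> : (W k / k.+1%:R * (x k.+1 u ^+ 2 + y k.+1 u ^+ 2) <= 0) =
   (x k.+1 u ^+ 2 + y k.+1 u ^+ 2 <= 0).
  by rewrite pmulr_rle0 // divr_gt0.
move=> h; suff : x k.+1 u ^+ 2 + y k.+1 u ^+ 2 <= 0.
  move=> e; have : x k.+1 u ^+ 2 + y k.+1 u ^+ 2 == 0 by rewrite eq_le e addr_ge0 ?sqr_ge0.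
  rewrite paddr_eq0 ?sqr_ge0 // !sqrf_eq0 !subr_eq0 => /andP[/eqP -> /eqP ->] //.
apply: h.
- by move=> z; rewrite /x !mc0 subrr.
- by move=> z; rewrite /y !ms0 subrr.
- by move=> j z; rewrite /x (le_trans (ler_normB _ _)) // -[leRHS]/(1 + 1) lerD // (mean_cos_le1 reg, mean_cos_le1 reg').
- by move=> j z; rewrite /y (le_trans (ler_normB _ _)) // -[leRHS]/(1 + 1) lerD // (mean_cos_le1 reg, mean_cos_le1 reg').
- move=> j z; have e1 := sh _ _ _ (derive_mc reg j (z + v)); have e2 := derive_mc reg' j z.
  by apply: is_derive_eq; rewrite rE /x /y; field.
- move=> j z; have e1 := sh _ _ _ (derive_ms reg j (z + v)); have e2 := derive_ms reg' j z.
  by apply: is_derive_eq; rewrite rE /x /y; field.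
- by move=> z; rewrite normr0.
- by [].
- move=> j z; rewrite -[X in _ --> X](subrr 1); apply: cvgB; last exact: (mc_start reg').
  by under eq_fun do rewrite addrAC; exact: (mc_start reg).
- move=> j z; rewrite -[X in _ --> X](subrr 0); apply: cvgB; last exact: (ms_start reg').
  by under eq_fun do rewrite addrAC; exact: (ms_start reg).
Qed.

End solution_moments.

Section integrability.
Context {R : realType} {d : measure_display} {T : measurableType d}.
Variables (P : probability T R) (Z : R -> T -> R[i]).
Hypothesis CBM : two_sided_complex_BM P Z.
Variables (beta delta : R).
Hypotheses (beta_gt0 : 0 < beta) (delta_gt0 : 0 < delta).
Local Notation rate := (drift_rate beta).
Local Notation clock := (scaled_param beta).
Variables (lambda : R) (a : R -> T -> R).
Hypothesis reg : regular_solution P Z beta delta lambda a.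

Let ma u : measurable_fun setT (a u). Proof. exact: (reg_measurable reg). Qed.

(** [mean_near_start] bounds (1 - E cos a)^2 by a multiple of e^{beta u/4}. Hence 1 - E cos a is of
    order e^{beta u/8}, and [incr_L1] takes one more root, which explains beta / 16. The summand 1
    in [D] ensures D <= D^4. *)
Let unit_step U : exists2 K, 0 <= K & forall t, t <= U ->
  L1 P (fun w => a t w - a (t - 1) w) /\
  Ex P (fun w => `|a t w - a (t - 1) w|) <= K * expR (beta / 16 * t).
Proof.
have [C C0 hC] := mean_near_start CBM beta_gt0 delta_gt0 1.
pose D := C * `|lambda| + 1.
have D1 : 1 <= D by rewrite lerDr mulr_ge0.
have D0 : 0 < D by exact: lt_le_trans D1.
have b16 : 0 < beta / 16 by rewrite divr_gt0.
pose e u := D * expR (beta / 16 * u).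
have e0 u : 0 < e u by rewrite mulr_gt0 ?expR_gt0.
have he u : Ex P (fun w => 1 - cos (a u w)) <= e u ^+ 2.
  have -> : Ex P (fun w => 1 - cos (a u w)) = 1 - mc P a 1 u.
    rewrite mcE ExB; [|exact: L1_cst|]; last first.
      apply: (@L1_bounded _ _ _ _ _ 1); first exact: (measurableT_comp measurable_cosR).
      by move=> w; exact: cos_max.
    by rewrite Ex_cst; congr (_ - _); apply: eq_Ex => w; rewrite mul1r.
  have h := hC lambda a reg u.
  have h4 : (1 - mc P a 1 u) ^+ 2 <= (e u ^+ 2) ^+ 2.
    apply: (@le_trans _ _ (C * clock `|lambda| u)).
      by apply: le_trans h; rewrite lerDl sqr_ge0.
    rewrite /scaled_param mulrA /e -exprM exprMn -expRM_natl.
    have -> : (2 * 2)%:R * (beta / 16 * u) = beta / 4 * u by rewrite natrM; field.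
    rewrite ler_pM2r ?expR_gt0 //.
    apply: (@le_trans _ _ D); first by rewrite lerDl.
    by rewrite ler_eXnr.
  rewrite -ler_sqr ?nnegrE // ?exprn_ge0 // ?(ltW (e0 u)) //.
  by rewrite subr_ge0; have := mean_cos_le1 (P := P) reg 1 0 u; rewrite ler_norml => /andP[].
pose K := `|lambda| * (beta / 4 * expR (3 * (beta / 16) * U)) + (2 * delta + 5) * D.
have K0 : 0 <= K.
  have b4 : 0 <= beta / 4 by rewrite divr_ge0 // ltW.
  have d5 : 0 <= 2 * delta + 5 by rewrite addr_ge0 // mulr_ge0 // ltW.
  apply: addr_ge0; apply: mulr_ge0 => //; last exact: ltW.
  by apply: mulr_ge0 => //; exact: expR_ge0.
exists K => // t tU.
have [||u ut|l h] := incr_L1 beta_gt0 (ltW delta_gt0) reg (s := t - 1) (t := t) _ _ (e0 t).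
- by rewrite gerBl.
- by rewrite subrK.
- move: ut => /andP[_ ut]; apply: (le_trans (he u)); rewrite lerXn2r ?nnegrE ?(ltW (e0 _)) //.
  by rewrite ler_pM2l // ler_expR ler_pM2l.
split => //; apply: (le_trans h).
rewrite /K [leRHS]mulrDl; apply: lerD; last by rewrite /e mulrA.
rewrite -[leRHS]mulrA ler_wpM2l // /drift_rate -[leRHS]mulrA ler_pM2l ?divr_gt0 // -expRD ler_expR.
have -> : beta / 4 * t = 3 * (beta / 16) * t + beta / 16 * t by field.
by rewrite lerD2r ler_wpM2l // mulr_ge0 // ltW.
Qed.

(** As a (t - n) tends to 0 almost surely, |a t| is at most the sum of the absolute unit increments
    before [t], whose means are dominated by a geometric series of ratio e^{-beta/16}. *)
Lemma solution_L1 U : exists2 K, 0 <= K & forall t, t <= U ->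
  L1 P (a t) /\ Ex P (fun w => `|a t w|) <= K * expR (beta / 16 * t).
Proof.
have [K K0 hK] := unit_step U.
pose q := expR (- (beta / 16)).
have b16 : 0 < beta / 16 by rewrite divr_gt0.
have q0 : 0 < q by exact: expR_gt0.
have q1 : q < 1 by rewrite expR_lt1 oppr_lt0.
have q1' : 0 < 1 - q by rewrite subr_gt0.
exists (K / (1 - q)); first by rewrite divr_ge0 // ltW.
move=> t tU.
pose g j w := `|a (t - j%:R) w - a (t - j%:R - 1) w|.
have g0 j w : 0 <= g j w by exact: normr_ge0.
have tj j : t - j%:R <= U by rewrite (le_trans _ tU) // gerBl.
have lg j : L1 P (g j) by apply: L1_norm; exact: (hK _ (tj j)).1.
have eg j : Ex P (g j) <= K * expR (beta / 16 * t) * q ^+ j.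
  apply: (le_trans (hK _ (tj j)).2).
  have -> : expR (beta / 16 * (t - j%:R)) = expR (beta / 16 * t) * q ^+ j.
    by rewrite /q -expRM_natl -expRD; congr expR; ring.
  by rewrite mulrA.
have mg j : measurable_fun setT (fun w => (g j w)%:E) by exact: measurable_int (lg j).
have geom n : \sum_(j < n) q ^+ j <= (1 - q)^-1.
  rewrite -[leRHS]mul1r ler_pdivlMr //.
  have -> : (\sum_(j < n) q ^+ j) * (1 - q) = 1 - q ^+ n.
    elim: n => [|n ih]; first by rewrite big_ord0 mul0r expr0 subrr.
    by rewrite big_ord_recr /= mulrDl ih exprS; ring.
  by rewrite gerBl exprn_ge0 // ltW.
have ig : (\int[P]_w (\sum_(j <oo) (g j w)%:E) <= (K / (1 - q) * expR (beta / 16 * t))%:E)%E.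
  rewrite integral_nneseries //; last by move=> n w _; rewrite lee_fin.
  apply: lime_le.
    by apply: is_cvg_nneseries => n _ _; apply: integral_ge0 => w _; rewrite lee_fin.
  apply: nearW => n /=.
  apply: (@le_trans _ _ (\sum_(0 <= j < n) (K * expR (beta / 16 * t) * q ^+ j)%:E)%E).
    apply: lee_sum => j _.
    by rewrite -(ExE (lg j)) lee_fin; exact: eg.
  rewrite sumEFin lee_fin big_mkord -mulr_sumr.
  rewrite [leRHS](_ : _ = K * expR (beta / 16 * t) * (1 - q)^-1); last by ring.
  by rewrite ler_wpM2l // mulr_ge0 // expR_ge0.
have bound : {ae P, forall w, (`|a t w|%:E <= \sum_(j <oo) (g j w)%:E)%E}.
  apply: filterS (cvg_start reg t) => w hw.
  have part n : (`|a t w|%:E <= `|a (t - n%:R) w|%:E + \sum_(j <oo) (g j w)%:E)%E.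
    apply: (@le_trans _ _ (`|a (t - n%:R) w|%:E + \sum_(0 <= j < n) (g j w)%:E)%E); last first.
      rewrite leeD2l //; apply: nneseries_lim_ge => j _ _; by rewrite lee_fin.
    rewrite sumEFin -EFinD lee_fin.
    elim: n => [|n ih]; first by rewrite subr0 big_geq // addr0.
    apply: (le_trans ih); rewrite big_nat_recr //= addrA addrAC lerD2r /g.
    have -> : t - n.+1%:R = t - n%:R - 1 by rewrite -natr1; ring.
    have := ler_normD (a (t - n%:R - 1) w) (a (t - n%:R) w - a (t - n%:R - 1) w).
    by rewrite subrKC.
  have h0 : (`|a (t - n%:R) w|%:E + \sum_(j <oo) (g j w)%:E)%E @[n --> \oo] -->
      (0 + \sum_(j <oo) (g j w)%:E)%E.
    apply: cvgeD; last exact: cvg_cst.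
      by rewrite fin_num_adde_defr.
    apply: cvg_EFin; first exact: nearW.
    by rewrite -(normr0 R); apply: cvg_norm.
  rewrite add0e in h0.
  rewrite -(cvg_lim _ h0) //; apply: lime_ge; first by apply/cvg_ex; eexists; exact: h0.
  exact: nearW.
have mS : measurable_fun setT (fun w => \sum_(j <oo) (g j w)%:E)%E.
  apply: ge0_emeasurable_sum => //; by move=> j w _ _; rewrite lee_fin.
have [|||l h] := @Ex_le_int _ _ _ P (fun w => `|a t w|) (K / (1 - q) * expR (beta / 16 * t)).
- by apply: measurableT_comp.
- by [].
- apply: le_trans ig; apply: ae_ge0_le_integral => //.
  + by apply/measurable_EFinP; apply: measurableT_comp.
  + by move=> w _; apply: nneseries_ge0 => j _ _; rewrite lee_fin.
  + by apply: filterS bound => w h _.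
split => //.
by apply: L1_le l _ => // w; exact: ler_norm.
Qed.

Lemma L1_solution u : L1 P (a u).
Proof. by have [K _ h] := solution_L1 u; exact: (h u (lexx u)).1. Qed.

Lemma derive_mean (u : R) : is_derive u 1 (fun u => Ex P (a u))
  (lambda * rate u - delta * ms P a 1 u).
Proof.
move: u; apply: derive_of_estimate.
  move=> u; apply: cvgB; apply: cvgM; try exact: cvg_cst.
    exact: continuous_rate.
  have cm : continuous (ms P a 1) := continuous_mean_cos beta_gt0 delta_gt0 reg (k := 1%:R) (c := - (pi / 2)).
  exact: cm.
move=> U; have [C C0 hC] := mean_step beta_gt0 (ltW delta_gt0) reg U.
exists C => // s t st ts1 tU; have := hC s t st ts1 tU.
rewrite ExB; [|exact: L1_solution|exact: L1_solution].
have ls : L1 P (fun w => sin (a s w)).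
  apply: (@L1_bounded _ _ _ _ _ 1); first exact: (measurableT_comp measurable_sinR).
  by move=> w; exact: sin_max.
rewrite ExB; [|exact: L1_cst|exact: L1Z].
rewrite Ex_cst ExZ //.
have -> // : ms P a 1 s = Ex P (fun w => sin (a s w)).
by rewrite msE; apply: eq_Ex => w; rewrite mul1r.
Qed.

End integrability.

Section mean_lsum.
Context {R : realType} {d : measure_display} {T : measurableType d}.
Variables (P : probability T R) (delta : R).
Hypothesis delta_gt0 : 0 < delta.

(** The bound [tail] is uniform in the sample point, so the partial sums also approximate in
    mean. *)
Lemma Ex_lsum (v : nat -> T -> R) : (forall k, measurable_fun setT (v k)) ->
  (forall k w, `|v k w| <= 1) ->
  L1 P (fun w => lsum delta (v ^~ w)) /\
  Ex P (fun w => lsum delta (v ^~ w)) = lsum delta (fun k => Ex P (v k)).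
Proof.
move=> mv v1.
have lv k : L1 P (v k) by exact: (@L1_bounded _ _ _ _ _ 1).
have lp K : L1 P (fun w => psum delta (v ^~ w) K).
  by apply: L1_sum => k; exact: L1Z.
have Ev1 k : `|Ex P (v k)| <= 1.
  rewrite (le_trans (Ex_norm_le (lv k))) // -[leRHS](@Ex_cst _ _ _ P); apply: Ex_le => //.
    exact: L1_norm.
  exact: L1_cst.
have ml : measurable_fun setT (fun w => lsum delta (v ^~ w)).
  apply: (@measurable_fun_cvg _ _ _ setT (fun K w => psum delta (v ^~ w) K)).
    by move=> K; exact: L1_measurable (lp K).
  by move=> w _; apply: psum_cvg.
have ll : L1 P (fun w => lsum delta (v ^~ w)).
  apply: (@L1_bounded _ _ _ _ _ (tail delta 0)) => // w.
  have := @lsum_tail R delta delta_gt0 (v ^~ w) 0 (v1 ^~ w).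
  by rewrite /psum big_ord0 subr0.
split => //.
have c1 := @psum_cvg R delta delta_gt0 (fun k => Ex P (v k)) Ev1.
suff c2 : psum delta (fun k => Ex P (v k)) K @[K --> \oo] --> Ex P (fun w => lsum delta (v ^~ w)).
  exact: (cvg_unique _ c2 c1).
apply/cvgrPdist_le => e e0; have /cvgrPdist_le /(_ _ e0) := tail_cvg delta_gt0.
apply: filterS => K; rewrite sub0r normrN => h.
have -> : psum delta (fun k => Ex P (v k)) K = Ex P (fun w => psum delta (v ^~ w) K).
  rewrite /psum Ex_sum; last by move=> k; exact: L1Z.
  by apply: eq_bigr => k _; rewrite ExZ.
rewrite -ExB // (le_trans (Ex_norm_le (L1B ll (lp K)))) //.
rewrite -[leRHS](@Ex_cst _ _ _ P); apply: Ex_le.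
- by apply: L1_norm; exact: L1B.
- exact: L1_cst.
- move=> w; apply: le_trans (le_trans (ler_norm _) h); exact: lsum_tail.
Qed.

End mean_lsum.

(** * The mean of [Theta_cdf] along a solution and the intensity *)

Section intensity.
Context {R : realType} {d : measure_display} {T : measurableType d}.
Variables (P : probability T R) (Z : R -> T -> R[i]).
Hypothesis CBM : two_sided_complex_BM P Z.
Variables (beta delta : R).
Hypotheses (beta_gt0 : 0 < beta) (delta_gt0 : 0 < delta).
Local Notation rate := (drift_rate beta).
Local Notation clock := (scaled_param beta).
Variable a : R -> R -> T -> R.
Hypothesis reg : forall lambda, regular_solution P Z beta delta lambda (a lambda).
Local Notation pi := (@pi R).
Local Notation S := (Theta_density delta).
Local Notation Tc := (Theta_cdf delta).
Local Notation mu := (@lebesgue_measure R).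

Let ma lambda u : measurable_fun setT (a lambda u).
Proof. exact: (reg_measurable (reg lambda)). Qed.

Let pi_neq0 : pi != 0. Proof. by rewrite gt_eqF // pi_gt0. Qed.

Let pi_inv_ge0 : 0 <= 1 / pi. Proof. by rewrite divr_ge0 // pi_ge0. Qed.

Definition level_density lambda u : R :=
  1 / (2 * pi) + 1 / pi * lsum delta (fun k => mc P (a lambda) k u).

Definition intensity x : R := level_density x 0.

Definition level_mean lambda u : R := Ex P (fun w => Tc (a lambda u w)).

Let mc1 lambda u k : `|mc P (a lambda) k u| <= 1.
Proof. exact: (mean_cos_le1 (reg lambda)). Qed.

Let ms1 lambda u k : `|ms P (a lambda) k u| <= 1.
Proof. exact: (mean_cos_le1 (reg lambda)). Qed.

Let msk lambda u k : `|ms P (a lambda) k u / k%:R| <= 1.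
Proof.
case: k => [|k]; first by rewrite invr0 mulr0 normr0.
rewrite normrM normfV normr_nat ler_pdivrMr // mul1r (le_trans (ms1 _ _ _)) //.
by rewrite ler1n.
Qed.

Lemma level_densityE lambda u :
  L1 P (fun w => S (a lambda u w)) /\ level_density lambda u = Ex P (fun w => S (a lambda u w)).
Proof.
have [||l e] := @Ex_lsum _ _ _ P delta delta_gt0 (fun k w => cos (k%:R * a lambda u w)).
- by move=> k; apply: (measurableT_comp measurable_cosR); exact: measurable_funM.
- by move=> k w; exact: cos_max.
have l2 := L1Z (1 / pi) l.
split; first by apply: L1D => //; exact: L1_cst.
rewrite /level_density /Theta_density ExD //; last exact: L1_cst.
rewrite Ex_cst ExZ // e; congr (_ + _ * lsum delta _).
by apply/funext => k; rewrite mcE.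
Qed.

Lemma level_meanE lambda u : L1 P (fun w => Tc (a lambda u w)) /\
  level_mean lambda u = Ex P (a lambda u) / (2 * pi) +
     1 / pi * lsum delta (fun k => ms P (a lambda) k u / k%:R).
Proof.
have [||l e] := @Ex_lsum _ _ _ P delta delta_gt0 (fun k w => sin (k%:R * a lambda u w) / k%:R).
- move=> k; apply: measurable_funM => //.
  by apply: (measurableT_comp measurable_sinR); exact: measurable_funM.
- by move=> k w; exact: sin_div_le1.
have la := L1_solution CBM beta_gt0 delta_gt0 (reg lambda) u.
have l1 : L1 P (fun w => a lambda u w / (2 * pi)).
  have := L1Z (2 * pi)^-1 la; by under eq_fun do rewrite mulrC.
have l2 := L1Z (1 / pi) l.
split; first exact: L1D.
rewrite /level_mean /Theta_cdf ExD // ExZ // e; congr (_ + _ * lsum delta _).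
  rewrite [RHS]mulrC -ExZ //; apply: eq_Ex => w; exact: mulrC.
apply/funext => k; rewrite msE mulrC -ExZ; first by apply: eq_Ex => w; exact: mulrC.
apply: (@L1_bounded _ _ _ _ _ 1); last by move=> w; exact: sin_max.
by apply: (measurableT_comp measurable_sinR); exact: measurable_funM.
Qed.

Let cmc lambda k : continuous (mc P (a lambda) k).
Proof. exact: (continuous_mean_cos beta_gt0 delta_gt0 (reg lambda) (k := k%:R) (c := 0)). Qed.

Let tailc (c : R) : c * tail delta K @[K --> \oo] --> (0 : R).
Proof.
have : c * tail delta K @[K --> \oo] --> (c * 0 : R).
  by apply: cvgM; [exact: cvg_cst|exact: tail_cvg].
by rewrite mulr0.
Qed.

Let part K (v : nat -> R) : R := 1 / (2 * pi) + 1 / pi * psum delta v K.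

Let part_tail K v : (forall k, `|v k| <= 1) ->
  `|1 / (2 * pi) + 1 / pi * lsum delta v - part K v| <= 1 / pi * tail delta K.
Proof.
move=> v1; rewrite /part opprD addrACA subrr add0r -mulrBr normrM (ger0_norm pi_inv_ge0).
by rewrite ler_wpM2l //; exact: lsum_tail.
Qed.

Let continuous_part K (v : nat -> R -> R) : (forall k, continuous (v k)) ->
  continuous (fun u => part K (v ^~ u)).
Proof.
move=> cv u; apply: cvgD; first exact: cvg_cst.
apply: cvgM; first exact: cvg_cst.
rewrite /psum; elim: K => [|K ih].
  by under eq_fun do rewrite big_ord0; rewrite big_ord0; exact: cvg_cst.
under eq_fun do rewrite big_ord_recr.
rewrite big_ord_recr; apply: cvgD => //; apply: cvgM; first exact: cvg_cst.
exact: cv.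
Qed.

Let lsum_continuous (v : nat -> R -> R) : (forall k, continuous (v k)) ->
  (forall k u, `|v k u| <= 1) ->
  continuous (fun u => 1 / (2 * pi) + 1 / pi * lsum delta (v ^~ u)).
Proof.
move=> cv v1.
apply: (@uniform_limit_continuous_seq R (fun K u => part K (v ^~ u)) _ (fun K => 1 / pi * tail delta K)).
- by move=> K; exact: continuous_part.
- exact: tailc.
- by move=> K u; apply: part_tail => k.
Qed.

Lemma derive_level_mean lambda (u : R) :
  is_derive u 1 (level_mean lambda) (lambda * rate u * level_density lambda u).
Proof.
pose HK K u := Ex P (a lambda u) / (2 * pi) +
   1 / pi * psum delta (fun k => ms P (a lambda) k u / k%:R) K.
pose A u := mc P (a lambda) ^~ u; pose B u := ms P (a lambda) ^~ u.
(* The derivative of the truncated series: the drift in lambda plus the boundary term left by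
   [rising_ratio_telescope]. *)
pose dHK K u := lambda * rate u * part K (A u) +
   1 / pi * (2^-1 * ((K%:R - delta) * rising_ratio delta K) * (B u K.+1 - B u K)).
apply: (@derive_locally_uniform_limit R (level_mean lambda)
  (fun u => lambda * rate u * level_density lambda u) HK dHK).
- move=> K v.
  have hm := derive_mean CBM beta_gt0 delta_gt0 (reg lambda) v.
  have tel := @rising_ratio_telescope R delta delta_gt0 (B v) K (ms0 _ _ _).
  have hs : is_derive v 1 (\sum_(k < K) (fun u => rising_ratio delta k.+1 * (ms P (a lambda) k.+1 u / k.+1%:R)))
     (\sum_(k < K) rising_ratio delta k.+1 * ((k.+1%:R * (lambda * rate v) * mc P (a lambda) k.+1 v - k.+1%:R ^+ 2 * ms P (a lambda) k.+1 v
   + k.+1%:R * (k.+1%:R + delta) / 2 * ms P (a lambda) k v + k.+1%:R * (k.+1%:R - delta) / 2 * ms P (a lambda) k.+2 v) / k.+1%:R)).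
    apply: is_derive_sum => k; have hk := derive_ms CBM beta_gt0 delta_gt0 (reg lambda) k v.
    by apply: is_derive_eq; rewrite /GRing.scale /=; ring.
  have -> : HK K = fun u => (2 * pi)^-1 * Ex P (a lambda u) + 1 / pi * (\sum_(k < K) (fun u => rising_ratio delta k.+1 * (ms P (a lambda) k.+1 u / k.+1%:R))) u.
    by apply/funext => z; rewrite fct_sumE mulrC.
  apply: is_derive_eq; rewrite /GRing.scale /= /dHK -tel /part /psum.
  have -> : \sum_(k < K) rising_ratio delta k.+1 * ((k.+1%:R * (lambda * rate v) * mc P (a lambda) k.+1 v - k.+1%:R ^+ 2 * ms P (a lambda) k.+1 v
   + k.+1%:R * (k.+1%:R + delta) / 2 * ms P (a lambda) k v + k.+1%:R * (k.+1%:R - delta) / 2 * ms P (a lambda) k.+2 v) / k.+1%:R) =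
   lambda * rate v * (\sum_(k < K) rising_ratio delta k.+1 * A v k.+1) +
   \sum_(k < K) rising_ratio delta k.+1 * (- (k.+1%:R * B v k.+1) + (k.+1%:R - delta) / 2 * B v k.+2 + (k.+1%:R + delta) / 2 * B v k).
    rewrite mulr_sumr -big_split /=; apply: eq_bigr => k _.
    have : (k.+1%:R : R) != 0 by rewrite pnatr_eq0.
    rewrite /A /B; move: (k.+1%:R : R) => n n0; by field.
  rewrite -/(B v 1%N); move: pi_neq0; move: (trigo.pi) (bigop _ _ _) (bigop _ _ _) => p b1 b2 p0.
  by field.
- move=> v; rewrite (level_meanE lambda v).2; apply: cvgD; first exact: cvg_cst.
  by apply: cvgM; [exact: cvg_cst|apply: psum_cvg].
- move=> U; pose eK K := `|lambda| * rate U * (1 / pi * tail delta K) +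
     `|1 / pi * ((K%:R - delta) * rising_ratio delta K)|.
  exists eK.
    have [_ h1] := rising_ratio_summable delta_gt0.
    have h2 : `|1 / pi * ((K%:R - delta) * rising_ratio delta K)| @[K --> \oo] --> `|1 / pi * 0 : R|.
      by apply: cvg_norm; apply: cvgM => //; exact: cvg_cst.
    have h3 : `|lambda| * rate U * (1 / pi * tail delta K) @[K --> \oo] --> (`|lambda| * rate U * 0 : R).
      by apply: cvgM; [exact: cvg_cst|exact: tailc].
    by have := cvgD h3 h2; rewrite !mulr0 normr0 addr0; exact.
  move=> K v vU; rewrite /dHK opprD addrA -mulrBr (le_trans (ler_normB _ _)) //; apply: lerD.
    rewrite normrM; apply: ler_pM => //; last by apply: part_tail.
    by rewrite normrM (gtr0_norm (rate_gt0 v beta_gt0)) ler_wpM2l // rate_le.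
  rewrite [X in `|X|](_ : _ = 1 / pi * ((K%:R - delta) * rising_ratio delta K) * (2^-1 * (B v K.+1 - B v K))); last first.
    by move: pi_neq0; move: (trigo.pi) => p p0; field.
  rewrite normrM ler_piMr // normrM ger0_norm // mulrC ler_pdivrMr // mul1r.
  rewrite (le_trans (ler_normB _ _)) // -[leRHS]/(1 + 1); apply: lerD; exact: ms1.
- move=> v; apply: cvgM.
    by apply: cvgM; [exact: cvg_cst|exact: continuous_rate].
  exact: (@lsum_continuous (fun k => mc P (a lambda) k)).
Qed.

Lemma level_density_clock lambda u : level_density lambda u = intensity (clock lambda u).
Proof.
rewrite /intensity /level_density; congr (_ + _ * lsum delta _); apply/funext => k.
have [h _] := mean_scaling CBM beta_gt0 delta_gt0 (reg lambda) (reg (clock lambda u)) k 0.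
by rewrite -h add0r.
Qed.

(** Near x <> 0 write y = x e^{beta tau/4} with tau = (4 / beta) ln (y / x): by [mean_scaling],
    continuity in the parameter becomes continuity in time of the moments for the fixed parameter x.
    At 0 the bound of [mean_near_start], uniform in the parameter, takes over. *)
Lemma continuous_intensity : continuous intensity.
Proof.
apply: (@lsum_continuous (fun k x => mc P (a x) k 0)) => // k x.
have [->|x0] := eqVneq x 0.
  have [C C0 hC] := mean_near_start CBM beta_gt0 delta_gt0 k.
  have h y : (1 - mc P (a y) k 0) ^+ 2 <= C * `|y|.
    have := hC y (a y) (reg y) 0; rewrite /scaled_param mulr0 expR0 mulr1.
    by apply: le_trans; rewrite lerDl sqr_ge0.
  have e0 : mc P (a 0) k 0 = 1.
    apply/eqP; rewrite eq_sym -subr_eq0 -sqrf_eq0 eq_le sqr_ge0 andbT.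
    by have := h 0; rewrite normr0 mulr0.
  rewrite /continuous_at /= e0; apply/cvgrPdist_le => e ep.
  have d0 : 0 < e ^+ 2 / (C + 1) by rewrite divr_gt0 ?exprn_gt0 // ltr_wpDl.
  have /cvgrPdist_le /(_ _ d0) := @cvg_id _ (nbhs (0 : R)); apply: filterS => y.
  rewrite sub0r normrN => hy.
  rewrite -(ger0_norm (ltW ep)) -ler_sqr ?nnegrE // !real_normK ?num_real //.
  apply: (le_trans (h y)); apply: (@le_trans _ _ ((C + 1) * `|y|)).
    by rewrite ler_wpM2r // lerDl.
  by rewrite mulrC -ler_pdivlMr // ltr_wpDl.
pose tau y := 4 / beta * ln (y / x).
have eq_near : \forall y \near x, mc P (a y) k 0 = mc P (a x) k (tau y).
  have : \forall y \near x, 0 < y / x.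
    have c : (y / x) @[y --> x] --> x / x by apply: cvgM; [exact: cvg_id|exact: cvg_cst].
    rewrite divff // in c.
    have /cvgrPdist_lt /(_ _ ltr01) := c; apply: filterS => y.
    rewrite ltr_norml => /andP[_ h]; lra.
  apply: filterS => y hy.
  have cl : clock x (tau y) = y.
    rewrite /scaled_param /tau.
    have -> : beta / 4 * (4 / beta * ln (y / x)) = ln (y / x) by field; rewrite gt_eqF.
    by rewrite lnK ?posrE // mulrC divfK.
  have r' : regular_solution P Z beta delta (clock x (tau y)) (a y) by rewrite cl.
  have [h _] := mean_scaling CBM beta_gt0 delta_gt0 (reg x) r' k 0.
  by rewrite -h add0r.
have ct : mc P (a x) k (tau y) @[y --> x] --> mc P (a x) k (tau x).
  apply: (@cvg_comp _ _ _ tau (mc P (a x) k) (nbhs x) (nbhs (tau x))); last exact: cmc.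
  apply: cvgM; first exact: cvg_cst.
  apply: (@cvg_comp _ _ _ (fun y => y / x) (@ln R) (nbhs x) (nbhs (x / x))).
    by apply: cvgM; [exact: cvg_id|exact: cvg_cst].
  by rewrite divff //; apply: continuous_ln.
have ex : mc P (a x) k 0 = mc P (a x) k (tau x) by rewrite /tau divff // ln1 mulr0.
rewrite /continuous_at /= ex; apply: cvg_trans ct; apply: near_eq_cvg.
by apply: filterS eq_near => y ->.
Qed.

Lemma intensity_ge0 x : (forall y, 0 <= S y) -> 0 <= intensity x.
Proof. by move=> S0; rewrite /intensity (level_densityE x 0).2; apply: Ex_ge0. Qed.

(** [Theta_density] is bounded, so |Theta_cdf y| is at most a multiple of |y|, and the mean of |a|
    decays exponentially at -oo. *)
Lemma level_mean_start lambda : level_mean lambda (- n%:R) @[n --> \oo] --> (0 : R).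
Proof.
have [K K0 hK] := solution_L1 CBM beta_gt0 delta_gt0 (reg lambda) 0.
pose C := 1 / (2 * pi) + 1 / pi * tail delta 0.
have SC y : `|S y| <= C.
  rewrite (le_trans (ler_normD _ _)) // ger0_norm; last by rewrite divr_ge0 // mulr_ge0 // pi_ge0.
  rewrite lerD2l normrM (ger0_norm pi_inv_ge0) ler_wpM2l //.
  have := @lsum_tail R delta delta_gt0 (fun k => cos (k%:R * y)) 0 (fun k => cos_max _).
  by rewrite /psum big_ord0 subr0.
have TC y : `|Tc y| <= C * `|y|.
  by apply: (@mean_value_bound R Tc S C y (derive_Theta_cdf delta_gt0) (Theta_cdf0 delta)) => z _.
have C0 : 0 <= C by exact: le_trans (SC 0).
have b16 : 0 < beta / 16 by rewrite divr_gt0.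
have bd n : `|level_mean lambda (- n%:R)| <= C * (K * expR (- (beta / 16)) ^+ n).
  have nn : - n%:R <= 0 :> R by rewrite oppr_le0.
  have [l h] := hK _ nn.
  have lT := (level_meanE lambda (- n%:R)).1.
  rewrite /level_mean (le_trans (Ex_norm_le lT)) //.
  apply: (@le_trans _ _ (Ex P (fun w => C * `|a lambda (- n%:R) w|))).
    by apply: Ex_le; [exact: L1_norm|by apply: L1Z; exact: L1_norm|].
  rewrite ExZ; last exact: L1_norm.
  rewrite ler_wpM2l // (le_trans h) // -expRM_natl.
  by rewrite le_eqVlt; apply/orP; left; apply/eqP; congr (_ * expR _); ring.
have hq : C * (K * expR (- (beta / 16)) ^+ n) @[n --> \oo] --> (C * (K * 0) : R).
  apply: cvgM; first exact: cvg_cst.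
  apply: cvgM; first exact: cvg_cst.
  apply: cvg_expr; rewrite ger0_norm ?expR_ge0 // expR_lt1 oppr_lt0 //.
rewrite !mulr0 in hq.
apply/norm_cvg0P; apply: (@squeeze_cvgr _ _ _ _ (fun=> 0) (fun n => C * (K * expR (- (beta / 16)) ^+ n))) => //.
  by apply: nearW => n; rewrite normr_ge0 bd.
exact: cvg_cst.
Qed.

Lemma integral_intensity p q : p < q ->
  (\int[mu]_(x in `[p, q]) (intensity x)%:E = (level_mean q 0 - level_mean p 0)%:E)%E.
Proof.
move=> pq.
(* Strictly above |p| and |q|, so that for u <= 0 the clock stays in the open interval where [F] is
   differentiable, for either sign of lambda. *)
pose N := `|p| + `|q| + 1.
have N0 : 0 < N by rewrite ltr_wpDl // addr_ge0.
pose F x := \int[mu]_(t in `[- N, x]) intensity t.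
have iN : mu.-integrable `[- N, N] (EFin \o intensity).
  apply: continuous_compact_integrable; first exact: segment_compact.
  by apply: continuous_subspaceT; exact: continuous_intensity.
have dF (x : R) : - N < x -> x < N -> is_derive x 1 F (intensity x).
  move=> Nx xN; have [dFx eFx] := continuous_FTC1_closed xN iN Nx (@continuous_intensity x).
  by apply: DeriveDef; [exact: dFx|rewrite -derive1E; exact: eFx].
have level lambda : `|lambda| < N -> level_mean lambda 0 = F lambda - F 0.
  move=> lN.
  have cN u : u <= 0 -> - N < clock lambda u < N.
    move=> u0; rewrite -ltr_norml /scaled_param normrM (gtr0_norm (expR_gt0 _)).
    apply: le_lt_trans lN; rewrite ler_piMr // expR_le1 mulr_ge0_le0 // divr_ge0 // ltW //.
  (* Constant for u <= 0 by [derive_level_mean] and [level_density_clock], with limit - F 0 at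
     -oo. *)
  pose D u := level_mean lambda u - F (clock lambda u).
  have dD (u : R) : u <= 0 -> is_derive u 1 D 0.
    move=> u0; have h1 := derive_level_mean lambda u.
    have /andP[c1 c2] := cN u u0.
    have h2 := @is_derive1_comp R F (clock lambda) u _ _ (dF _ c1 c2) (derive_clock beta lambda u).
    have h3 : is_derive u 1 (fun u => F (clock lambda u)) (intensity (clock lambda u) * (lambda * rate u)) by exact: h2.
    by apply: is_derive_eq; rewrite level_density_clock; ring.
  have D0 n : D 0 = D (- n%:R).
    case: n => [|n]; first by rewrite oppr0.
    have n0 : - n.+1%:R < 0 :> R by rewrite oppr_lt0 ltr0n.
    have [||z _] := @MVT R D (fun=> 0) (- n.+1%:R) 0 n0.
    - by move=> z; rewrite in_itv /= => /andP[_ /ltW]; exact: dD.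
    - by apply: derivable_within_continuous => z; rewrite in_itv /= => /andP[_ /dD]; case.
    - by rewrite mul0r => /eqP; rewrite subr_eq0 => /eqP.
  have c0 : clock lambda (- n%:R) @[n --> \oo] --> (0 : R).
    have e n : clock lambda (- n%:R) = lambda * expR (- (beta / 4)) ^+ n.
      rewrite /scaled_param -expRM_natl; congr (_ * expR _); ring.
    under eq_fun do rewrite e.
    have : lambda * expR (- (beta / 4)) ^+ n @[n --> \oo] --> (lambda * 0 : R).
      apply: cvgM; first exact: cvg_cst.
      by apply: cvg_expr; rewrite ger0_norm ?expR_ge0 // expR_lt1 oppr_lt0 divr_gt0.
    by rewrite mulr0.
  have cF : {for 0, continuous F}.
    have h0 : is_derive (0 : R) 1 F (intensity 0) by apply: dF => //; rewrite oppr_lt0.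
    by apply: differentiable_continuous; apply/derivable1_diffP; case: h0.
  have lim : D (- n%:R) @[n --> \oo] --> 0 - F 0.
    apply: cvgB; first exact: level_mean_start.
    by apply: (@cvg_comp _ _ _ (fun n => clock lambda (- n%:R)) F _ (nbhs (0 : R))).
  have lim2 : D (- n%:R) @[n --> \oo] --> D 0.
    by under eq_fun do rewrite -D0; exact: cvg_cst.
  have : 0 - F 0 = D 0 by exact: (cvg_unique _ lim lim2).
  rewrite /D /scaled_param mulr0 expR0 mulr1 sub0r => e.
  by rewrite -[LHS](subrK (F lambda)) -e addrC.
have pN : `|p| < N by rewrite /N; have := normr_ge0 q; lra.
have qN : `|q| < N by rewrite /N; have := normr_ge0 p; lra.
rewrite (level p) // (level q) //.
have inN x : p <= x -> x <= q -> - N < x /\ x < N.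
  move: pN qN; rewrite !ltr_norml => /andP[h1 h2] /andP[h3 h4] h5 h6; split; lra.
have cFx x : p <= x -> x <= q -> {for x, continuous F}.
  move=> px xq; have [h1 h2] := inN x px xq.
  have h0 := dF x h1 h2.
  by apply: differentiable_continuous; apply/derivable1_diffP; case: h0.
rewrite (@continuous_FTC2 _ intensity F p q) //.
- by rewrite -EFinB; congr EFin; ring.
- by apply: continuous_subspaceT; exact: continuous_intensity.
- split.
  + move=> x; rewrite in_itv /= => /andP[/ltW px /ltW xq]; have [h1 h2] := inN x px xq.
    by case: (dF x h1 h2).
  + by apply: cvg_at_right_filter; apply: cFx => //; exact: ltW.
  + by apply: cvg_at_left_filter; apply: cFx => //; exact: ltW.
- move=> x; rewrite in_itv /= => /andP[/ltW px /ltW xq]; have [h1 h2] := inN x px xq.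
  by have dx := dF x h1 h2; rewrite derive1E (@derive_val _ _ _ _ _ _ _ dx).
Qed.

End intensity.

(** * The point process *)

Section measures_on_the_line.
Context {R : realType}.
Local Notation mu := (@lebesgue_measure R).

Lemma measure_eq_ocitv (m1 m2 : {measure set (measurableTypeR R) -> \bar R}) :
  (forall p q : R, p < q -> m1 (`]p, q]%classic : set R) = m2 (`]p, q]%classic : set R)) ->
  (forall p q : R, p < q -> (m1 (`]p, q]%classic : set R) < +oo)%E) ->
  forall A, measurable A -> m1 A = m2 A.
Proof.
move=> h12 hfin A mA.
apply: (@measure_unique _ R (measurableTypeR R) (@ocitv R) (fun k => `](- k.+1%:R), k.+1%:R]%classic)) => //.
- exact: ocitvI.
- by move=> i; exact: is_ocitv.
- apply/seteqP; split => // x _; exists (Num.trunc `|x|) => //=.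
  have h := truncnS_gt `|x|.
  by move: h; rewrite ltr_norml in_itv /= => /andP[-> /ltW ->].
- move=> _ [[p q] _ <-] /=; have [pq|qp] := ltP p q; first exact: h12.
  by rewrite set_itv_ge ?bnd_simp -?leNgt // !measure0.
- by move=> k; apply: hfin; rewrite (@lt_trans _ _ 0) ?oppr_lt0 ?ltr0Sn.
Qed.

Section density_measure.
Variables (f : R -> R) (mf : measurable_fun setT f) (f0 : forall x, 0 <= f x).

(** The two proofs are arguments of the definition so that the measure structure declared below is
    found by unification; likewise for [restricted_law]. *)
Definition density_measure (_ : measurable_fun setT f) (_ : forall x, 0 <= f x)
  (A : set (measurableTypeR R)) : \bar R := (\int[mu]_(x in A) (f x)%:E)%E.

Local Notation m := (density_measure mf f0).

Let m0 : m set0 = 0%E. Proof. exact: integral_set0. Qed.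

Let m_ge0 A : (0 <= m A)%E.
Proof. by apply: integral_ge0 => x _; rewrite lee_fin. Qed.

Let m_sigma_additive : semi_sigma_additive m.
Proof.
move=> F mF tF mU; rewrite /density_measure ge0_integral_bigcup //.
- apply: is_cvg_ereal_nneg_natsum_cond => n _ _.
  by apply: integral_ge0 => x _; rewrite lee_fin.
- by apply/measurable_EFinP; exact: measurable_funTS.
- by move=> x _; rewrite lee_fin.
Qed.

HB.instance Definition _ := isMeasure.Build _ _ _ m m0 m_ge0 m_sigma_additive.

End density_measure.

Section restricted_law.
Context {d : measure_display} {T : measurableType d}.
Variables (P : probability T R) (D : set T) (X : T -> R).
Variables (mD : measurable D) (mX : measurable_fun setT X).

Definition restricted_law (_ : measurable D) (_ : measurable_fun setT X)
  (A : set (measurableTypeR R)) : \bar R := P (D `&` X @^-1` A).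

Local Notation m := (restricted_law mD mX).

Let m0 : m set0 = 0%E. Proof. by rewrite /restricted_law preimage_set0 setI0. Qed.

Let m_ge0 A : (0 <= m A)%E. Proof. exact: measure_ge0. Qed.

Let mpre (A : set (measurableTypeR R)) : measurable A -> measurable (D `&` X @^-1` A).
Proof. by move=> mA; apply: measurableI => //; rewrite -[X in measurable X]setTI; exact: mX. Qed.

Let m_sigma_additive : semi_sigma_additive m.
Proof.
move=> F mF tF mU; rewrite /restricted_law preimage_bigcup setI_bigcupr.
apply: measure_semi_sigma_additive.
- by move=> n; exact: mpre.
- apply/trivIsetP => i j _ _ ij; rewrite setIACA setIid -preimage_setI.
  by move/trivIsetP : tF => /(_ _ _ _ _ ij) -> //; rewrite preimage_set0 setI0.
- by rewrite -setI_bigcupr -preimage_bigcup; exact: mpre.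
Qed.

HB.instance Definition _ := isMeasure.Build _ _ _ m m0 m_ge0 m_sigma_additive.

End restricted_law.

(** Sigma-additivity of the counting measure over the sets [F j], each a singleton or empty;
    injectivity makes them disjoint. *)
Lemma counting_points (B : nat -> bool) (x : nat -> R) :
  (forall i j, B i -> B j -> x i = x j -> i = j) ->
  (counting [set y | exists2 j, B j & x j = y] = \sum_(j <oo) (\1_[set k | B k] j)%:E :> \bar R)%E.
Proof.
move=> inj.
pose F j : set (measurableTypeR R) := [set y | B j /\ x j = y].
have mF j : measurable (F j).
  have [Bj|nB] := boolP (B j).
    by rewrite (_ : F j = [set x j]) ?measurable_set1 //; apply/seteqP; split => y /= => [[]|->].
  by rewrite (_ : F j = set0) //; apply/seteqP; split => y //= -[]; rewrite (negbTE nB).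
have -> : [set y | exists2 j, B j & x j = y] = \bigcup_j F j.
  by apply/seteqP; split => [y /= [j Bj e]|y [j _ [Bj e]]]; [exists j|exists j].
have tF : trivIset setT F.
  by move=> i j _ _ [y [[Bi ei] [Bj ej]]]; apply: inj => //; rewrite ei ej.
have h := @measure_semi_bigcup _ _ _ (@counting (measurableTypeR R) R) F mF tF (bigcupT_measurable _ mF).
rewrite h; apply: eq_eseriesr => j _.
have [Bj|nB] := boolP (B j).
  rewrite indicE mem_set //.
  rewrite (_ : F j = [set x j]); last by apply/seteqP; split => y /= => [[]|->].
  have c1 : @counting (measurableTypeR R) R [set x j] = 1%:E.
    by rewrite /counting asboolT // fset_set1 finmap.cardfs1.
  exact: c1.
rewrite indicE memNset /=; last exact/negP.
rewrite (_ : F j = set0); first by rewrite measure0.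
by apply/seteqP; split => y //= -[]; rewrite (negbTE nB).
Qed.

(* [g] need not be measurable: its integral is then a lower integral. *)
Lemma ge0_integral_ae_eq {d : measure_display} {T : measurableType d} (P : probability T R)
  (g h : T -> \bar R) : measurable_fun setT h -> (forall w, 0 <= h w)%E ->
  (forall w, 0 <= g w)%E -> {ae P, forall w, g w = h w} ->
  (\int[P]_w g w = \int[P]_w h w)%E.
Proof.
move=> mh h0 g0 [N0 [mN PN sN]].
have mono (u v : T -> \bar R) : (forall w, 0 <= u w)%E -> (forall w, 0 <= v w)%E ->
    (forall w, u w <= v w)%E -> (\int[P]_w u w <= \int[P]_w v w)%E.
  move=> u0 v0 uv; rewrite !ge0_integralTE //; apply: ge_ereal_sup => _ [q qu <-].
  by apply: ereal_sup_ubound; exists q => // w; exact: le_trans (qu w) (uv w).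
(* [g] is squeezed between two measurable functions that agree with [h] off the null set, where they
   are 0 and +oo. *)
pose lo w := (h w * (\1_(~` N0) w)%:E)%E.
pose up w := (h w + +oo * (\1_N0 w)%:E)%E.
have ghN w : ~ N0 w -> g w = h w by move=> nw; apply: contrapT => /sN.
have m1 (A : set T) : measurable A -> measurable_fun setT (fun w => (\1_A w)%:E : \bar R).
  by move=> mA; apply/measurable_EFinP; exact: measurable_indic.
have lo0 w : (0 <= lo w)%E by rewrite mule_ge0 // lee_fin.
have up0 w : (0 <= up w)%E by rewrite adde_ge0 // mule_ge0 // lee_fin.
have mlo : measurable_fun setT lo by apply: emeasurable_funM => //; apply: m1; exact: measurableC.
have mup : measurable_fun setT up.
  by apply: emeasurable_funD => //; apply: emeasurable_funM => //; exact: m1.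
have elo : (\int[P]_w lo w = \int[P]_w h w)%E.
  apply: ae_eq_integral => //; exists N0; split => // w /= nw; apply: contrapT => nN; apply: nw => _.
  by rewrite /lo indicE mem_set // mule1.
have eup : (\int[P]_w up w = \int[P]_w h w)%E.
  apply: ae_eq_integral => //; exists N0; split => // w /= nw; apply: contrapT => nN; apply: nw => _.
  by rewrite /up indicE memNset // mule0 adde0.
apply/eqP; rewrite eq_le; apply/andP; split.
  rewrite -eup; apply: mono => // w; rewrite /up indicE.
  have [Nw|nN] := pselect (N0 w); last by rewrite memNset // mule0 adde0 ghN.
  by rewrite mem_set // mule1 addey ?leey // gt_eqF // (lt_le_trans _ (h0 w)) // ltNy0.
rewrite -elo; apply: mono => // w; rewrite /lo indicE.
have [Nw|nN] := pselect (N0 w); last by rewrite mem_set // mule1 ghN.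
by rewrite memNset ?mule0 //; exact.
Qed.

End measures_on_the_line.

Section analytic.
Context {R : realType}.

(** At h0 = r / 2 the terms of the series are bounded by some M, so for |h| <= h0 / 2 the series
    without its constant term is at most M times a geometric series of ratio q = |h| / h0 <= 1/2. *)
Lemma real_analytic_continuous (f : R -> R) : real_analytic f -> continuous f.
Proof.
move=> fa x; have [c [r r0 hc]] := fa x.
pose h0 := r / 2.
have h00 : 0 < h0 by rewrite divr_gt0.
have h0r : `|h0| < r by rewrite gtr0_norm // /h0 ltr_pdivrMr // ltr_pMr // ltr1n.
have [M hM] : exists M, forall n, `|c n * h0 ^+ n| <= M.
  have cv : cvgn (series (fun n => c n * h0 ^+ n)) by apply/cvg_ex; eexists; exact: hc.
  have := cvg_series_bounded cv; move=> /pinfty_ex_gt0[M _ hM]; exists M => n.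
  exact: hM.
have M0 : 0 <= M by exact: le_trans (hM 0%N).
have fx : f x = c 0%N.
  have l1 := hc 0; rewrite normr0 addr0 in l1; have {}l1 := l1 r0.
  suff l2 : series (fun n => c n * 0 ^+ n) x @[x --> \oo] --> c 0%N.
    exact: (cvg_unique _ l1 l2).
  rewrite -(cvg_shiftS (series (fun n => c n * 0 ^+ n))).
  rewrite (_ : (fun n => _) = fun=> c 0%N); first exact: cvg_cst.
  apply/funext => n; rewrite /series /= big_nat_recl // expr0 mulr1 big1 ?addr0 // => i _.
  by rewrite expr0n mulr0.
have bound h : `|h| <= h0 / 2 -> `|f (x + h) - f x| <= M * 2 / h0 * `|h|.
  move=> hh; have hr : `|h| < r.
    by apply: le_lt_trans hh _; apply: le_lt_trans h0r; rewrite gtr0_norm // ler_pdivrMr // ler_pMr // ler1n.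
  have l1 := hc h hr.
  have l2 : `|series (fun n => c n * h ^+ n) n - c 0%N| @[n --> \oo] --> `|f (x + h) - c 0%N|.
    by apply: cvg_norm; apply: cvgB => //; exact: cvg_cst.
  rewrite fx; apply: (@cvgr_to_le _ _ _ _ _ _ _ l2); exists 1%N => // -[//|n] _ /=.
  rewrite /series /= big_nat_recl // expr0 mulr1 addrAC subrr add0r.
  pose q := `|h| / h0.
  have q0 : 0 <= q by rewrite divr_ge0 // ltW.
  have q2 : q <= 1 / 2 by rewrite ler_pdivrMr // mulrC mulrA mulr1.
  have term i : `|c i.+1 * h ^+ i.+1| <= M * q ^+ i.+1.
    have e : c i.+1 * h ^+ i.+1 = c i.+1 * h0 ^+ i.+1 * (h / h0) ^+ i.+1.
      by rewrite -mulrA -exprMn [h0 * _]mulrC divfK // gt_eqF.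
    have nq : `|h / h0| = q by rewrite normrM normfV (gtr0_norm h00).
    by rewrite e normrM (normrX i.+1 (h / h0)) nq ler_wpM2r ?exprn_ge0.
  apply: (@le_trans _ _ (\sum_(0 <= i < n) M * q ^+ i.+1)).
    by rewrite (le_trans (ler_norm_sum _ _ _)) //; apply: ler_sum => i _.
  rewrite -mulr_sumr -!mulrA ler_wpM2l //.
  have -> : 2 * (h0^-1 * `|h|) = 2 * q by rewrite [h0^-1 * _]mulrC.
  (* The extra term 2 q^(n+1) is what lets the induction go through. *)
  have geo : \sum_(0 <= i < n) q ^+ i.+1 + 2 * q ^+ n.+1 <= 2 * q.
    elim: n => [|n ih]; first by rewrite big_geq // add0r expr1.
    rewrite big_nat_recr //=; apply: le_trans ih; rewrite -addrA lerD2l.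
    have qn : 0 <= q ^+ n.+1 by rewrite exprn_ge0.
    by rewrite [q ^+ n.+2]exprS; nra.
  by apply: le_trans geo; rewrite lerDl mulr_ge0 // exprn_ge0.
apply/cvgrPdist_le => e e0.
pose K := M * 2 / h0 + 1.
have K0 : 0 < K by rewrite ltr_wpDl // divr_ge0 ?mulr_ge0 // ltW.
pose dd := Num.min (h0 / 2) (e / K).
have d0 : 0 < dd by rewrite lt_min !divr_gt0.
have /cvgrPdist_le /(_ _ d0) := @cvg_id _ (nbhs (x : R)); apply: filterS => y.
rewrite le_min distrC => /andP[h1 h2]; rewrite distrC.
have := bound _ h1; rewrite subrKC => h3; apply: (le_trans h3).
apply: (@le_trans _ _ (K * `|y - x|)); first by rewrite ler_wpM2r // lerDl.
by rewrite mulrC -ler_pdivlMr.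
Qed.

End analytic.

(** * Translates of the distribution function of Theta *)

Section shifted_distribution.
Context {R : realType}.
Variable delta : R.
Hypothesis delta_gt0 : 0 < delta.
Hypothesis density_ge0 : forall x, 0 <= Theta_density delta x.
Local Notation pi := (@pi R).
Local Notation S := (Theta_density delta).
Local Notation Tc := (Theta_cdf delta).
Local Notation mu := (@lebesgue_measure R).

Let p2 : 0 < 2 * pi. Proof. by rewrite mulr_gt0 // pi_gt0. Qed.

Definition clamp (z : R) : R := Num.max 0 (Num.min z (2 * pi)).

Definition Theta_dist (z : R) : R := Tc (clamp z).
Local Notation F := Theta_dist.

(** The enumeration 0, -1, 1, -2, 2, ...: its first 2 N values are the integers from - N to N - 1, a
    pairing on which [shifted_dist_sum] relies. *)
Definition nth_int (j : nat) : int := if odd j then Negz j./2 else Posz j./2.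

Lemma nth_int_inj : injective nth_int.
Proof.
move=> i j e; rewrite -(odd_double_half i) -(odd_double_half j); move: e.
by rewrite /nth_int; case: (odd i); case: (odd j) => // -[->].
Qed.

Lemma nth_int_surj (n : int) : exists j, nth_int j = n.
Proof.
case: n => k; [exists k.*2|exists k.*2.+1]; rewrite /nth_int /=.
  by rewrite odd_double doubleK.
by rewrite odd_double /= uphalf_double.
Qed.

Lemma continuous_Theta_cdf : continuous Tc.
Proof.
move=> x; have h := derive_Theta_cdf delta_gt0 x.
by apply: differentiable_continuous; apply/derivable1_diffP; case: h.
Qed.

Lemma Theta_cdf_le x y : x <= y -> Tc x <= Tc y.
Proof.
move=> xy; have := @derive_increment_le R (fun=> 0) Tc (fun=> 0) S x y.
rewrite subrr subr_ge0; apply => //.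
exact: derive_Theta_cdf.
Qed.

Lemma Theta_cdfDn z (k : nat) : Tc (z + 2 * pi * k%:R) = Tc z + k%:R.
Proof.
elim: k => [|k ih]; first by rewrite mulr0 !addr0.
have -> : z + 2 * pi * k.+1%:R = z + 2 * pi * k%:R + 2 * pi by rewrite -natr1; ring.
by rewrite Theta_cdfD2pi ih -natr1 addrA.
Qed.

Lemma Theta_cdfBn z (k : nat) : Tc (z - 2 * pi * k%:R) = Tc z - k%:R.
Proof. by rewrite -[in RHS](subrK (2 * pi * k%:R) z) Theta_cdfDn addrK. Qed.

Lemma Theta_cdf2pi : Tc (2 * pi) = 1.
Proof. by have := Theta_cdfDn 0 1; rewrite mulr1 add0r Theta_cdf0 add0r. Qed.

Lemma Theta_dist_le x y : x <= y -> F x <= F y.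
Proof.
move=> xy; apply: Theta_cdf_le; rewrite /clamp ge_max le_max lexx /= le_max.
by apply/orP; right; rewrite le_min !ge_min xy lexx orbT.
Qed.

Lemma Theta_dist0 z : z <= 0 -> F z = 0.
Proof.
move=> z0; rewrite /F /clamp min_l ?(le_trans z0) ?(ltW p2) // max_l //.
exact: Theta_cdf0.
Qed.

Lemma Theta_dist1 z : 2 * pi <= z -> F z = 1.
Proof. by move=> z1; rewrite /F /clamp min_r // max_r ?(ltW p2) // Theta_cdf2pi. Qed.

Lemma Theta_dist_mid z : 0 <= z -> z <= 2 * pi -> F z = Tc z.
Proof. by move=> z0 z1; rewrite /F /clamp min_l // max_r. Qed.

Let dS (k : nat) : 2 * pi * k.+1%:R = 2 * pi * k%:R + 2 * pi.
Proof. by rewrite -[k.+1%:R]natr1; ring. Qed.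

(** The full periods below [z] contribute 1 each, those above contribute 0, and the one containing
    [z] the value of [Theta_cdf] reduced to it. *)
Let pos_sum N z : 0 <= z -> z <= 2 * pi * N%:R ->
  \sum_(k < N) F (z - 2 * pi * k%:R) = Tc z.
Proof.
elim: N => [|N ih] z0 zN.
  rewrite big_ord0; have -> : z = 0 by apply/eqP; rewrite eq_le z0 andbT -(mulr0 (2 * pi)).
  by rewrite Theta_cdf0.
rewrite big_ord_recr /=; have [zN'|zN'] := leP z (2 * pi * N%:R).
  by rewrite ih // Theta_dist0 ?addr0 // subr_le0.
rewrite Theta_dist_mid ?subr_ge0 ?(ltW zN') //; last first.
  by rewrite lerBlDr addrC; move: zN; rewrite dS.
rewrite Theta_cdfBn (eq_bigr (fun=> 1)); first by rewrite sumr_const card_ord addrCA subrr addr0.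
move=> k _; apply: Theta_dist1; rewrite lerBrDr; apply: le_trans (ltW zN').
have : (k.+1%:R : R) <= N%:R by rewrite ler_nat.
rewrite -natr1; have := p2; move: (2 * pi) (k%:R : R) (N%:R : R) => p k' n' *; nra.
Qed.

Let neg_sum N z : z <= 0 -> - (2 * pi * N%:R) <= z ->
  \sum_(k < N) F (z + 2 * pi * k.+1%:R) = N%:R + Tc z.
Proof.
elim: N => [|N ih] z0 zN.
  rewrite big_ord0; have -> : z = 0 by apply/eqP; rewrite eq_le z0 -oppr0 -(mulr0 (2 * pi)).
  by rewrite Theta_cdf0 addr0.
rewrite big_ord_recr /=; have [zN'|zN'] := leP (- (2 * pi * N%:R)) z.
  rewrite ih // Theta_dist1; first by rewrite -natr1 addrAC.
  by move: zN'; rewrite dS => h; lra.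
rewrite Theta_dist_mid; last 2 first.
- by rewrite -lerBlDr sub0r.
- by move: zN'; rewrite dS => /ltW h; lra.
rewrite Theta_cdfDn big1 ?add0r; first by rewrite addrC.
move=> k _; apply: Theta_dist0.
have : (k.+1%:R : R) <= N%:R by rewrite ler_nat.
have := p2; move: zN'; move: (2 * pi) (k.+1%:R : R) (N%:R : R) => p k' n' *; nra.
Qed.

(* Theta_cdf increases by 1 over a period, so it is the sum of the translates of
   the distribution function of Theta, up to the constant N. *)
Lemma shifted_dist_sum N z : `|z| <= 2 * pi * N%:R ->
  \sum_(j < N.*2) F (z - 2 * pi * (nth_int j)%:~R) = N%:R + Tc z.
Proof.
move=> zN; have -> : \sum_(j < N.*2) F (z - 2 * pi * (nth_int j)%:~R) =
    \sum_(k < N) F (z - 2 * pi * k%:R) + \sum_(k < N) F (z + 2 * pi * k.+1%:R).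
  elim: N {zN} => [|N ih]; first by rewrite !big_ord0 addr0.
  rewrite doubleS 4!big_ord_recr /= ih.
  have -> : (nth_int N.*2)%:~R = N%:R :> R by rewrite /nth_int odd_double doubleK.
  have -> : (nth_int N.*2.+1)%:~R = - N.+1%:R :> R.
    by rewrite /nth_int /= odd_double /= uphalf_double NegzE mulrNz.
  by rewrite mulrN opprK; ring.
move: zN; rewrite ler_norml => /andP[h1 h2].
have [z0|z0] := leP 0 z.
  rewrite pos_sum // (eq_bigr (fun=> 1)); first by rewrite sumr_const card_ord addrC.
  move=> k _; apply: Theta_dist1; rewrite dS.
  have : 0 <= 2 * pi * k%:R by rewrite mulr_ge0 // ltW.
  by move: z0; lra.
rewrite neg_sum ?(ltW z0) // big1 ?add0r // => k _; apply: Theta_dist0.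
have : 0 <= 2 * pi * k%:R by rewrite mulr_ge0 // ltW.
by move: z0; lra.
Qed.

(** The constant N of [shifted_dist_sum] cancels in the difference, so the partial sums of even
    length 2 N are constant once 2 pi N exceeds |x| + |y|. The terms are nonnegative, so all later
    partial sums agree with these. *)
Lemma shifted_dist_series x y : x <= y ->
  (\sum_(j <oo) (F (y - 2 * pi * (nth_int j)%:~R) - F (x - 2 * pi * (nth_int j)%:~R))%:E =
   (Tc y - Tc x)%:E)%E.
Proof.
move=> xy; pose t j := F (y - 2 * pi * (nth_int j)%:~R) - F (x - 2 * pi * (nth_int j)%:~R).
have t0 j : 0 <= t j by rewrite subr_ge0 Theta_dist_le // lerD2r.
pose N0 := (Num.trunc ((`|x| + `|y|) / (2 * pi))).+1.
have big N : (N0 <= N)%N -> `|x| + `|y| <= 2 * pi * N%:R.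
  move=> N0N; rewrite mulrC -ler_pdivrMr //; apply: (@le_trans _ _ N0%:R); last by rewrite ler_nat.
  by apply: ltW; exact: truncnS_gt.
have even N : (N0 <= N)%N -> \sum_(j < N.*2) t j = Tc y - Tc x.
  move=> /big h; rewrite /t sumrB !shifted_dist_sum; first by ring.
    by rewrite (le_trans _ h) // lerDl.
  by rewrite (le_trans _ h) // lerDr.
have mono m n : (m <= n)%N -> \sum_(j < m) t j <= \sum_(j < n) t j.
  move=> mn; rewrite -!(big_mkord xpredT t) [leRHS](big_cat_nat _ mn) //= lerDl sumr_ge0 //.
have const n : (N0.*2 <= n)%N -> \sum_(j < n) t j = Tc y - Tc x.
  move=> h; apply/eqP; rewrite eq_le; apply/andP; split.
    have h2 : (n <= n.*2)%N by rewrite -addnn leq_addr.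
    rewrite -(even n); first exact: mono.
    by rewrite (leq_trans _ h) // -addnn leq_addr.
  by rewrite -(even N0) //; exact: mono.
apply/cvg_lim => //; apply: cvg_near_cst; exists N0.*2 => // n /= h.
by rewrite sumEFin big_mkord -/(t _) const.
Qed.

Lemma Theta_law_dist {d : measure_display} {T : measurableType d} (P : probability T R)
  (Theta : T -> R) z : Theta_law P delta Theta ->
  P [set w | Theta w <= z] = (F z)%:E.
Proof.
move=> law; have [mTheta _ hlaw] := law.
have [pdf _] := Theta_density_pdf delta_gt0 law.
have FTC c : 0 < c -> (\int[mu]_(x in `]0%R, c[) (S x)%:E = (Tc c)%:E)%E.
  move=> c0; have cS := continuous_Theta_density delta_gt0.
  have mS : measurable_fun setT S by exact: continuous_measurable_fun.
  rewrite -(@integral_itv_bndoo _ 0 c _ true false); last first.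
    by apply/measurable_EFinP; exact: measurable_funTS.
  rewrite (@continuous_FTC2 _ S Tc) //.
  - by rewrite Theta_cdf0 sube0.
  - exact: continuous_subspaceT.
  - split; first by move=> x _; have h := derive_Theta_cdf delta_gt0 x; case: h.
      by apply: cvg_at_right_filter; exact: continuous_Theta_cdf.
    by apply: cvg_at_left_filter; exact: continuous_Theta_cdf.
  - by move=> x _; have dx := derive_Theta_cdf delta_gt0 x; rewrite derive1E (@derive_val _ _ _ _ _ _ _ dx).
have itv c b0 b1 : 0 < c -> c <= 2 * pi ->
    (\int[mu]_(x in [set` Interval (BSide b0 0%R) (BSide b1 c)]) (Theta_pdf delta x)%:E = (Tc c)%:E)%E.
  move=> c0 c1.
  have inI x : x \in (`]0%R, c[%classic : set R) -> 0 < x < 2 * pi.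
    by rewrite inE /= in_itv /= => /andP[-> h]; rewrite (lt_le_trans h).
  rewrite integral_itv_bndoo; last first.
    apply: (eq_measurable_fun (fun x => (S x)%:E)).
      by move=> x /inI hx; rewrite pdf.
    apply/measurable_EFinP; apply: measurable_funTS; apply: continuous_measurable_fun.
    exact: continuous_Theta_density.
  by rewrite -FTC //; apply: eq_integral => x /inI hx; rewrite pdf.
have -> : [set w | Theta w <= z] = Theta @^-1` `]-oo, z].
  by apply/seteqP; split => w /=; rewrite in_itv.
rewrite hlaw //; have [z0|z0] := leP z 0.
  (* For z = 0 the intersection is the single point 0, of Lebesgue measure zero. *)
  rewrite Theta_dist0 //; have -> : `]-oo, z] `&` `[0, (2 * pi)[ = if z == 0 then [set 0] else set0.
    apply/seteqP; split => x /=.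
      rewrite !in_itv /= => -[xz /andP[x0 _]].
      have zE : z = 0 by apply/eqP; rewrite eq_le z0 (le_trans x0 xz).
      by rewrite zE eqxx /=; apply/eqP; rewrite eq_le x0 andbT -zE.
    by case: eqP => [->|//] ->; rewrite !in_itv /= lexx p2.
  by case: ifP => _; [rewrite integral_set1|rewrite integral_set0].
have [z1|z1] := ltP z (2 * pi).
  rewrite Theta_dist_mid ?ltW // -(itv z true false) ?ltW //; congr (integral _ _ _).
  apply/seteqP; split => x /=; rewrite !in_itv /=; first by move=> [-> /andP[->]].
  by move=> /andP[-> xz]; rewrite xz (le_lt_trans xz).
rewrite Theta_dist1 //; have -> : 1%:E = (Tc (2 * pi))%:E :> \bar R by rewrite Theta_cdf2pi.
rewrite -(itv (2 * pi) true true) //; congr (integral _ _ _).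
apply/seteqP; split => x /=; rewrite !in_itv /=; first by move=> [].
by move=> /andP[-> xz]; rewrite xz (le_trans (ltW xz)).
Qed.

End shifted_distribution.

Lemma indic_iff {R : realType} {T U : Type} (A : set T) (B : set U) x y :
  (A x <-> B y) -> \1_A x = \1_B y :> R.
Proof. by move=> h; rewrite !indicE /in_mem /mem /=; congr (_ %:R); congr nat_of_bool; apply/asboolP/asboolP => /h. Qed.

Section point_process_intensity.
Context {R : realType} {d : measure_display} {T : measurableType d}.
Variables (P : probability T R) (Z : R -> T -> R[i]).
Hypothesis CBM : two_sided_complex_BM P Z.
Variables (beta delta : R).
Hypotheses (beta_gt0 : 0 < beta) (delta_gt0 : 0 < delta).
Variables (alpha : R -> R -> T -> R) (Theta : T -> R).
Hypothesis sol : forall lambda, strong_solution P Z beta delta lambda (alpha lambda).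
Hypothesis alpha_good : {ae P, forall w, real_analytic (fun lambda => alpha lambda 0 w) /\
  {homo (fun lambda => alpha lambda 0 w) : x y / x < y}}.
Hypothesis law : Theta_law P delta Theta.
Hypothesis indep : independent P (sigma_of [set Theta]) (sigma_all Z).
Local Notation pi := (@pi R).
Local Notation mu := (@lebesgue_measure R).
Local Notation Tc := (Theta_cdf delta).
Local Notation F := (Theta_dist delta).

Let p2 : 0 < 2 * pi. Proof. by rewrite mulr_gt0 // pi_gt0. Qed.

Let mTheta : measurable_fun setT Theta. Proof. by have [] := law. Qed.

Let sigma_all_measurable : sigma_all Z `<=` measurable.
Proof.
apply: sigma_of_measurable => f [u [->|->]].
  exact: (BM_measurable (CBM_Re CBM)).
exact: (BM_measurable (CBM_Im CBM)).
Qed.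

Let past_sub_all s : past P Z s `<=` completed P (sigma_all Z).
Proof.
have sA : sigma_algebra setT (sigma_all Z) by exact: sigma_of_sigma_algebra.
apply: completed_le; apply: sigma_of_sub => // f [v [w [_ _ [->|->]]]].
  rewrite ReB_comp; apply: measurable_wrtB => //; apply: sigma_of_mem.
    by exists v; left.
  by exists w; left.
rewrite ImB_comp; apply: measurable_wrtB => //; apply: sigma_of_mem.
  by exists v; right.
by exists w; right.
Qed.

Let past_indep_Theta s A (B : set R) : past P Z s A -> measurable B ->
  P (A `&` Theta @^-1` B) = (P A * P (Theta @^-1` B))%E.
Proof.
move=> /past_sub_all FA mB.
apply: (indep_event_completed (F := sigma_all Z)) FA => //.
  by rewrite -[X in measurable X]setTI; exact: mTheta.
move=> C FC; rewrite setIC indep //; first exact: muleC.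
by apply: sigma_of_mem.
Qed.

Let past_pair s (f g : T -> R) (A : set (R * R)) : measurable_wrt (past P Z s) f ->
  measurable_wrt (past P Z s) g -> measurable A ->
  past P Z s ((fun w => (f w, g w)) @^-1` A).
Proof.
move=> mf mg mA; have sF := past_sigma_algebra P Z s.
rewrite -(sigma_algebra_id sF) in mf mg *.
move/measurable_wrtP in mf; move/measurable_wrtP in mg.
have h : measurable_fun (setT : set (g_sigma_algebraType (past P Z s)))
    (fun w : g_sigma_algebraType (past P Z s) => ((f w, g w) : R * R)).
  exact/measurable_fun_pair.
by rewrite -[X in _ X]setTI; exact: h.
Qed.

Let al lambda (w : T) : R := alpha lambda 0 w.

Let Fal lambda : measurable_wrt (past P Z 0) (al lambda).
Proof. exact: (sol_adapted (sol lambda)). Qed.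

Let mal lambda : measurable_fun setT (al lambda).
Proof. apply: measurable_wrt_measurable (Fal lambda); exact: past_measurable. Qed.

Let lt_set (f g : T -> R) : measurable_fun setT f -> measurable_fun setT g ->
  measurable [set w | f w < g w].
Proof.
move=> mf mg; rewrite (_ : [set w | _] = (g \- f) @^-1` `]0, +oo[); last first.
  by apply/seteqP; split => w /=; rewrite in_itv /= andbT subr_gt0.
by rewrite -[X in measurable X]setTI; apply: measurable_funB.
Qed.

Let le_set (f g : T -> R) : measurable_fun setT f -> measurable_fun setT g ->
  measurable [set w | f w <= g w].
Proof.
move=> mf mg; rewrite (_ : [set w | _] = (g \- f) @^-1` `[0, +oo[); last first.
  by apply/seteqP; split => w /=; rewrite in_itv /= andbT subr_ge0.
by rewrite -[X in measurable X]setTI; apply: measurable_funB.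
Qed.

Let shift (j : nat) : R := 2 * pi * (nth_int j)%:~R.

Let y (j : nat) (w : T) : R := Theta w + shift j.

Let my j : measurable_fun setT (y j). Proof. exact: measurable_funD. Qed.

(** The path values are adapted at time 0, hence measurable for the completed sigma-algebra of [Z]
    and independent of Theta, so they can be frozen. For frozen values the event says that Theta
    lies in an interval, whose probability is a difference of its distribution function. The maximum
    keeps the interval well ordered also where the path fails to increase. *)
Lemma level_crossing_prob p q j :
  P [set w | al p w < y j w /\ y j w <= al q w] =
  (\int[P]_w (F (Num.max (al p w) (al q w) - shift j) - F (al p w - shift j))%:E)%E.
Proof.
pose G (w : T) : R * R := (al p w, Num.max (al p w) (al q w)).
have mmax : measurable_fun setT (fun w => Num.max (al p w) (al q w)).
  exact: measurable_maxr.
have Fmax : measurable_wrt (past P Z 0) (fun w => Num.max (al p w) (al q w)).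
  move=> A mA.
  have -> : (fun w => Num.max (al p w) (al q w)) @^-1` A =
     (fun w => (al p w, al q w)) @^-1` ((fun z : R * R => Num.max z.1 z.2) @^-1` A) by [].
  apply: past_pair => //; rewrite -[X in measurable X]setTI.
  by apply: (measurable_maxr measurable_fst measurable_snd).
have mG : measurable_fun setT G by apply/measurable_fun_pair.
pose D := [set z : (R * R) * R | z.1.1 < z.2 + shift j /\ z.2 + shift j <= z.1.2].
have mD : measurable D.
  have m11 : measurable_fun setT (fun z : (R * R) * R => z.1.1).
    exact: (measurableT_comp measurable_fst measurable_fst).
  have m12 : measurable_fun setT (fun z : (R * R) * R => z.1.2).
    exact: (measurableT_comp measurable_snd measurable_fst).
  have m2 : measurable_fun setT (fun z : (R * R) * R => z.2 + shift j).
    by apply: measurable_funD => //; exact: measurable_snd.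
  have -> : D = (fun z : (R * R) * R => z.2 + shift j - z.1.1) @^-1` `]0, +oo[ `&`
      (fun z : (R * R) * R => z.1.2 - (z.2 + shift j)) @^-1` `[0, +oo[.
    by apply/seteqP; split => z /=; rewrite !in_itv /= !andbT subr_gt0 subr_ge0.
  by apply: measurableI; rewrite -[X in measurable X]setTI; apply: measurable_funB.
have ind (A : set (R * R)) (B : set R) : measurable A -> measurable B ->
    P (G @^-1` A `&` Theta @^-1` B) = (P (G @^-1` A) * P (Theta @^-1` B))%E.
  by move=> mA mB; apply: (past_indep_Theta (s := 0)) => //; exact: past_pair.
have mh : measurable_fun setT (fun z => (\1_D z)%:E : \bar R).
  by apply/measurable_EFinP; exact: measurable_indic.
have := @indep_ge0_integral _ _ _ P _ _ _ _ G Theta mG mTheta ind (fun z => (\1_D z)%:E) mh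
  (fun z => _).
have -> : (\int[P]_w (\1_D (G w, Theta w))%:E)%E = P [set w | al p w < y j w /\ y j w <= al q w].
  rewrite (_ : (fun w => _) = fun w => (\1_[set w | al p w < y j w /\ y j w <= al q w] w)%:E); last first.
    apply/funext => w; congr EFin; apply: indic_iff; rewrite /D /= -/(y j w); split=> -[h1 h2]; split => //.
      move: h2; rewrite le_max => /orP[h2|//].
      by move: (lt_le_trans h1 h2); rewrite ltxx.
    by rewrite le_max h2 orbT.
  rewrite integral_indic ?setIT //.
  rewrite (_ : [set w | _] = [set w | al p w < y j w] `&` [set w | y j w <= al q w]) //.
  by apply: measurableI; [exact: lt_set|exact: le_set].
move=> ->; last by move=> z; rewrite lee_fin.
apply: eq_integral => w _.
rewrite (_ : (fun v => (\1_D (G w, Theta v))%:E) = fun v => (\1_([set v | Theta v <= Num.max (al p w) (al q w) - shift j] `\`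
    [set v | Theta v <= al p w - shift j]) v)%:E); last first.
  apply/funext => v; congr EFin; apply: indic_iff; rewrite /D /= !lerBrDr.
  by split => -[h1 h2]; split => //; [apply/negP; rewrite -ltNge|rewrite ltNge; apply/negP].
have mT z : measurable [set v | Theta v <= z] by apply: le_set => //; exact: measurable_cst.
rewrite integral_indic //; last exact: measurableD.
rewrite setIT measureD //; last by rewrite (le_lt_trans (probability_le1 P _)) // ltry.
rewrite setIidr; last first.
  by move=> v /= h; rewrite (le_trans h) // lerD2r le_max lexx.
by rewrite EFinB; congr (_ - _)%E; exact: Theta_law_dist.
Qed.

Variable a : R -> R -> T -> R.
Hypothesis reg : forall lambda, regular_solution P Z beta delta lambda (a lambda).
Hypothesis aE : forall lambda, {ae P, forall w, forall u, alpha lambda u w = a lambda u w}.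

Let S0 x : 0 <= Theta_density delta x.
Proof. exact: (Theta_density_pdf delta_gt0 law).2. Qed.

Let mdist (f : T -> R) : measurable_fun setT f -> measurable_fun setT (F \o f).
Proof.
move=> mf; apply: measurableT_comp mf; apply: measurableT_comp.
  by apply: continuous_measurable_fun; exact: continuous_Theta_cdf.
apply: measurable_maxr; first exact: measurable_cst.
by apply: measurable_minr; [exact: measurable_id|exact: measurable_cst].
Qed.

Let mcdf (f : T -> R) : measurable_fun setT f -> measurable_fun setT (Tc \o f).
Proof.
move=> mf; apply: measurableT_comp mf; apply: continuous_measurable_fun.
exact: continuous_Theta_cdf.
Qed.

(** Summed over the translates, the differences of distribution functions give an increment of
    [Theta_cdf]; almost surely the maximum is the value at [q]. *)
Lemma level_crossing_series p q : p < q ->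
  (\sum_(j <oo) P [set w | (al p w < y j w /\ y j w <= al q w)%R] =
   (level_mean P delta a q 0 - level_mean P delta a p 0)%:E)%E.
Proof.
move=> pq; have mmax : measurable_fun setT (fun w => Num.max (al p w) (al q w)).
  exact: measurable_maxr.
pose t (j : nat) (w : T) := F (Num.max (al p w) (al q w) - shift j) - F (al p w - shift j).
have t0 j w : 0 <= t j w.
  by rewrite subr_ge0; apply: Theta_dist_le => //; rewrite lerD2r le_max lexx.
have mt j : measurable_fun setT (t j).
  apply: measurable_funB.
    by apply: (mdist (f := fun w => Num.max (al p w) (al q w) - shift j)); exact: measurable_funB.
  by apply: (mdist (f := fun w => al p w - shift j)); exact: measurable_funB.
rewrite (eq_eseriesr (g := fun j => \int[P]_w (t j w)%:E)%E); last first.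
  by move=> j _; exact: level_crossing_prob.
rewrite -integral_nneseries //; last 2 first.
- by move=> j; apply/measurable_EFinP.
- by move=> j w _; rewrite lee_fin.
have [lp ep] := level_meanE CBM beta_gt0 delta_gt0 reg p 0.
have [lq eq] := level_meanE CBM beta_gt0 delta_gt0 reg q 0.
rewrite /level_mean -ExB // ExE; last exact: L1B.
rewrite (eq_integral (fun w => (Tc (Num.max (al p w) (al q w)) - Tc (al p w))%:E)); last first.
  by move=> w _; rewrite shifted_dist_series // le_max lexx.
apply: ae_eq_integral => //.
- apply/measurable_EFinP; apply: measurable_funB.
    exact: (mcdf (f := fun w => Num.max (al p w) (al q w))).
  exact: (mcdf (f := al p)).
- by apply/measurable_EFinP; apply: L1_measurable (L1B lq lp).
apply: filterS3 (aE p) (aE q) alpha_good => w ap aq [_ incr] _.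
by rewrite max_r ?ltW //; [rewrite /al ap aq|exact: incr].
Qed.

Section good_paths.
Variable G : set T.
Hypotheses (mG : measurable G) (PG : P (~` G) = 0%E).
Hypothesis Gcont : forall w, G w -> continuous (al ^~ w).
Hypothesis Gincr : forall w, G w -> {homo al ^~ w : p q / p < q}.

Let Gle w : G w -> {mono al ^~ w : p q / p <= q}.
Proof. by move=> Gw; apply: le_mono; exact: Gincr. Qed.

Let Glt w : G w -> {mono al ^~ w : p q / p < q}.
Proof. by move=> Gw; apply: leW_mono; exact: Gle. Qed.

(* X j is the point of the process at which the path crosses Theta + shift j, on
   the event E j that it does. *)
Let E j : set T := G `&` \bigcup_m [set w | al (- m%:R) w < y j w /\ y j w <= al m%:R w].

Let mE j : measurable (E j).
Proof.
apply: measurableI => //; apply: bigcupT_measurable => m.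
rewrite (_ : [set w | _] = [set w | al (- m%:R) w < y j w] `&` [set w | y j w <= al m%:R w]) //.
by apply: measurableI; [exact: lt_set|exact: le_set].
Qed.

Let E_between j w p q : G w -> al p w < y j w -> y j w <= al q w -> E j w.
Proof.
move=> Gw h1 h2; split => //; exists (Num.trunc (`|p| + `|q|)).+1 => //=.
have := truncnS_gt (`|p| + `|q|); move: (_.+1%:R : R) => m hm.
have hp := ler_norm (- p); have hq := ler_norm q.
have p0 := normr_ge0 p; have q0 := normr_ge0 q; rewrite normrN in hp.
split; [apply: le_lt_trans h1|apply: le_trans h2 _]; rewrite Gle //; lra.
Qed.

(** Off [E j] the value 0 is a mere default, so below the law of [X j] is restricted to [E j]. *)
Let X j w : R := if `[< E j w >] then xget 0 [set x | al x w = y j w] else 0.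

Let X_level j w : E j w -> al (X j w) w = y j w.
Proof.
move=> Ew; rewrite /X asboolT //; case: xgetP => [x -> //|none].
have [Gw [m _ [h1 h2]]] := Ew.
have [|||x _ xE] := @IVT R (al ^~ w) (- m%:R) m%:R (y j w).
- by rewrite lerNl (le_trans _ (ler0n _ _)) // oppr_le0.
- by apply: continuous_subspaceT; exact: Gcont.
- by rewrite ge_min (ltW h1) le_max h2 orbT.
by case: (none x).
Qed.

Let X_unique j w x : G w -> al x w = y j w -> E j w /\ X j w = x.
Proof.
move=> Gw xE; have Ew : E j w.
  by apply: (@E_between j w (x - 1) x) => //; rewrite -xE // Glt // ltrBlDr ltrDl.
split => //; apply: (inc_inj (Gle Gw)) => /=.
by rewrite X_level // xE.
Qed.

Let X_gt j w q : E j w -> (q < X j w) = (al q w < y j w).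
Proof. by move=> Ew; rewrite -X_level // Glt //; case: Ew. Qed.

Let mX j : measurable_fun setT (X j).
Proof.
move=> mT; apply: (measurability _ (RGenOInfty.measurableE R)) => //.
move=> /= _ [_ [q ->] <-]; rewrite setTI.
have -> : X j @^-1` `]q, +oo[ = (E j `&` [set w | al q w < y j w]) `|`
    (~` E j `&` [set w | q < 0]).
  apply/seteqP; split => w /=; rewrite in_itv /= andbT.
    have [Ew|nE] := pselect (E j w); first by rewrite X_gt // => h; left.
    by rewrite {1}/X asboolF // => h; right.
  by move=> [[Ew h]|[nE h]]; [rewrite X_gt|rewrite /X asboolF].
apply: measurableU; apply: measurableI => //; first exact: lt_set.
  exact: measurableC.
by apply: lt_set; exact: measurable_cst.
Qed.

Let X_ocitv p q j : P (E j `&` X j @^-1` `]p, q]) =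
  P [set w | al p w < y j w /\ y j w <= al q w].
Proof.
have mS : measurable [set w | al p w < y j w /\ y j w <= al q w].
  rewrite (_ : [set w | _] = [set w | al p w < y j w] `&` [set w | y j w <= al q w]) //.
  by apply: measurableI; [exact: lt_set|exact: le_set].
have mS' : measurable (E j `&` X j @^-1` `]p, q]).
  by apply: measurableI => //; rewrite -[X in measurable X]setTI; exact: mX.
have eqG w : G w -> (E j `&` X j @^-1` `]p, q]) w <-> al p w < y j w /\ y j w <= al q w.
  move=> Gw; split => /=.
    by rewrite in_itv /= => -[Ew]; rewrite X_gt // leNgt X_gt // -leNgt => /andP[].
  move=> [h1 h2]; have Ew := E_between Gw h1 h2.
  by rewrite in_itv /= X_gt // leNgt X_gt // -leNgt h1 h2.
have := @measure_symdiff _ _ _ P _ _ setT mS' mS measurableT; rewrite !setIT; apply.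
apply: (@negligibleS _ _ _ _ (~` G)); last by exists (~` G); split => //; exact: measurableC.
by move=> w [[h1 h2]|[h1 h2]] Gw; apply: h2; apply/(eqG w Gw).
Qed.

Let m1 := mseries (fun j => restricted_law P (mE j) (mX j) : {measure set (measurableTypeR R) -> \bar R}) 0.

Let cI : measurable_fun setT (intensity P delta a).
Proof. by apply: continuous_measurable_fun; exact: (continuous_intensity CBM beta_gt0 delta_gt0 reg). Qed.

Let I0 x : 0 <= intensity P delta a x.
Proof. exact: (intensity_ge0 delta_gt0 reg). Qed.

Let m2 := density_measure cI I0.

Let m1_ocitv p q : p < q -> m1 `]p, q] = (level_mean P delta a q 0 - level_mean P delta a p 0)%:E.
Proof.
move=> pq; rewrite -level_crossing_series // /m1 /mseries.
by apply: eq_eseriesr => j _; exact: X_ocitv.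
Qed.

(** Both sides are measures in [A], finite and equal on intervals ]p, q] by [level_crossing_series]
    and [integral_intensity]. *)
Lemma expected_points_density A : measurable A ->
  (\sum_(j <oo) P (E j `&` X j @^-1` A) = \int[mu]_(x in A) (intensity P delta a x)%:E)%E.
Proof.
move=> mA; apply: (@measure_eq_ocitv R m1 m2) => // p q pq; last first.
  by apply: (@eq_ind_r _ _ (fun z => z < +oo)%E _ _ (m1_ocitv pq)); exact: ltry.
apply: (eq_trans (m1_ocitv pq)); rewrite /= /density_measure integral_itv_obnd_cbnd; last first.
  by apply/measurable_EFinP; exact: measurable_funTS.
by rewrite (integral_intensity CBM beta_gt0 delta_gt0 reg).
Qed.

(** On [G] every point of the process is [X j] for some index j, and different indices give
    different points because their levels differ; so the count is a series of indicators. *)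
Lemma expected_points A : measurable A ->
  (\int[P]_w counting (HP_process alpha Theta w `&` A) =
   \sum_(j <oo) P (E j `&` X j @^-1` A))%E.
Proof.
move=> mA; have mEX j : measurable (E j `&` X j @^-1` A).
  by apply: measurableI => //; rewrite -[X in measurable X]setTI; exact: mX.
have mind j : measurable_fun setT (fun w => (\1_(E j `&` X j @^-1` A) w)%:E : \bar R).
  by apply/measurable_EFinP; exact: measurable_indic.
(* The count agrees with the measurable series on [G], hence almost everywhere; it is not itself
   known to be measurable. *)
rewrite (ge0_integral_ae_eq (h := fun w => \sum_(j <oo) (\1_(E j `&` X j @^-1` A) w)%:E)%E) //.
- rewrite integral_nneseries //.
  by apply: eq_eseriesr => j _; rewrite integral_indic ?setIT.
- apply: ge0_emeasurable_sum => // j w _ _; by rewrite lee_fin.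
- by move=> w; apply: nneseries_ge0 => j _ _; rewrite lee_fin.
exists (~` G); split => //; first exact: measurableC.
move=> w /= nE Gw; apply: nE.
pose B j := `[< (E j `&` X j @^-1` A) w >].
have -> : HP_process alpha Theta w `&` A = [set x | exists2 j, B j & X j w = x].
  apply/seteqP; split => x /=.
    move=> [[n xE] Ax]; have [j jE] := nth_int_surj n.
    have [|Ew Xx] := @X_unique j w x Gw; first by rewrite /al xE /y /shift jE.
    by exists j => //; apply/asboolP; split => //=; rewrite Xx.
  move=> [j /asboolP[Ew AX] <-]; split => //; exists (nth_int j).
  by rewrite -/(al (X j w) w) X_level.
rewrite counting_points.
  by apply: eq_eseriesr => j _; congr EFin; apply: indic_iff; split => /asboolP.
move=> i j /asboolP[Ei _] /asboolP[Ej _] Xij.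
have : y i w = y j w by rewrite -X_level // -X_level // Xij.
move/addrI; rewrite /shift => /(mulfI (lt0r_neq0 p2)) /intr_inj.
exact: nth_int_inj.
Qed.

End good_paths.

Lemma HP_one_point_function :
  one_point_function P (HP_process alpha Theta) (intensity P delta a).
Proof.
have [N0 [mN PN sN]] := alpha_good.
have mG := measurableC mN; have PG : P (~` (~` N0)) = 0%E by rewrite setCK.
have good w : (~` N0) w -> real_analytic (al ^~ w) /\ {homo al ^~ w : p q / p < q}.
  by move=> nw; apply: contrapT => h; apply: nw; exact: sN.
have cont w (nw : (~` N0) w) : continuous (al ^~ w).
  by apply: real_analytic_continuous; exact: (good w nw).1.
have incr w (nw : (~` N0) w) := (good w nw).2.
split.
- by apply: continuous_measurable_fun; exact: (continuous_intensity CBM beta_gt0 delta_gt0 reg).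
- by move=> x; apply: (intensity_ge0 delta_gt0 reg).
by move=> A mA; rewrite (expected_points mG PG cont incr) // expected_points_density.
Qed.

Lemma mean_cos_series lambda :
  \sum_(1 <= k < n) (rising (- delta) k / rising (1 + delta) k
     * fine ('E_P[(fun w => cos (k%:R * alpha lambda 0 w))%R])%E)
  @[n --> \oo] --> lsum delta (fun k => mc P (a lambda) k 0).
Proof.
have mcE' k : fine ('E_P[(fun w => cos (k%:R * alpha lambda 0 w))%R])%E = mc P (a lambda) k 0.
  rewrite mcE unlock; apply: Ex_ae_eq.
  - apply: (measurableT_comp measurable_cosR); apply: measurable_funM => //.
    exact: mal.
  - apply: (measurableT_comp measurable_cosR); apply: measurable_funM => //.
    exact: (reg_measurable (reg lambda)).
  by apply: filterS (aE lambda) => w ->.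
(* The sum over 1 <= k < n + 1 is [psum] of length n, whose own index starts at 0. *)
rewrite -(cvg_shiftS (fun n => \sum_(1 <= k < n) _)) /=.
pose v k := mc P (a lambda) k 0.
have v1 k : `|v k| <= 1 by exact: (mean_cos_le1 (P := P) (reg lambda) k%:R 0 0).
rewrite (_ : (fun n => _) = psum delta v); first exact: (psum_cvg delta_gt0 v1).
apply/funext => n; rewrite big_add1 /= big_mkord; apply: eq_bigr => k _.
by rewrite mcE'.
Qed.

End point_process_intensity.

Theorem theorem9 (R : realType) (d : measure_display) (T : measurableType d)
    (P : probability T R) (delta beta : R)
    (Z : R -> T -> R[i]) (alpha : R -> R -> T -> R) (Theta : T -> R) :
  0 < delta -> 0 < beta ->
  two_sided_complex_BM P Z ->
  (forall lambda, strong_solution P Z beta delta lambda (alpha lambda)) ->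
  {ae P, forall w, real_analytic (fun lambda => alpha lambda 0 w) /\
                   {homo (fun lambda => alpha lambda 0 w) : x y / x < y}} ->
  Theta_law P delta Theta ->
  independent P (sigma_of [set Theta]) (sigma_all Z) ->
  exists Sigma : R -> R,
    (forall lambda,
       \sum_(1 <= k < n) (rising (- delta) k / rising (1 + delta) k
          * fine ('E_P[(fun w => cos (k%:R * alpha lambda 0 w))%R])%E)
       @[n --> \oo] --> Sigma lambda) /\
    one_point_function P (HP_process alpha Theta)
      (fun lambda => 1 / (2 * pi) + 1 / pi * Sigma lambda).
Proof.
move=> delta_gt0 beta_gt0 CBM sol good law indep.
(* One regular version for each lambda. The null set off which it differs from [alpha] may depend on
   lambda: the version enters through expectations at fixed lambda, and the path in lambda remains
   that of [alpha]. *)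
have /choice[a ha] : forall lambda, exists a, regular_solution P Z beta delta lambda a /\
    {ae P, forall w, forall u, alpha lambda u w = a u w}.
  by move=> lambda; have [a ra aE] := strong_solution_regular CBM (sol lambda); exists a.
have reg lambda := (ha lambda).1; have aE lambda := (ha lambda).2.
exists (fun lambda => lsum delta (fun k => mc P (a lambda) k 0)); split.
  by exact: (mean_cos_series delta_gt0 sol reg aE).
exact: (HP_one_point_function CBM beta_gt0 delta_gt0 sol good law indep reg aE).
Qed.
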